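(* Let $\omega$ be the Euclidean area form on $\mathbb{R}^2$. For a smooth loop $\alpha: S^1 \to \mathbb{R}^2 \setminus \mathbb{Z}^2$ that is contractible in $\mathbb{R}^2 \setminus \mathbb{Z}^2$, define $$\mathrm{Area}(\alpha) = \inf \int_{D^2} |f^*\omega|,$$ where the infimum is taken over all maps $f: D^2 \to \mathbb{R}^2 \setminus \mathbb{Z}^2$ with $f|_{S^1} = \alpha$ (here $|f^*\omega|$ denotes the absolute value of the pulled-back 2-form, i.e. the density $|\det df|\,ds\,dt$). Then for every smooth contractible loop $\alpha: S^1 \to \mathbb{R}^2 \setminus \mathbb{Z}^2$, $$\mathrm{Area}(\alpha) \leq (1+\sqrt{2})\, \mathrm{Length}(\alpha),$$ where $\mathrm{Length}$ is the Euclidean length. *)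

(* Defs.v *)
From Stdlib Require Import Reals.
From Coquelicot Require Import Coquelicot.
Open Scope R_scope.

Definition lattice (p : R * R) : Prop :=
  exists m n : Z, p = (IZR m, IZR n).

(* Loops S^1 -> R^2 are represented as 1-periodic maps R -> R * R
   (S^1 = R/Z, t |-> (cos 2 pi t, sin 2 pi t)). *)
Definition periodic_loop (a : R -> R * R) : Prop :=
  forall t, a (t + 1) = a t.

Definition smooth_loop (a : R -> R * R) : Prop :=
  forall (n : nat) (t : R),
    ex_derive_n (fun s => fst (a s)) n t /\ ex_derive_n (fun s => snd (a s)) n t.

Definition avoids_lattice (a : R -> R * R) : Prop :=
  forall t, ~ lattice (a t).

Definition contractible_loop (a : R -> R * R) : Prop :=
  exists (H : R * R -> R * R) (c : R * R),
    (forall p, continuous H p) /\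
    (forall t, H (0, t) = a t) /\
    (forall t, H (1, t) = c) /\
    (forall s t, 0 <= s <= 1 -> H (s, t + 1) = H (s, t)) /\
    (forall s t, 0 <= s <= 1 -> ~ lattice (H (s, t))).

Definition Length (a : R -> R * R) : R :=
  RInt (fun t => sqrt ((Derive (fun s => fst (a s)) t) ^ 2
                      + (Derive (fun s => snd (a s)) t) ^ 2)) 0 1.

Definition smooth_map2 (f : R * R -> R * R) : Prop :=
  forall (n : nat) (x y : R),
    ex_diff_n (fun u v => fst (f (u, v))) n x y /\
    ex_diff_n (fun u v => snd (f (u, v))) n x y.

Definition jac_det (f : R * R -> R * R) (x y : R) : R :=
  Derive (fun u => fst (f (u, y))) x * Derive (fun v => snd (f (x, v))) y
  - Derive (fun v => fst (f (x, v))) y * Derive (fun u => snd (f (u, y))) x.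

Definition disk_abs_area (f : R * R -> R * R) : R :=
  RInt (fun x => RInt (fun y => Rabs (jac_det f x y))
                      (- sqrt (1 - x ^ 2)) (sqrt (1 - x ^ 2))) (-1) 1.

(* f : D^2 -> R^2 \ Z^2 smooth with f restricted to S^1 equal to the loop a.
   (A smooth map on the closed disk is taken as the restriction of a smooth
   map on R^2.) *)
Definition filling (a : R -> R * R) (f : R * R -> R * R) : Prop :=
  smooth_map2 f /\
  (forall x y, x ^ 2 + y ^ 2 <= 1 -> ~ lattice (f (x, y))) /\
  (forall t, f (cos (2 * PI * t), sin (2 * PI * t)) = a t).

Definition Area (a : R -> R * R) : Rbar :=
  Glb_Rbar (fun A => exists f, filling a f /\ A = disk_abs_area f).

(* Main.v *)
(** A loop that is contractible in the punctured plane lifts to the tree of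
    closed unit squares (with their corners removed) that is its universal
    cover. Root this tree at the square of the constant loop, and replace the
    loop by a polygon each of whose edges lies in one square. Every square
    retracts onto the edge shared with its parent by a bilinear map that
    shrinks the other three edges by the factor 1/3. Collapsing the squares of
    maximal depth, depth by depth, brings the polygon into the root square,
    where it is coned off. Because of the geometric series, the area swept by
    a segment that lies on an edge of a square is at most its length, in total
    over all further collapses; an arbitrary segment sweeps at most
    2 sqrt(10) / 3 < 12/5 times its length, which leaves room below
    1 + sqrt 2 for the passage from the loop to the polygon.

    All homotopies are linear between loops and are glued by smooth steps, so
    the resulting filling of the disk is smooth. *)

Require Import Defs.
From Stdlib Require Import Reals Lra Lia ZArith List Classical ClassicalEpsilon.
From Stdlib Require Import FunctionalExtensionality.
From Coquelicot Require Import Coquelicot.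
Open Scope R_scope.

(** * Smooth functions of one and two variables *)

(** The collapses are run as a potential argument: each edge of the polygon carries a weight that
    dominates the area of its next collapse plus the weight of its image, so the sum of the initial
    weights bounds the whole area and no series is summed. The ratio 1/3 comes from the edge
    opposite to the root edge: a segment of length L there sweeps a trapezoid of area (1 + r) L / 2
    and leaves an image of length r L, and (1 + r) / 2 + r <= 1 exactly when r <= 1/3. A general
    segment with components v1 along and v2 across the root edge is charged 2 (|v1| + |v2| / 3),
    which Cauchy-Schwarz compares with its length.

    Contractibility enters through the lift. The homotopy is merely continuous, hence only sampled,
    on a grid so fine that every small triangle of samples meets at most two squares, and these
    share an edge. Moves in the tree then commute around each triangle, and the lift of the given
    loop closes up because that of the constant loop does. *)

Fixpoint Cn1 (n : nat) (D : R -> Prop) (f : R -> R) : Prop :=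
  (forall x, D x -> continuous f x) /\
  match n with
  | O => True
  | S m => exists f', (forall x, D x -> is_derive f x (f' x)) /\ Cn1 m D f'
  end.

(** Derivatives are given as witnesses instead of [Derive] terms, which makes closure under sums,
    products and composition direct. The domain D is a parameter because the filling of the disk is
    given by different formulas on different open sets. *)
Fixpoint Cn2 (n : nat) (D : R -> R -> Prop) (f : R -> R -> R) : Prop :=
  (forall x y, D x y -> continuity_2d_pt f x y) /\
  match n with
  | O => True
  | S m => exists fx fy,
      (forall x y, D x y ->
         is_derive (fun u : R => f u y) x (fx x y) /\
         is_derive (fun v : R => f x v) y (fy x y)) /\
      Cn2 m D fx /\ Cn2 m D fy
  end.

Definition smooth1 (D : R -> Prop) (f : R -> R) : Prop := forall n, Cn1 n D f.
Definition smooth2 (D : R -> R -> Prop) (f : R -> R -> R) : Prop :=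
  forall n, Cn2 n D f.

Definition open2 (D : R -> R -> Prop) : Prop :=
  forall x y, D x y -> locally_2d D x y.

Notation everywhere := (fun _ : R => True).

Lemma Cn1_cont n D f : Cn1 n D f -> forall x, D x -> continuous f x.
Proof. destruct n; intros H; apply H. Qed.

Lemma Cn2_cont n D f : Cn2 n D f -> forall x y, D x y -> continuity_2d_pt f x y.
Proof. destruct n; intros H; apply H. Qed.

Lemma Cn2_pred n D f : Cn2 (S n) D f -> Cn2 n D f.
Proof.
  revert f; induction n as [|n IH]; intros f [Hc [fx [fy [Hd [Hx Hy]]]]].
  - split; trivial.
  - split; trivial. exists fx, fy; split; trivial. split; now apply IH.
Qed.

Lemma Cn1_ext n (D : R -> Prop) (f g : R -> R) :
  open D -> (forall x, D x -> f x = g x) -> Cn1 n D f -> Cn1 n D g.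
Proof.
  intros HD; revert f g; induction n as [|n IH]; intros f g Hfg.
  - intros [Hc _]; split; trivial. intros x Dx.
    apply (continuous_ext_loc g f); [|now apply Hc].
    generalize (HD x Dx); apply filter_imp; intros u Du; auto.
  - intros [Hc [f' [Hd Hf]]]; split.
    + intros x Dx. apply (continuous_ext_loc g f); [|now apply Hc].
      generalize (HD x Dx); apply filter_imp; intros u Du; auto.
    + exists f'; split; trivial. intros x Dx.
      apply (is_derive_ext_loc f); [|now apply Hd].
      generalize (HD x Dx); apply filter_imp; intros u Du; auto.
Qed.

Lemma locally_2d_slice1 (P : R -> R -> Prop) x y :
  locally_2d P x y -> locally x (fun u => P u y).
Proof.
  intros [d Hd]; exists d; intros u Hu; apply Hd; trivial.
  rewrite Rminus_diag, Rabs_R0; apply cond_pos.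
Qed.

Lemma locally_2d_slice2 (P : R -> R -> Prop) x y :
  locally_2d P x y -> locally y (fun v => P x v).
Proof.
  intros [d Hd]; exists d; intros u Hu; apply Hd; trivial.
  rewrite Rminus_diag, Rabs_R0; apply cond_pos.
Qed.

Lemma Cn2_ext n D f g :
  open2 D -> (forall x y, D x y -> f x y = g x y) -> Cn2 n D f -> Cn2 n D g.
Proof.
  intros HD Hfg.
  assert (Hloc : forall x y, D x y -> locally_2d (fun u v => f u v = g u v) x y).
  { intros x y Dxy. generalize (HD x y Dxy); apply locally_2d_impl.
    apply locally_2d_forall; auto. }
  assert (HC : Cn2 0 D f -> Cn2 0 D g).
  { intros [Hc _]; split; trivial. intros x y Dxy.
    apply (continuity_2d_pt_ext_loc f); auto. }
  destruct n as [|n].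
  - exact HC.
  - intros [Hc [fx [fy [Hd H]]]]; split; [now apply HC|].
    exists fx, fy; split; trivial. intros x y Dxy; split.
    + apply (is_derive_ext_loc (fun u => f u y)); [|now apply Hd].
      apply (locally_2d_slice1 (fun u v => f u v = g u v)); auto.
    + apply (is_derive_ext_loc (fun v => f x v)); [|now apply Hd].
      apply (locally_2d_slice2 (fun u v => f u v = g u v)); auto.
Qed.

Lemma Cn2_const n D c : Cn2 n D (fun _ _ => c).
Proof.
  revert c; induction n as [|n IH]; intros c; split; trivial;
    try (intros; apply continuity_2d_pt_const).
  exists (fun _ _ => 0), (fun _ _ => 0); split; [|split; auto].
  intros x y _; split; apply @is_derive_const.
Qed.

Lemma Cn2_fst n D : Cn2 n D (fun x _ => x).
Proof.
  destruct n as [|n]; split; trivial;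
    try (intros; apply continuity_2d_pt_id1).
  exists (fun _ _ => 1), (fun _ _ => 0); split; [|split; apply Cn2_const].
  intros x y _; split; [apply @is_derive_id | apply @is_derive_const].
Qed.

Lemma Cn2_snd n D : Cn2 n D (fun _ y => y).
Proof.
  destruct n as [|n]; split; trivial;
    try (intros; apply continuity_2d_pt_id2).
  exists (fun _ _ => 0), (fun _ _ => 1); split; [|split; apply Cn2_const].
  intros x y _; split; [apply @is_derive_const | apply @is_derive_id].
Qed.

Lemma Cn2_plus n D f g : Cn2 n D f -> Cn2 n D g -> Cn2 n D (fun x y => f x y + g x y).
Proof.
  revert f g; induction n as [|n IH]; intros f g.
  - intros [Hf _] [Hg _]; split; trivial; intros.
    apply continuity_2d_pt_plus; auto.
  - intros [Hf [fx [fy [Df [Hfx Hfy]]]]] [Hg [gx [gy [Dg [Hgx Hgy]]]]].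
    split; [intros; apply continuity_2d_pt_plus; auto|].
    exists (fun x y => fx x y + gx x y), (fun x y => fy x y + gy x y).
    split; [|split; auto].
    intros x y Dxy; split; apply @is_derive_plus;
      (apply Df || apply Dg); trivial.
Qed.

Lemma Cn2_mult n D f g : Cn2 n D f -> Cn2 n D g -> Cn2 n D (fun x y => f x y * g x y).
Proof.
  revert f g; induction n as [|n IH]; intros f g.
  - intros [Hf _] [Hg _]; split; trivial; intros.
    apply continuity_2d_pt_mult; auto.
  - intros HF HG; pose proof (Cn2_pred _ _ _ HF) as HF'.
    pose proof (Cn2_pred _ _ _ HG) as HG'. revert HF HG.
    intros [Hf [fx [fy [Df [Hfx Hfy]]]]] [Hg [gx [gy [Dg [Hgx Hgy]]]]].
    split; [intros; apply continuity_2d_pt_mult; auto|].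
    exists (fun x y => fx x y * g x y + f x y * gx x y),
           (fun x y => fy x y * g x y + f x y * gy x y).
    split; [|split; apply Cn2_plus; auto].
    intros x y Dxy; split.
    + apply (is_derive_mult (fun u => f u y) (fun u => g u y)).
      now apply Df. now apply Dg. intros; apply Rmult_comm.
    + apply (is_derive_mult (fun u => f x u) (fun u => g x u)).
      now apply Df. now apply Dg. intros; apply Rmult_comm.
Qed.

Lemma Cn2_comp n (E : R -> Prop) D g f :
  Cn1 n E g -> Cn2 n D f -> (forall x y, D x y -> E (f x y)) ->
  Cn2 n D (fun x y => g (f x y)).
Proof.
  revert f g; induction n as [|n IH]; intros f g.
  - intros [Hg _] [Hf _] HE; split; trivial; intros.
    apply (continuity_1d_2d_pt_comp g f); auto.
    apply continuity_pt_filterlim; apply Hg; auto.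
  - intros HG HF HE. pose proof (Cn2_pred _ _ _ HF) as HF'.
    revert HG HF. intros [Hg [g' [Dg Hg']]] [Hf [fx [fy [Df [Hfx Hfy]]]]].
    split.
    { intros; apply (continuity_1d_2d_pt_comp g f); auto.
      apply continuity_pt_filterlim; apply Hg; auto. }
    exists (fun x y => fx x y * g' (f x y)), (fun x y => fy x y * g' (f x y)).
    split; [|split; apply Cn2_mult; auto].
    intros x y Dxy; split.
    + apply (is_derive_comp g (fun u => f u y)); [apply Dg | apply Df]; auto.
    + apply (is_derive_comp g (fun u => f x u)); [apply Dg | apply Df]; auto.
Qed.

(** Together with [Cn1_as_Cn2], this reads off the one-variable closure rules from the two-variable
    ones, so that each is proved once. *)
Lemma Cn2_slice n (E : R -> Prop) F :
  Cn2 n (fun x _ => E x) F -> Cn1 n E (fun x => F x 0).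
Proof.
  assert (Hc : forall F, (forall x y, E x -> continuity_2d_pt F x y) ->
     forall x, E x -> continuous (fun x => F x 0) x).
  { intros G HG x Ex.
    apply filterlim_locally; intros eps.
    generalize (HG x 0 Ex eps); intros H.
    exact (locally_2d_slice1 _ _ _ H). }
  revert F; induction n as [|n IH]; intros F.
  - intros [H _]; split; trivial. now apply Hc.
  - intros [H [fx [fy [Df [Hx _]]]]]; split; [now apply Hc|].
    exists (fun x => fx x 0); split; [|now apply IH].
    intros x Ex; now apply (Df x 0).
Qed.

Lemma Cn1_as_Cn2 n E f : Cn1 n E f -> Cn2 n (fun x _ => E x) (fun x _ => f x).
Proof.
  intros Hf; apply (Cn2_comp n E); trivial. apply Cn2_fst.
Qed.

Lemma Cn1_const n D c : Cn1 n D (fun _ => c).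
Proof. apply (Cn2_slice n D (fun _ _ => c)), Cn2_const. Qed.

Lemma Cn1_id n D : Cn1 n D (fun x => x).
Proof. apply (Cn2_slice n D (fun x _ => x)), Cn2_fst. Qed.

Lemma Cn1_plus n D f g : Cn1 n D f -> Cn1 n D g -> Cn1 n D (fun x => f x + g x).
Proof.
  intros Hf Hg; apply (Cn2_slice n D (fun x _ => f x + g x)).
  apply Cn2_plus; now apply Cn1_as_Cn2.
Qed.

Lemma Cn1_mult n D f g : Cn1 n D f -> Cn1 n D g -> Cn1 n D (fun x => f x * g x).
Proof.
  intros Hf Hg; apply (Cn2_slice n D (fun x _ => f x * g x)).
  apply Cn2_mult; now apply Cn1_as_Cn2.
Qed.

Lemma Cn1_comp n (E D : R -> Prop) g f :
  Cn1 n E g -> Cn1 n D f -> (forall x, D x -> E (f x)) -> Cn1 n D (fun x => g (f x)).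
Proof.
  intros Hg Hf HE; apply (Cn2_slice n D (fun x _ => g (f x))).
  apply (Cn2_comp n E); trivial. now apply Cn1_as_Cn2. auto.
Qed.

(** The derivative of the inverse is a product of inverses, so the induction on the order closes
    up. *)
Lemma Cn1_inv n : Cn1 n (fun x => x <> 0) Rinv.
Proof.
  assert (Hd : forall x, x <> 0 -> is_derive Rinv x (-1 * (/ x * / x))).
  { intros x Hx. auto_derive; trivial. field; trivial. }
  assert (Hc : forall x, x <> 0 -> continuous Rinv x).
  { intros x Hx. apply (ex_derive_continuous Rinv). eexists; now apply Hd. }
  induction n as [|n IH]; split; trivial.
  exists (fun x => -1 * (/ x * / x)); split; trivial.
  apply Cn1_mult; [apply Cn1_const|]. now apply Cn1_mult.
Qed.

Lemma Cn1_atan n : Cn1 n everywhere atan.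
Proof.
  assert (Hd : forall x, is_derive atan x (/ (1 + x * x))).
  { intros x; apply is_derive_atan. }
  assert (Hc : forall x, continuous atan x).
  { intros x. apply (ex_derive_continuous atan). eexists; now apply Hd. }
  destruct n as [|n]; split; auto. exists (fun x => / (1 + x * x)); split; auto.
  apply (Cn1_comp n (fun x => x <> 0)).
  - apply Cn1_inv.
  - apply Cn1_plus; [apply Cn1_const|]. apply Cn1_mult; apply Cn1_id.
  - intros x _; nra.
Qed.

Lemma Cn2_opp n D f : Cn2 n D f -> Cn2 n D (fun x y => - f x y).
Proof.
  intros Hf; replace (fun x y => - f x y) with (fun x y => -1 * f x y).
  - apply Cn2_mult; trivial; apply Cn2_const.
  - do 2 (apply FunctionalExtensionality.functional_extensionality; intro); ring.
Qed.

Lemma Cn2_minus n D f g : Cn2 n D f -> Cn2 n D g -> Cn2 n D (fun x y => f x y - g x y).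
Proof. intros Hf Hg; apply Cn2_plus; trivial; now apply Cn2_opp. Qed.

Lemma Cn1_opp n D f : Cn1 n D f -> Cn1 n D (fun x => - f x).
Proof.
  intros Hf; apply (Cn2_slice n D (fun x _ => - f x)).
  apply Cn2_opp; now apply Cn1_as_Cn2.
Qed.

Lemma Cn1_minus n D f g : Cn1 n D f -> Cn1 n D g -> Cn1 n D (fun x => f x - g x).
Proof. intros Hf Hg; apply Cn1_plus; trivial; now apply Cn1_opp. Qed.

Lemma Cn2_div n D f g :
  Cn2 n D f -> Cn2 n D g -> (forall x y, D x y -> g x y <> 0) ->
  Cn2 n D (fun x y => f x y / g x y).
Proof.
  intros Hf Hg Hn; apply Cn2_mult; trivial.
  now apply (Cn2_comp n (fun x => x <> 0)); [apply Cn1_inv| |].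
Qed.

Lemma Cn1_div n D f g :
  Cn1 n D f -> Cn1 n D g -> (forall x, D x -> g x <> 0) ->
  Cn1 n D (fun x => f x / g x).
Proof.
  intros Hf Hg Hn; apply Cn1_mult; trivial.
  now apply (Cn1_comp n (fun x => x <> 0)); [apply Cn1_inv| |].
Qed.

Lemma ex_derive_n_smooth1 f :
  (forall n x, ex_derive_n f n x) -> smooth1 everywhere f.
Proof.
  intros Hf n. cut (forall k, Cn1 n everywhere (Derive_n f k)).
  { intros H; exact (H O). }
  assert (Hd : forall k x, is_derive (Derive_n f k) x (Derive_n f (S k) x)).
  { intros k x; apply Derive_correct. exact (Hf (S k) x). }
  assert (Hc : forall k x, continuous (Derive_n f k) x).
  { intros k x. apply @ex_derive_continuous. eexists; apply Hd. }
  induction n as [|n IH]; intros k; split; auto.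
  exists (Derive_n f (S k)); split; auto.
Qed.

Lemma Cn2_ex_diff_n n D f :
  open2 D -> Cn2 n D f -> forall x y, D x y -> ex_diff_n f n x y.
Proof.
  intros HD; revert f; induction n as [|n IH]; intros f.
  - intros [Hc _] x y Dxy; split; auto.
  - intros [Hc [fx [fy [Hd [Hx Hy]]]]] x y Dxy; split; auto.
    split; [exists (fx x y); exact (proj1 (Hd x y Dxy))|].
    split; [exists (fy x y); exact (proj2 (Hd x y Dxy))|].
    split.
    + apply IH; trivial. revert Hx; apply Cn2_ext; trivial.
      intros u v Duv; symmetry; apply is_derive_unique; now apply Hd.
    + apply IH; trivial. revert Hy; apply Cn2_ext; trivial.
      intros u v Duv; symmetry; apply is_derive_unique; now apply Hd.
Qed.

Lemma smooth2_local f :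
  (forall x y, exists D g, D x y /\ open2 D /\ smooth2 D g /\
     forall u v, D u v -> f u v = g u v) ->
  forall n x y, ex_diff_n f n x y.
Proof.
  intros H n x y. destruct (H x y) as [D [g [Dxy [HD [Hg Hfg]]]]].
  apply (Cn2_ex_diff_n n D); trivial.
  apply (Cn2_ext n D g); trivial. intros u v Duv; symmetry; auto.
Qed.

(** The local models and their derivatives depend on the point, so the induction runs on
    [Derive_n f k], a single global function that agrees locally with each of them. *)
Lemma Cn1_local n f :
  (forall x, exists D g, D x /\ open D /\ smooth1 D g /\
     forall u, D u -> f u = g u) -> Cn1 n everywhere f.
Proof.
  intros H.
  assert (Hn : forall k x, ex_derive_n f k x).
  { cut (forall k m x, ex_derive_n f k x /\ exists D, D x /\ open D /\ Cn1 m D (Derive_n f k)).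
    { intros A k x; apply (A k O x). }
    induction k as [|k IH]; intros m x.
    - split; [exact I|]. destruct (H x) as [D [g [Dx [HD [Hg Hfg]]]]].
      exists D; repeat split; trivial. apply (Cn1_ext m D g); auto.
      intros u Du; symmetry; auto.
    - destruct (IH (S m) x) as [_ [D [Dx [HD [Hc [f' [Hd Hf']]]]]]]. split.
      + eexists; now apply Hd.
      + exists D; repeat split; trivial. apply (Cn1_ext m D f'); trivial.
        intros u Du; symmetry; apply is_derive_unique; now apply Hd. }
  now apply ex_derive_n_smooth1.
Qed.

(** * A smooth step *)

(* [expinv 0] is the classical flat function exp(-1/x); the factors (1/x)^n
   make the family closed under differentiation. *)
Definition expinv (n : nat) (x : R) : R :=
  if Rlt_dec 0 x then (/ x) ^ n * exp (- / x) else 0.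

Lemma expinv_pos n x : 0 < x -> 0 < expinv n x.
Proof.
  intros Hx; unfold expinv; destruct (Rlt_dec 0 x) as [_|]; [|lra].
  apply Rmult_lt_0_compat; [apply pow_lt, Rinv_0_lt_compat; lra | apply exp_pos].
Qed.

Lemma expinv_neg n x : x <= 0 -> expinv n x = 0.
Proof. intros Hx; unfold expinv; destruct (Rlt_dec 0 x); lra. Qed.

Lemma expinv_ge0 n x : 0 <= expinv n x.
Proof.
  destruct (Rlt_dec 0 x) as [H|H]; [apply Rlt_le, expinv_pos; lra|].
  rewrite expinv_neg; lra.
Qed.

Lemma expinv_S n x : expinv n x = x * expinv (S n) x.
Proof.
  unfold expinv; destruct (Rlt_dec 0 x) as [H|H]; [|ring].
  simpl; field; lra.
Qed.

(** Raise u / m <= exp (u / m) to the power m. *)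
Lemma pow_exp_bound (m : nat) u : 0 < u -> u ^ m * exp (- u) <= INR m ^ m.
Proof.
  intros Hu. destruct m as [|m].
  - simpl. rewrite Rmult_1_l, <- exp_0. left; apply exp_increasing; lra.
  - set (k := S m). assert (Hk : 0 < INR k) by (apply lt_0_INR; lia).
    assert (H1 : u / INR k <= exp (u / INR k)).
    { generalize (exp_ineq1_le (u / INR k)); lra. }
    assert (H2 : (u / INR k) ^ k <= exp u).
    { replace (exp u) with (exp (u / INR k) ^ k).
      - apply pow_incr; split; trivial. apply Rlt_le, Rdiv_lt_0_compat; lra.
      - rewrite <- (exp_ln (exp (u / INR k) ^ k)) by (apply pow_lt, exp_pos).
        rewrite ln_pow by apply exp_pos. rewrite ln_exp.
        f_equal; field; lra. }
    rewrite Rdiv_def, Rpow_mult_distr, pow_inv in H2.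
    rewrite exp_Ropp. assert (He : 0 < exp u) by apply exp_pos.
    assert (HK : 0 < INR k ^ k) by (apply pow_lt; trivial).
    apply (Rmult_le_reg_r (exp u)); trivial.
    rewrite Rmult_assoc, Rinv_l, Rmult_1_r by lra.
    apply (Rmult_le_reg_r (/ INR k ^ k)); [now apply Rinv_0_lt_compat|].
    eapply Rle_trans; [apply H2|]. right; field; lra.
Qed.

(** Taking one factor x out of [expinv n x] leaves a value of the form u^(n + 1) exp (- u), which is
    bounded. The resulting linear decay, applied to the next member of the family, gives the
    derivative 0 at the origin. *)
Lemma expinv_bound n : exists C, 0 < C /\ forall x, expinv n x <= C * Rabs x.
Proof.
  exists (INR (S n) ^ S n). split.
  { apply pow_lt, lt_0_INR; lia. }
  intros x. destruct (Rlt_dec 0 x) as [H|H].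
  - rewrite expinv_S, Rabs_pos_eq by lra. rewrite Rmult_comm.
    apply Rmult_le_compat_r; [lra|]. unfold expinv.
    destruct (Rlt_dec 0 x); [|lra].
    apply pow_exp_bound, Rinv_0_lt_compat; lra.
  - rewrite expinv_neg by lra. apply Rmult_le_pos; [|apply Rabs_pos].
    apply pow_le, pos_INR.
Qed.

Lemma expinv_derive n x :
  is_derive (expinv n) x (expinv (S (S n)) x + - INR n * expinv (S n) x).
Proof.
  destruct (Rtotal_order x 0) as [H|[H|H]].
  - rewrite 2!expinv_neg by lra. replace (0 + - INR n * 0) with 0 by ring.
    apply (is_derive_ext_loc (fun _ => 0)); [|apply @is_derive_const].
    assert (Hx : 0 < - x) by lra. exists (mkposreal _ Hx); intros y Hy.
    apply Rabs_def2 in Hy; simpl in Hy. symmetry; apply expinv_neg.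
    unfold minus, plus, opp in Hy; simpl in Hy; lra.
  - subst x. rewrite 2!expinv_neg by lra. replace (0 + - INR n * 0) with 0 by ring.
    apply is_derive_Reals. intros eps Heps.
    destruct (expinv_bound (S n)) as [C [HC HB]].
    assert (Hd : 0 < eps / C) by (apply Rdiv_lt_0_compat; lra).
    exists (mkposreal _ Hd); simpl. intros h Hh Hlt.
    rewrite Rplus_0_l, (expinv_neg n 0), Rminus_0_r by lra.
    rewrite expinv_S. replace ((h * expinv (S n) h - 0) / h) with (expinv (S n) h) by (field; lra).
    rewrite Rabs_pos_eq by apply expinv_ge0.
    eapply Rle_lt_trans; [apply HB|].
    apply (Rmult_lt_reg_r (/ C)); [now apply Rinv_0_lt_compat|].
    replace (C * Rabs h * / C) with (Rabs h) by (field; lra). exact Hlt.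
  - apply (is_derive_ext_loc (fun x => (/ x) ^ n * exp (- / x))).
    { exists (mkposreal x H). intros y Hy. apply Rabs_def2 in Hy; simpl in Hy.
      unfold minus, plus, opp in Hy; simpl in Hy.
      unfold expinv; destruct (Rlt_dec 0 y); [trivial|lra]. }
    unfold expinv; destruct (Rlt_dec 0 x) as [_|]; [|lra].
    auto_derive; [lra|]. destruct n as [|n]; simpl pred.
    + simpl. field; lra.
    + simpl pow. field; lra.
Qed.

Lemma expinv_Cn1 k n : Cn1 k everywhere (expinv n).
Proof.
  revert n; induction k as [|k IH]; intros n; split; trivial;
    try (intros x _; apply @ex_derive_continuous; eexists; apply expinv_derive).
  exists (fun x => expinv (S (S n)) x + - INR n * expinv (S n) x); split.
  - intros x _; apply expinv_derive.
  - apply Cn1_plus; trivial. apply Cn1_mult; trivial. apply Cn1_const.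
Qed.

(** The classical smooth step built from a flat function: constant 0 up to 0, constant 1 from 1 on.
    Both values are reached to infinite order, so pieces reparametrized by it fit together
    smoothly. *)
Definition sg (x : R) : R := expinv 0 x / (expinv 0 x + expinv 0 (1 - x)).
Definition sg' (x : R) : R :=
  (expinv 2 x * expinv 0 (1 - x) + expinv 0 x * expinv 2 (1 - x)) /
  (expinv 0 x + expinv 0 (1 - x)) ^ 2.

Lemma sg_denom x : 0 < expinv 0 x + expinv 0 (1 - x).
Proof.
  generalize (expinv_ge0 0 x), (expinv_ge0 0 (1 - x)); intros.
  destruct (Rlt_dec 0 x).
  - generalize (expinv_pos 0 x); lra.
  - generalize (expinv_pos 0 (1 - x)); lra.
Qed.

Lemma sg_smooth : smooth1 everywhere sg.
Proof.
  intros n. apply Cn1_div.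
  - apply expinv_Cn1.
  - apply Cn1_plus; [apply expinv_Cn1|].
    apply (Cn1_comp n everywhere); trivial. apply expinv_Cn1.
    apply Cn1_minus; [apply Cn1_const | apply Cn1_id].
  - intros x _; generalize (sg_denom x); lra.
Qed.

Lemma sg_le0 x : x <= 0 -> sg x = 0.
Proof. intros H; unfold sg; rewrite expinv_neg by lra. unfold Rdiv; ring. Qed.

Lemma sg_ge1 x : 1 <= x -> sg x = 1.
Proof.
  intros H; unfold sg; rewrite (expinv_neg 0 (1 - x)) by lra.
  generalize (expinv_pos 0 x); intros. field; lra.
Qed.

Lemma sg_range x : 0 <= sg x <= 1.
Proof.
  generalize (sg_denom x), (expinv_ge0 0 x), (expinv_ge0 0 (1 - x)); intros.
  unfold sg; split.
  - apply Rmult_le_pos; trivial. left; now apply Rinv_0_lt_compat.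
  - apply Rle_div_l; lra.
Qed.

Lemma sg_derive x : is_derive sg x (sg' x).
Proof.
  assert (H : is_derive (fun y => expinv 0 (1 - y)) x (- expinv 2 (1 - x))).
  { replace (- expinv 2 (1 - x)) with
      (scal (-1) (expinv 2 (1 - x) + - INR 0 * expinv 1 (1 - x))).
    - apply (is_derive_comp (expinv 0) (fun y => 1 - y)).
      + apply expinv_derive.
      + auto_derive; trivial; ring.
    - unfold scal; simpl; unfold mult; simpl; ring. }
  generalize (expinv_derive 0 x); intros H0.
  generalize (sg_denom x); intros Hd.
  evar_last.
  - apply is_derive_div; [apply H0 | | lra].
    apply @is_derive_plus; [apply H0 | apply H].
  - unfold sg', plus; simpl. field; lra.
Qed.

Lemma sg'_ge0 x : 0 <= sg' x.
Proof.
  generalize (sg_denom x); intros Hd. unfold sg'.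
  apply Rmult_le_pos.
  - apply Rplus_le_le_0_compat; apply Rmult_le_pos; apply expinv_ge0.
  - left; apply Rinv_0_lt_compat, pow_lt; trivial.
Qed.

Lemma sg'_cont x : continuous sg' x.
Proof.
  destruct (sg_smooth 1%nat) as [_ [f [Hf Hf1]]].
  apply (continuous_ext f); [|exact (proj1 Hf1 x I)].
  intros y. rewrite <- (is_derive_unique _ _ _ (Hf y I)).
  apply is_derive_unique, sg_derive.
Qed.

(** * Chains of linear homotopies *)

Definition cross (u v : R * R) : R := fst u * snd v - snd u * fst v.
Definition vsub (p q : R * R) : R * R := (fst p - fst q, snd p - snd q).
Definition lerp (s : R) (p q : R * R) : R * R :=
  ((1 - s) * fst p + s * fst q, (1 - s) * snd p + s * snd q).

Definition sloop (P : R -> R * R) : Prop :=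
  smooth1 everywhere (fun t => fst (P t)) /\
  smooth1 everywhere (fun t => snd (P t)) /\
  forall t, P (t + 1) = P t.

Definition velocity (P : R -> R * R) (t : R) : R * R :=
  (Derive (fun s => fst (P s)) t, Derive (fun s => snd (P s)) t).

Lemma Derive_eq (f : R -> R) (x l : R) : is_derive f x l -> Derive f x = l.
Proof. apply is_derive_unique. Qed.

Lemma smooth1_derive f : smooth1 everywhere f ->
  forall t, is_derive f t (Derive f t) /\ continuous (Derive f) t.
Proof.
  intros H t. destruct (H 1%nat) as [_ [f' [Hf [Hc _]]]].
  assert (E : forall t, Derive f t = f' t) by (intros; apply is_derive_unique; auto).
  split; [rewrite E; auto|].
  apply (continuous_ext f'); auto.
Qed.

Lemma smooth1_cont f : smooth1 everywhere f -> forall t, continuous f t.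
Proof. intros H t. now apply (Cn1_cont _ _ _ (H O)). Qed.

Lemma sloop_derive P : sloop P -> forall t,
  is_derive (fun s : R => fst (P s)) t (fst (velocity P t)) /\
  is_derive (fun s : R => snd (P s)) t (snd (velocity P t)).
Proof.
  intros [H1 [H2 _]] t; split; now apply smooth1_derive.
Qed.

Lemma sloop_cont P : sloop P -> forall t,
  continuous (fun s => fst (P s)) t /\ continuous (fun s => snd (P s)) t.
Proof. intros [H1 [H2 _]] t; split; now apply smooth1_cont. Qed.

Lemma velocity_cont P : sloop P -> forall t,
  continuous (fun s => fst (velocity P s)) t /\
  continuous (fun s => snd (velocity P s)) t.
Proof.
  intros [H1 [H2 _]] t; split; now apply smooth1_derive.
Qed.

Lemma continuous_rplus (f g : R -> R) t :
  continuous f t -> continuous g t -> continuous (fun s => f s + g s) t.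
Proof. intros; apply @continuous_plus; trivial. Qed.
Lemma continuous_rminus (f g : R -> R) t :
  continuous f t -> continuous g t -> continuous (fun s => f s - g s) t.
Proof. intros; apply @continuous_minus; trivial. Qed.
Lemma continuous_rmult (f g : R -> R) t :
  continuous f t -> continuous g t -> continuous (fun s => f s * g s) t.
Proof. intros; apply @continuous_mult; trivial. Qed.
Lemma continuous_rabs (f : R -> R) t :
  continuous f t -> continuous (fun s => Rabs (f s)) t.
Proof.
  intros; apply (continuous_comp f Rabs); trivial.
  apply continuity_pt_filterlim, Rcontinuity_abs.
Qed.

Ltac cont :=
  repeat match goal with
  | |- continuous (fun s => Rabs (@?f s)) _ => apply (continuous_rabs f)
  | |- continuous (fun s => Rminus (@?f s) (@?g s)) _ => apply (continuous_rminus f g)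
  | |- continuous (fun s => Rplus (@?f s) (@?g s)) _ => apply (continuous_rplus f g)
  | |- continuous (fun s => Rmult (@?f s) (@?g s)) _ => apply (continuous_rmult f g)
  | |- continuous (fun _ => ?c) _ => apply (@continuous_const R_UniformSpace R_UniformSpace c)
  | |- continuous (fun s => s) _ => apply (@continuous_id R_UniformSpace)
  | |- continuous _ _ => assumption
  end.

Lemma cross_cont (u v : R -> R * R) t :
  continuous (fun s => fst (u s)) t -> continuous (fun s => snd (u s)) t ->
  continuous (fun s => fst (v s)) t -> continuous (fun s => snd (v s)) t ->
  continuous (fun s => Rabs (cross (u s) (v s))) t.
Proof. intros; unfold cross; cont. Qed.

Lemma cont_ex_RInt (f : R -> R) a b : (forall t, continuous f t) -> ex_RInt f a b.
Proof. intros H; apply @ex_RInt_continuous; auto. Qed.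

Lemma cont2_slice (F : R -> R -> R) s t :
  continuity_2d_pt F s t -> continuous (F s) t.
Proof.
  intros H; apply filterlim_locally; intros eps.
  exact (locally_2d_slice2 _ _ _ (H eps)).
Qed.

Lemma RInt_param_cont (F : R -> R -> R) a b :
  a <= b -> (forall s t, continuity_2d_pt F s t) ->
  forall s, continuous (fun s => RInt (F s) a b) s.
Proof.
  intros Hab HF s. apply filterlim_locally; intros eps.
  assert (Hi : forall s, ex_RInt (F s) a b).
  { intros; apply cont_ex_RInt; intros; now apply cont2_slice. }
  (* The added 1 keeps the quotient meaningful when a = b. *)
  assert (He : 0 < eps / (b - a + 1)).
  { apply Rdiv_lt_0_compat; [apply cond_pos | lra]. }
  destruct (uniform_continuity_2d_1d' F a b s) with (eps := mkposreal _ He)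
    as [d Hd]; auto.
  exists d; intros u Hu. change (Rabs (RInt (F u) a b - RInt (F s) a b) < eps).
  replace (RInt (F u) a b - RInt (F s) a b)
    with (RInt (fun t => minus (F u t) (F s t)) a b)
    by (apply (@RInt_minus R_CompleteNormedModule); auto).
  eapply Rle_lt_trans.
  - apply (abs_RInt_le_const (fun x => minus (F u x) (F s x)) a b (eps / (b - a + 1))); trivial.
    + apply (@ex_RInt_minus R_NormedModule); auto.
    + intros t Ht. left. change (Rabs (u - s) < d) in Hu.
      apply (Hd t s t u); trivial.
      * generalize (cond_pos d); lra.
      * apply Rabs_def2 in Hu; lra.
      * rewrite Rminus_diag, Rabs_R0; apply cond_pos.
  - apply (Rmult_lt_reg_r (b - a + 1)); [lra|].
    replace ((b - a) * (eps / (b - a + 1)) * (b - a + 1)) with ((b - a) * eps)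
      by (field; lra).
    generalize (cond_pos eps); intros; nra.
Qed.

(** This is the substitution u = sg s: passing through time with the smooth step does not change the
    mean of an affine function over [0, 1]. *)
Lemma RInt_sg_affine a b :
  is_RInt (fun s => sg' s * ((1 - sg s) * a + sg s * b)) 0 1 ((a + b) / 2).
Proof.
  set (F := fun s => (sg s - sg s * sg s / 2) * a + sg s * sg s / 2 * b).
  replace ((a + b) / 2) with (minus (F 1) (F 0)).
  - apply (is_RInt_derive F).
    + intros s _. unfold F. generalize (sg_derive s); intros H.
      auto_derive.
      * repeat split; exists (sg' s); exact H.
      * replace (Derive _ s) with (sg' s) by (symmetry; exact (is_derive_unique _ _ _ H)). field.
    + intros s _.
      assert (Hc : forall s, continuous sg s).
      { intros; apply (smooth1_cont sg sg_smooth). }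
      generalize (sg'_cont s) (Hc s); intros. cont.
  - unfold F, minus, plus, opp; simpl.
    rewrite (sg_ge1 1), (sg_le0 0) by lra. field.
Qed.

Lemma swept_ex_RInt P Q S : sloop P -> sloop Q -> sloop S -> forall a b,
  ex_RInt (fun t => Rabs (cross (vsub (Q t) (P t)) (velocity S t))) a b.
Proof.
  intros HP HQ HS a b. apply cont_ex_RInt; intros t.
  destruct (velocity_cont S HS t), (sloop_cont P HP t), (sloop_cont Q HQ t).
  apply cross_cont; trivial; unfold vsub; simpl; cont.
Qed.

(* In the linear homotopy from P to Q the loop at time s has velocity
   (1 - s) P' + s Q', so the swept area is at most the mean of the two
   integrals. *)
Inductive Chain : (R -> R * R) -> R -> Prop :=
| Chain_const c A : ~ lattice c -> 0 <= A -> Chain (fun _ => c) A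
| Chain_step P Q A B :
    sloop P ->
    (forall s t, 0 <= s <= 1 -> ~ lattice (lerp s (P t) (Q t))) ->
    (RInt (fun t => Rabs (cross (vsub (Q t) (P t)) (velocity P t))) 0 1 +
     RInt (fun t => Rabs (cross (vsub (Q t) (P t)) (velocity Q t))) 0 1) / 2 <= B ->
    Chain Q A -> Chain P (B + A).

Lemma sloop_const c : sloop (fun _ => c).
Proof. repeat split; intro; apply Cn1_const. Qed.

Lemma Chain_sloop P A : Chain P A -> sloop P.
Proof. intros [c B _ _ | ]; auto using sloop_const. Qed.

Lemma Chain_le P A B : Chain P A -> A <= B -> Chain P B.
Proof.
  intros HC; revert B. induction HC as [c A Hc HA | P Q A B HP Hav HB HC IH]; intros E HE.
  - apply Chain_const; [trivial | lra].
  - replace E with (B + (E - B)) by ring. apply Chain_step with Q; auto.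
    apply IH; lra.
Qed.

(** * Gluing a chain into one smooth homotopy *)

Definition jac (K : R -> R -> R * R) (s t : R) : R :=
  jac_det (fun p => K (fst p) (snd p)) s t.

Lemma jacE K s t : jac K s t =
  Derive (fun u => fst (K u t)) s * Derive (fun v => snd (K s v)) t -
  Derive (fun v => fst (K s v)) t * Derive (fun u => snd (K u t)) s.
Proof. reflexivity. Qed.

(** The homotopy is defined for all times, equal to P before 0 and to c after k, so that it can be
    composed with any height function on the plane. Smoothness is stated as stability under
    substitution, because [Cn2_comp] composes only with functions of one variable. *)
Record Contraction (P : R -> R * R) (A : R) (K : R -> R -> R * R) (k : R) (c : R * R) : Prop := {
  con_pos : 0 < k;
  con_start : forall s t, s <= 0 -> K s t = P t;
  con_end : forall s t, k <= s -> K s t = c;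
  con_per : forall s t, K s (t + 1) = K s t;
  con_avoid : forall s t, ~ lattice (K s t);
  con_smooth : forall n D S T, Cn2 n D S -> Cn2 n D T ->
    Cn2 n D (fun x y => fst (K (S x y) (T x y))) /\
    Cn2 n D (fun x y => snd (K (S x y) (T x y)));
  con_area : RInt (fun s => RInt (fun t => Rabs (jac K s t)) 0 1) 0 k <= A }.

Section JacCont.
Variable K : R -> R -> R * R.
Hypothesis HK : forall n D S T, Cn2 n D S -> Cn2 n D T ->
    Cn2 n D (fun x y => fst (K (S x y) (T x y))) /\
    Cn2 n D (fun x y => snd (K (S x y) (T x y))).

Lemma jac_cont s t : continuity_2d_pt (fun s t => Rabs (jac K s t)) s t.
Proof.
  set (D := fun _ _ : R => True).
  destruct (HK 1 D (fun x _ => x) (fun _ y => y)) as [H1 H2];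
    [apply Cn2_fst | apply Cn2_snd |].
  destruct H1 as [_ [f1 [f2 [Hf [[C1 _] [C2 _]]]]]].
  destruct H2 as [_ [g1 [g2 [Hg [[C3 _] [C4 _]]]]]].
  apply (continuity_1d_2d_pt_comp Rabs); [apply Rcontinuity_abs|].
  apply (continuity_2d_pt_ext (fun s t => f1 s t * g2 s t - f2 s t * g1 s t)).
  - intros x y. unfold jac, jac_det. simpl.
    destruct (Hf x y I) as [F1 F2]; destruct (Hg x y I) as [G1 G2].
    rewrite (Derive_eq _ _ _ F1), (Derive_eq _ _ _ F2).
    now rewrite (Derive_eq _ _ _ G1), (Derive_eq _ _ _ G2).
  - apply continuity_2d_pt_minus; apply continuity_2d_pt_mult; 
      (apply C1 || apply C2 || apply C3 || apply C4); exact I.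
Qed.

Lemma ex_RInt_jac s a b : ex_RInt (fun t => Rabs (jac K s t)) a b.
Proof.
  apply cont_ex_RInt; intros t.
  apply (cont2_slice (fun s t => Rabs (jac K s t))), jac_cont.
Qed.

Lemma ex_RInt_RInt_jac a b :
  ex_RInt (fun s => RInt (fun t => Rabs (jac K s t)) 0 1) a b.
Proof.
  apply cont_ex_RInt. apply (RInt_param_cont (fun s t => Rabs (jac K s t))).
  lra. apply jac_cont.
Qed.
End JacCont.

Lemma jac_const (K : R -> R -> R * R) c s t :
  (forall s t, K s t = c) -> jac K s t = 0.
Proof.
  intros H; unfold jac, jac_det; simpl.
  rewrite (Derive_ext (fun u => fst (K u t)) (fun _ => fst c)) by (intros; now rewrite H).
  rewrite (Derive_ext (fun u => fst (K s u)) (fun _ => fst c)) by (intros; now rewrite H).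
  rewrite !Derive_const. ring.
Qed.

Lemma Contraction_const c A : ~ lattice c -> 0 <= A ->
  Contraction (fun _ => c) A (fun _ _ => c) 1 c.
Proof.
  intros Hc HA; split; trivial; try lra.
  - split; apply Cn2_const.
  - rewrite (RInt_ext _ (fun _ => 0)).
    + rewrite RInt_const. unfold scal; simpl; unfold mult; simpl; lra.
    + intros s _. rewrite (RInt_ext _ (fun _ => 0)).
      * rewrite RInt_const. unfold scal; simpl; unfold mult; simpl; ring.
      * intros t _. rewrite (jac_const _ c); trivial. apply Rabs_R0.
Qed.

(** One formula on both sides of s = 1: before it the last difference is Q - Q, after it the first
    two terms add up to Q and cancel. Smoothness thus follows from the closure rules, without a case
    distinction. *)
Definition concat (P Q : R -> R * R) (K : R -> R -> R * R) (s t : R) : R * R :=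
  (fst (P t) + sg s * (fst (Q t) - fst (P t)) + (fst (K (s - 1) t) - fst (Q t)),
   snd (P t) + sg s * (snd (Q t) - snd (P t)) + (snd (K (s - 1) t) - snd (Q t))).

Lemma concat_le1 P Q K s t : (forall s t, s <= 0 -> K s t = Q t) -> s <= 1 ->
  concat P Q K s t = lerp (sg s) (P t) (Q t).
Proof.
  intros H Hs; unfold concat, lerp. rewrite H by lra. f_equal; ring.
Qed.

Lemma concat_ge1 P Q K s t : 1 <= s -> concat P Q K s t = K (s - 1) t.
Proof.
  intros Hs; unfold concat. rewrite (sg_ge1 s) by trivial.
  rewrite (surjective_pairing (K (s - 1) t)). simpl. f_equal; ring.
Qed.

Lemma Derive_lerp (f g : R -> R) a t : ex_derive f t -> ex_derive g t ->
  Derive (fun t => (1 - a) * f t + a * g t) t = (1 - a) * Derive f t + a * Derive g t.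
Proof.
  intros Hf Hg. rewrite Derive_plus.
  - now rewrite !Derive_scal.
  - now apply ex_derive_scal.
  - now apply ex_derive_scal.
Qed.

Lemma Derive_lerp_sg a b s :
  Derive (fun s => (1 - sg s) * a + sg s * b) s = sg' s * (b - a).
Proof.
  apply is_derive_unique. generalize (sg_derive s); intros H.
  auto_derive.
  - repeat split; exists (sg' s); exact H.
  - replace (Derive _ s) with (sg' s) by (symmetry; exact (is_derive_unique _ _ _ H)). ring.
Qed.

Lemma jac_concat_lt1 P Q K s t :
  sloop P -> sloop Q -> (forall s t, s <= 0 -> K s t = Q t) -> s < 1 ->
  jac (concat P Q K) s t =
  sg' s * ((1 - sg s) * cross (vsub (Q t) (P t)) (velocity P t) +
           sg s * cross (vsub (Q t) (P t)) (velocity Q t)).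
Proof.
  intros HP HQ HK Hs. rewrite !jacE.
  destruct (sloop_derive P HP t) as [P1 P2]. destruct (sloop_derive Q HQ t) as [Q1 Q2].
  assert (Hloc : locally s (fun u => u < 1)).
  { apply (open_lt 1 s Hs). }
  rewrite (Derive_ext_loc (fun u => fst (concat P Q K u t))
             (fun u => (1 - sg u) * fst (P t) + sg u * fst (Q t))).
  2:{ generalize Hloc; apply filter_imp; intros u Hu. now rewrite concat_le1 by (trivial; lra). }
  rewrite (Derive_ext_loc (fun u => snd (concat P Q K u t))
             (fun u => (1 - sg u) * snd (P t) + sg u * snd (Q t))).
  2:{ generalize Hloc; apply filter_imp; intros u Hu. now rewrite concat_le1 by (trivial; lra). }
  rewrite (Derive_ext (fun v => fst (concat P Q K s v))
             (fun v => (1 - sg s) * fst (P v) + sg s * fst (Q v))).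
  2:{ intros v. now rewrite concat_le1 by (trivial; lra). }
  rewrite (Derive_ext (fun v => snd (concat P Q K s v))
             (fun v => (1 - sg s) * snd (P v) + sg s * snd (Q v))).
  2:{ intros v. now rewrite concat_le1 by (trivial; lra). }
  rewrite !Derive_lerp_sg, !Derive_lerp; try (eexists; eassumption).
  unfold cross, vsub, velocity; simpl. ring.
Qed.

Lemma jac_concat_gt1 P Q K s t : 1 < s -> jac (concat P Q K) s t = jac K (s - 1) t.
Proof.
  intros Hs. rewrite !jacE.
  assert (Hloc : locally s (fun u => 1 < u)).
  { apply (open_gt 1 s Hs). }
  assert (E : forall p : R * R -> R,
    Derive (fun u => p (concat P Q K u t)) s = Derive (fun u => p (K u t)) (s - 1)).
  { intros p. rewrite (Derive_ext_loc _ (fun u => p (K (u - 1) t))).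
    - unfold Derive. f_equal. apply Lim_ext; intros h.
      do 2 f_equal. f_equal. f_equal. ring.
    - generalize Hloc; apply filter_imp; intros u Hu. now rewrite concat_ge1 by lra. }
  rewrite (E fst), (E snd).
  rewrite (Derive_ext (fun v => fst (concat P Q K s v)) (fun v => fst (K (s - 1) v))).
  2:{ intros v. now rewrite concat_ge1 by lra. }
  rewrite (Derive_ext (fun v => snd (concat P Q K s v)) (fun v => snd (K (s - 1) v))).
  2:{ intros v. now rewrite concat_ge1 by lra. }
  reflexivity.
Qed.

Lemma Contraction_step P Q A B K k c :
  sloop P -> sloop Q ->
  (forall s t, 0 <= s <= 1 -> ~ lattice (lerp s (P t) (Q t))) ->
  (RInt (fun t => Rabs (cross (vsub (Q t) (P t)) (velocity P t))) 0 1 +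
   RInt (fun t => Rabs (cross (vsub (Q t) (P t)) (velocity Q t))) 0 1) / 2 <= B ->
  Contraction Q A K k c -> Contraction P (B + A) (concat P Q K) (1 + k) c.
Proof.
  intros HP HQ Hav HB [Hk H0 H1 Hper Havoid Hsm Harea].
  assert (HS : forall n D S T, Cn2 n D S -> Cn2 n D T ->
    Cn2 n D (fun x y => fst (concat P Q K (S x y) (T x y))) /\
    Cn2 n D (fun x y => snd (concat P Q K (S x y) (T x y)))).
  { intros n D S T CS CT. simpl.
    assert (Csg : Cn2 n D (fun x y => sg (S x y))).
    { apply (Cn2_comp n everywhere); auto. apply sg_smooth. }
    destruct (Hsm n D (fun x y => S x y - 1) T) as [K1 K2]; trivial.
    { apply Cn2_minus; trivial; apply Cn2_const. }
    destruct HP as [P1 [P2 _]], HQ as [Q1 [Q2 _]].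
    assert (CP1 : Cn2 n D (fun x y => fst (P (T x y)))).
    { apply (Cn2_comp n everywhere D (fun t => fst (P t)) T); auto. }
    assert (CP2 : Cn2 n D (fun x y => snd (P (T x y)))).
    { apply (Cn2_comp n everywhere D (fun t => snd (P t)) T); auto. }
    assert (CQ1 : Cn2 n D (fun x y => fst (Q (T x y)))).
    { apply (Cn2_comp n everywhere D (fun t => fst (Q t)) T); auto. }
    assert (CQ2 : Cn2 n D (fun x y => snd (Q (T x y)))).
    { apply (Cn2_comp n everywhere D (fun t => snd (Q t)) T); auto. }
    split; (apply Cn2_plus; [apply Cn2_plus; [|apply Cn2_mult]|]; trivial;
      apply Cn2_minus; trivial). }
  split; trivial.
  - lra.
  - intros s t Hs. rewrite concat_le1 by (trivial; lra). unfold lerp.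
    rewrite (sg_le0 s Hs), (surjective_pairing (P t)); simpl; f_equal; ring.
  - intros s t Hs. rewrite concat_ge1 by lra. apply H1; lra.
  - intros s t. unfold concat. destruct HP as [_ [_ EP]], HQ as [_ [_ EQ]].
    now rewrite EP, EQ, Hper.
  - intros s t. destruct (Rle_dec s 1) as [Hs|Hs].
    + rewrite concat_le1 by trivial. apply Hav, sg_range.
    + rewrite concat_ge1 by lra. apply Havoid.
  - rewrite <- (RInt_Chasles _ 0 1 (1 + k)) by (apply ex_RInt_RInt_jac; trivial).
    apply Rplus_le_compat.
    + eapply Rle_trans; [|apply HB].
      set (u := RInt (fun t => Rabs (cross (vsub (Q t) (P t)) (velocity P t))) 0 1).
      set (w := RInt (fun t => Rabs (cross (vsub (Q t) (P t)) (velocity Q t))) 0 1).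
      (* The mean of u and w is rewritten as the time integral of the affine bound, so that the
         comparison can be made slice by slice. *)
      rewrite <- (is_RInt_unique _ _ _ _ (RInt_sg_affine u w)).
      assert (Cu := swept_ex_RInt P Q P HP HQ HP 0 1).
      assert (Cw := swept_ex_RInt P Q Q HP HQ HQ 0 1).
      apply RInt_le; [lra | now apply ex_RInt_RInt_jac
                     | eexists; apply RInt_sg_affine |].
      intros s Hs.
      replace (sg' s * ((1 - sg s) * u + sg s * w)) with
        (RInt (fun t => sg' s *
           ((1 - sg s) * Rabs (cross (vsub (Q t) (P t)) (velocity P t)) +
            sg s * Rabs (cross (vsub (Q t) (P t)) (velocity Q t)))) 0 1).
      * apply RInt_le; [lra | now apply ex_RInt_jac | |].
        { apply @ex_RInt_scal. apply @ex_RInt_plus; apply @ex_RInt_scal; auto. }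
        intros t _. rewrite jac_concat_lt1 by (trivial; lra).
        rewrite Rabs_mult, (Rabs_pos_eq (sg' s)) by apply sg'_ge0.
        apply Rmult_le_compat_l; [apply sg'_ge0|].
        generalize (sg_range s); intros.
        eapply Rle_trans; [apply Rabs_triang|].
        rewrite !Rabs_mult, (Rabs_pos_eq (1 - sg s)), (Rabs_pos_eq (sg s)) by lra. lra.
      * apply is_RInt_unique. apply @is_RInt_scal.
        apply @is_RInt_plus; apply @is_RInt_scal; apply @RInt_correct; auto.
    + eapply Rle_trans; [|apply Harea]. right.
      set (G := fun s => RInt (fun t => Rabs (jac K s t)) 0 1).
      (* The remaining part of the integral is that of K, delayed by one unit of time. *)
      assert (E : RInt (fun s => scal 1 (G (1 * s + -1))) 1 (1 + k) =
                  RInt G (1 * 1 + -1) (1 * (1 + k) + -1)).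
      { apply (@RInt_comp_lin R_CompleteNormedModule).
        exact (ex_RInt_RInt_jac K Hsm _ _). }
      replace (1 * 1 + -1) with 0 in E by ring.
      replace (1 * (1 + k) + -1) with k in E by ring.
      rewrite <- E. apply RInt_ext. intros s Hs. rewrite Rmin_left in Hs by lra.
      change (RInt (fun t => Rabs (jac (concat P Q K) s t)) 0 1 = 1 * G (1 * s + -1)).
      rewrite Rmult_1_l. apply RInt_ext; intros t _.
      rewrite jac_concat_gt1 by lra. now replace (1 * s + -1) with (s - 1) by ring.
Qed.

Lemma Chain_Contraction P A : Chain P A ->
  exists K k c, Contraction P A K k c.
Proof.
  induction 1 as [c B Hc HB | P Q A B HP Hav HB HC [K [k [c IH]]]].
  - exists (fun _ _ => c), 1, c. now apply Contraction_const.
  - exists (concat P Q K), (1 + k), c. apply Contraction_step; trivial.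
    now apply Chain_sloop in HC.
Qed.

(** * From a contraction to a filling of the disk *)

Lemma per_Z (P : R -> R * R) : (forall t, P (t + 1) = P t) ->
  forall (n : Z) t, P (t + IZR n) = P t.
Proof.
  intros H. assert (Hn : forall (n : nat) t, P (t + INR n) = P t).
  { induction n as [|n IH]; intros t.
    - simpl. now rewrite Rplus_0_r.
    - rewrite S_INR, <- Rplus_assoc, H. apply IH. }
  intros n t. destruct (Z_le_dec 0 n) as [H0|H0].
  - rewrite <- (Z2Nat.id n), <- INR_IZR_INZ by lia. apply Hn.
  - replace (P t) with (P (t + IZR n + INR (Z.to_nat (- n)))) by
      (rewrite INR_IZR_INZ, Z2Nat.id, opp_IZR by lia; f_equal; ring).
    now rewrite Hn.
Qed.

(** Since cos (u - v) = 1 equals 1 - 2 sin^2 ((u - v) / 2), half the difference is a zero of the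
    sine. *)
Lemma angle_unique u v : cos u = cos v -> sin u = sin v ->
  exists n : Z, u = v + IZR n * (2 * PI).
Proof.
  intros Hc Hs.
  assert (H : cos (u - v) = 1).
  { rewrite cos_minus, Hc, Hs. generalize (sin2_cos2 v). unfold Rsqr. lra. }
  replace (u - v) with (2 * ((u - v) / 2)) in H by field.
  rewrite cos_2a_sin in H.
  assert (H0 : sin ((u - v) / 2) = 0) by nra.
  destruct (sin_eq_0_0 _ H0) as [n Hn]. exists n. lra.
Qed.

Lemma cos_sin_atan_quot x y : 0 < x -> x ^ 2 + y ^ 2 = 1 ->
  cos (atan (y / x)) = x /\ sin (atan (y / x)) = y.
Proof.
  intros Hx H.
  assert (E : sqrt (1 + (y / x)²) = / x).
  { replace (1 + (y / x)²) with ((/ x) * (/ x)).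
    - apply sqrt_square. left; now apply Rinv_0_lt_compat.
    - unfold Rsqr. replace (/ x * / x) with ((x ^ 2 + y ^ 2) * (/ x * / x))
        by (rewrite H; ring). field; lra. }
  rewrite cos_atan, sin_atan, E. split; field; lra.
Qed.

(** With [atan_quot_neg], this changes between the angle formulas in y / x, valid off the vertical
    axis, and those in x / y, valid off the horizontal axis. *)
Lemma atan_quot_pos x y : 0 < y / x -> atan (y / x) = PI / 2 - atan (x / y).
Proof.
  intros H. replace (y / x) with (/ (x / y)).
  - apply atan_inv. replace (x / y) with (/ (y / x)).
    + now apply Rinv_0_lt_compat.
    + now rewrite Rinv_div.
  - now rewrite Rinv_div.
Qed.

Lemma atan_quot_neg x y : y / x < 0 -> atan (y / x) = - (PI / 2) - atan (x / y).
Proof.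
  intros H. replace (y / x) with (- (- y / x)) by (unfold Rdiv; ring).
  rewrite atan_opp, atan_quot_pos by (unfold Rdiv in *; lra).
  replace (x / - y) with (- (x / y)).
  - rewrite atan_opp; ring.
  - unfold Rdiv. rewrite Rinv_opp. ring.
Qed.

Lemma open2_lt (f g : R -> R -> R) :
  (forall x y, continuity_2d_pt f x y) -> (forall x y, continuity_2d_pt g x y) ->
  open2 (fun x y => f x y < g x y).
Proof.
  intros Hf Hg x y H.
  assert (He : 0 < g x y - f x y) by lra.
  generalize (continuity_2d_pt_minus g f x y (Hg x y) (Hf x y) (mkposreal _ He)).
  apply locally_2d_impl, locally_2d_forall. intros u v Huv. simpl in Huv.
  apply Rabs_def2 in Huv. lra.
Qed.

Lemma open2_and (D E : R -> R -> Prop) :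
  open2 D -> open2 E -> open2 (fun x y => D x y /\ E x y).
Proof. intros HD HE x y [H1 H2]. apply locally_2d_and; auto. Qed.

(** By the chain rule both partial derivatives of f are multiples of the one vector G'. *)
Lemma jac_det_rank1 (f : R * R -> R * R) (G : R -> R * R) (D : R -> R -> Prop)
  (phi : R -> R -> R) x y :
  open2 D -> D x y -> Cn2 1 D phi ->
  (forall u v, D u v -> f (u, v) = G (phi u v)) ->
  ex_derive (fun t => fst (G t)) (phi x y) ->
  ex_derive (fun t => snd (G t)) (phi x y) ->
  jac_det f x y = 0.
Proof.
  intros HD Dxy [_ [px [py [Hp _]]]] Hf [g1 G1] [g2 G2].
  destruct (Hp x y Dxy) as [Hx Hy]. unfold jac_det.
  assert (L1 : locally x (fun u => D u y)) by (apply locally_2d_slice1; auto).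
  assert (L2 : locally y (fun v => D x v)) by (apply locally_2d_slice2; auto).
  assert (E1 : Derive (fun u => fst (f (u, y))) x = px x y * g1).
  { apply Derive_eq. apply (is_derive_ext_loc (fun u => fst (G (phi u y)))).
    - generalize L1; apply filter_imp; intros u Hu; now rewrite Hf.
    - apply (is_derive_comp (fun t => fst (G t)) (fun u => phi u y)); trivial. }
  assert (E2 : Derive (fun u => snd (f (u, y))) x = px x y * g2).
  { apply Derive_eq. apply (is_derive_ext_loc (fun u => snd (G (phi u y)))).
    - generalize L1; apply filter_imp; intros u Hu; now rewrite Hf.
    - apply (is_derive_comp (fun t => snd (G t)) (fun u => phi u y)); trivial. }
  assert (E3 : Derive (fun v => fst (f (x, v))) y = py x y * g1).
  { apply Derive_eq. apply (is_derive_ext_loc (fun v => fst (G (phi x v)))).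
    - generalize L2; apply filter_imp; intros u Hu; now rewrite Hf.
    - apply (is_derive_comp (fun t => fst (G t)) (fun u => phi x u)); trivial. }
  assert (E4 : Derive (fun v => snd (f (x, v))) y = py x y * g2).
  { apply Derive_eq. apply (is_derive_ext_loc (fun v => snd (G (phi x v)))).
    - generalize L2; apply filter_imp; intros u Hu; now rewrite Hf.
    - apply (is_derive_comp (fun t => snd (G t)) (fun u => phi x u)); trivial. }
  rewrite E1, E2, E3, E4. ring.
Qed.

(* The filling is [K (height x y) (turn x y)] on the disk: it has rank at most
   one outside the box [-2/5 <= x <= -1/5], [|y| <= 1/5], where it is
   [K (5 k x + 2 k) (clock y)], a separable reparametrization of [K] over
   [0, k] x [0, 1]. This way no polar change of variables is needed. *)
Definition rsq (x y : R) : R := x ^ 2 + y ^ 2.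
(** This cut rises for x^2 + y^2 between 1/4 and 1/2, [outer_cut] between 5/8 and 1. As the two
    annuli are disjoint, at every point either the height is 0 or the angle is not yet blended; this
    is what gives rank at most one outside the box. *)
Definition inner_cut (x y : R) : R := sg (4 * rsq x y - 1).
Definition outer_cut (x y : R) : R := sg (8 / 3 * rsq x y - 5 / 3).
Definition height (k x y : R) : R := (1 - inner_cut x y) * (5 * k * x + 2 * k).
Definition clock (y : R) : R := sg (1 / 2 - 5 / 2 * y).

(* Blends, across the annulus [5/8 <= x^2 + y^2 <= 1], of the angle divided by
   2 pi with [clock y] on the left, [0] above and on the right, [1] below. *)
Definition turnW (x y : R) : R :=
  (1 - outer_cut x y) * clock y + outer_cut x y * (1 / 2 + atan (y / x) / (2 * PI)).
Definition turnE (x y : R) : R := outer_cut x y * (atan (y / x) / (2 * PI)).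
Definition turnN (x y : R) : R := outer_cut x y * (1 / 4 - atan (x / y) / (2 * PI)).
Definition turnS (x y : R) : R :=
  (1 - outer_cut x y) + outer_cut x y * (3 / 4 - atan (x / y) / (2 * PI)).

(** The value jumps by 1 from [turnS] to [turnE], which the period of K absorbs, and it jumps on the
    vertical axis near the origin, where the contraction is already at its end and K is constant. *)
Definition turn (x y : R) : R :=
  if Rlt_dec x 0 then turnW x y else
  if Rlt_dec 0 x then turnE x y else
  if Rlt_dec 0 y then turnN x y else turnS x y.

Definition fill (K : R -> R -> R * R) (k : R) (p : R * R) : R * R :=
  K (height k (fst p) (snd p)) (turn (fst p) (snd p)).

Ltac cn2 :=
  repeat first [ assumption
    | apply Cn2_const | apply Cn2_fst | apply Cn2_snd
    | apply Cn2_div | apply Cn2_minus | apply Cn2_plus | apply Cn2_mult ].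

Lemma rsq_Cn2 n D : Cn2 n D rsq.
Proof. unfold rsq; simpl. cn2. Qed.

Lemma sg_Cn2 n D f : Cn2 n D f -> Cn2 n D (fun x y => sg (f x y)).
Proof. intros H; apply (Cn2_comp n everywhere D sg f); trivial. apply sg_smooth. Qed.

Lemma atan_Cn2 n D f : Cn2 n D f -> Cn2 n D (fun x y => atan (f x y)).
Proof. intros H; apply (Cn2_comp n everywhere D atan f); trivial. apply Cn1_atan. Qed.

Lemma inner_cut_Cn2 n D : Cn2 n D inner_cut.
Proof. generalize (rsq_Cn2 n D); intros. apply sg_Cn2. cn2. Qed.

Lemma outer_cut_Cn2 n D : Cn2 n D outer_cut.
Proof. generalize (rsq_Cn2 n D); intros. apply sg_Cn2. cn2. Qed.

Lemma height_Cn2 k n D : Cn2 n D (height k).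
Proof. generalize (inner_cut_Cn2 n D); intros. unfold height. cn2. Qed.

Lemma angle_Cn2 n D f g : Cn2 n D f -> Cn2 n D g ->
  (forall x y, D x y -> g x y <> 0) ->
  Cn2 n D (fun x y => atan (f x y / g x y) / (2 * PI)).
Proof.
  intros Hf Hg H. apply Cn2_div.
  - apply atan_Cn2, Cn2_div; trivial.
  - apply Cn2_const.
  - intros; generalize PI_RGT_0; lra.
Qed.

Lemma turnW_Cn2 n (D : R -> R -> Prop) : (forall x y, D x y -> x < 0) -> Cn2 n D turnW.
Proof.
  intros H. generalize (outer_cut_Cn2 n D); intros.
  assert (Cn2 n D (fun _ y => clock y)) by (apply sg_Cn2; cn2; intros; lra).
  assert (Cn2 n D (fun x y => atan (y / x) / (2 * PI))).
  { apply (angle_Cn2 n D (fun _ y => y) (fun x _ => x)); cn2.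
    intros x y Dxy; generalize (H x y Dxy); lra. }
  unfold turnW. cn2; intros; lra.
Qed.

Lemma turnE_Cn2 n (D : R -> R -> Prop) : (forall x y, D x y -> 0 < x) -> Cn2 n D turnE.
Proof.
  intros H. generalize (outer_cut_Cn2 n D); intros.
  assert (Cn2 n D (fun x y => atan (y / x) / (2 * PI))).
  { apply (angle_Cn2 n D (fun _ y => y) (fun x _ => x)); cn2.
    intros x y Dxy; generalize (H x y Dxy); lra. }
  unfold turnE. cn2.
Qed.

Lemma turnN_Cn2 n (D : R -> R -> Prop) : (forall x y, D x y -> 0 < y) -> Cn2 n D turnN.
Proof.
  intros H. generalize (outer_cut_Cn2 n D); intros.
  assert (Cn2 n D (fun x y => atan (x / y) / (2 * PI))).
  { apply (angle_Cn2 n D (fun x _ => x) (fun _ y => y)); cn2.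
    intros x y Dxy; generalize (H x y Dxy); lra. }
  unfold turnN. cn2; intros; lra.
Qed.

Lemma turnS_Cn2 n (D : R -> R -> Prop) : (forall x y, D x y -> y < 0) -> Cn2 n D turnS.
Proof.
  intros H. generalize (outer_cut_Cn2 n D); intros.
  assert (Cn2 n D (fun x y => atan (x / y) / (2 * PI))).
  { apply (angle_Cn2 n D (fun x _ => x) (fun _ y => y)); cn2.
    intros x y Dxy; generalize (H x y Dxy); lra. }
  unfold turnS. cn2; intros; lra.
Qed.

(** * Smoothness, boundary values and area of the filling *)

Section Fill.
Variables (P : R -> R * R) (A : R) (K : R -> R -> R * R) (k : R) (c : R * R).
Hypothesis HP : sloop P.
Hypothesis HK : Contraction P A K k c.

Definition DW (x y : R) : Prop := x < 0.
Definition DE (x y : R) : Prop := 0 < x.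
Definition DN (x y : R) : Prop := 1 / 5 < y.
Definition DS (x y : R) : Prop := y < - (1 / 5).
Definition DC (x y : R) : Prop := - (1 / 5) < x /\ rsq x y < 1 / 4.

Lemma rsq_cont x y : continuity_2d_pt rsq x y.
Proof. now apply (Cn2_cont 0 (fun _ _ => True) rsq (rsq_Cn2 _ _)). Qed.

Hint Resolve rsq_cont continuity_2d_pt_const continuity_2d_pt_id1 continuity_2d_pt_id2 : c2d.

Lemma open_DW : open2 DW.
Proof. apply (open2_lt (fun x _ => x) (fun _ _ => 0)); auto with c2d. Qed.
Lemma open_DE : open2 DE.
Proof. apply (open2_lt (fun _ _ => 0) (fun x _ => x)); auto with c2d. Qed.
Lemma open_DN : open2 DN.
Proof. apply (open2_lt (fun _ _ => 1 / 5) (fun _ y => y)); auto with c2d. Qed.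
Lemma open_DS : open2 DS.
Proof. apply (open2_lt (fun _ y => y) (fun _ _ => - (1 / 5))); auto with c2d. Qed.
Lemma open_DC : open2 DC.
Proof.
  apply open2_and.
  - apply (open2_lt (fun _ _ => - (1 / 5)) (fun x _ => x)); auto with c2d.
  - apply (open2_lt rsq (fun _ _ => 1 / 4)); auto with c2d.
Qed.
Lemma open_in r : open2 (fun x y => rsq x y < r).
Proof. apply (open2_lt rsq (fun _ _ => r)); auto with c2d. Qed.
Lemma open_out r : open2 (fun x y => r < rsq x y).
Proof. apply (open2_lt (fun _ _ => r) rsq); auto with c2d. Qed.

Lemma fill_DW x y : DW x y -> fill K k (x, y) = K (height k x y) (turnW x y).
Proof.
  intros H. unfold fill, turn; simpl. destruct (Rlt_dec x 0); trivial.
  now contradict n.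
Qed.

Lemma fill_DE x y : DE x y -> fill K k (x, y) = K (height k x y) (turnE x y).
Proof.
  unfold DE; intros H. unfold fill, turn; simpl. destruct (Rlt_dec x 0); [lra|].
  destruct (Rlt_dec 0 x); trivial; lra.
Qed.

Lemma fill_DN x y : DN x y -> fill K k (x, y) = K (height k x y) (turnN x y).
Proof.
  unfold DN; intros H. unfold fill, turn; simpl. generalize PI_RGT_0; intros Hpi.
  destruct (Rlt_dec x 0) as [Hx|Hx].
  - f_equal. unfold turnW, turnN, clock. rewrite (sg_le0 (1 / 2 - 5 / 2 * y)) by lra.
    rewrite (atan_quot_neg x y). field; lra.
    apply Rdiv_pos_neg; lra.
  - destruct (Rlt_dec 0 x) as [Hx'|Hx'].
    + f_equal. unfold turnE, turnN. rewrite (atan_quot_pos x y). field; lra.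
      apply Rdiv_lt_0_compat; lra.
    + destruct (Rlt_dec 0 y); trivial; lra.
Qed.

Lemma fill_DS x y : DS x y -> fill K k (x, y) = K (height k x y) (turnS x y).
Proof.
  unfold DS; intros H. unfold fill, turn; simpl. generalize PI_RGT_0; intros Hpi.
  destruct (Rlt_dec x 0) as [Hx|Hx].
  - f_equal. unfold turnW, turnS, clock. rewrite (sg_ge1 (1 / 2 - 5 / 2 * y)) by lra.
    rewrite (atan_quot_pos x y). field; lra.
    apply Rdiv_neg_neg; lra.
  - destruct (Rlt_dec 0 x) as [Hx'|Hx'].
    (* Below the horizontal axis, [turnS] exceeds [turnE] by exactly one turn. *)
    + rewrite <- (con_per _ _ _ _ _ HK). f_equal.
      unfold turnE, turnS. rewrite (atan_quot_neg x y). field; lra.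
      apply Rdiv_neg_pos; lra.
    + destruct (Rlt_dec 0 y); trivial; lra.
Qed.

Lemma height_in x y : rsq x y <= 1 / 4 -> height k x y = 5 * k * x + 2 * k.
Proof. intros H; unfold height, inner_cut. rewrite sg_le0 by lra. ring. Qed.

Lemma height_out x y : 1 / 2 <= rsq x y -> height k x y = 0.
Proof. intros H; unfold height, inner_cut. rewrite sg_ge1 by lra. ring. Qed.

Lemma outer_cut_in x y : rsq x y <= 5 / 8 -> outer_cut x y = 0.
Proof. intros H; unfold outer_cut. rewrite sg_le0 by lra. ring. Qed.

Lemma fill_DC x y : DC x y -> fill K k (x, y) = c.
Proof.
  intros [H1 H2]. unfold fill; simpl. apply (con_end _ _ _ _ _ HK).
  rewrite height_in by lra. generalize (con_pos _ _ _ _ _ HK). nra.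
Qed.

Lemma fill_smooth : smooth_map2 (fill K k).
Proof.
  assert (H : forall x y, exists D (T : R -> R -> R), D x y /\ open2 D /\ smooth2 D T /\
     forall u v, D u v -> fill K k (u, v) = K (height k u v) (T u v)).
  { intros x y. destruct (Rtotal_order x 0) as [Hx|[Hx|Hx]].
    - exists DW, turnW. split; [exact Hx|]. split; [apply open_DW|].
      split; [|apply fill_DW]. intros n; now apply turnW_Cn2.
    - destruct (Rlt_dec (1 / 5) y) as [Hy|Hy].
      { exists DN, turnN. split; [exact Hy|]. split; [apply open_DN|].
        split; [|apply fill_DN]. intros n; apply turnN_Cn2; unfold DN; intros; lra. }
      destruct (Rlt_dec y (-(1 / 5))) as [Hy'|Hy'].
      { exists DS, turnS. split; [exact Hy'|]. split; [apply open_DS|].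
        split; [|apply fill_DS]. intros n; apply turnS_Cn2; unfold DS; intros; lra. }
      (* Near this part of the vertical axis the map is constantly c, so any smooth angle can
         replace the discontinuous one. *)
      exists DC, (fun _ _ => 0). split; [unfold DC, rsq; split; nra|].
      split; [apply open_DC|]. split; [intros n; apply Cn2_const|].
      intros u v Huv. rewrite (fill_DC u v Huv). symmetry.
      destruct Huv as [H1 H2]. apply (con_end _ _ _ _ _ HK).
      rewrite height_in by lra. generalize (con_pos _ _ _ _ _ HK). nra.
    - exists DE, turnE. split; [exact Hx|]. split; [apply open_DE|].
      split; [|apply fill_DE]. intros n; now apply turnE_Cn2. }
  intros n x y; split.
  - apply (smooth2_local (fun u v => fst (fill K k (u, v)))). clear x y; intros x y.
    destruct (H x y) as [D [T [Dxy [HD [HT HF]]]]].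
    exists D, (fun u v => fst (K (height k u v) (T u v))). repeat split; trivial.
    + intros m. apply (con_smooth _ _ _ _ _ HK); trivial. apply height_Cn2.
    + intros u v Duv. now rewrite HF.
  - apply (smooth2_local (fun u v => snd (fill K k (u, v)))). clear x y; intros x y.
    destruct (H x y) as [D [T [Dxy [HD [HT HF]]]]].
    exists D, (fun u v => snd (K (height k u v) (T u v))). repeat split; trivial.
    + intros m. apply (con_smooth _ _ _ _ _ HK); trivial. apply height_Cn2.
    + intros u v Duv. now rewrite HF.
Qed.

(** The branch of the angle does not matter: P has period 1, so it suffices that cosine and sine of
    [turn], measured in full turns, return the point. *)
Lemma fill_boundary t : fill K k (cos (2 * PI * t), sin (2 * PI * t)) = P t.
Proof.
  set (x := cos (2 * PI * t)). set (y := sin (2 * PI * t)).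
  assert (Hr : rsq x y = 1).
  { unfold rsq, x, y. generalize (sin2_cos2 (2 * PI * t)). unfold Rsqr; lra. }
  unfold fill; simpl. rewrite (con_start _ _ _ _ _ HK) by (rewrite height_out; lra).
  cut (cos (2 * PI * turn x y) = x /\ sin (2 * PI * turn x y) = y).
  { intros [H1 H2]. destruct (angle_unique _ _ H1 H2) as [n Hn].
    generalize PI_RGT_0; intros Hpi.
    replace (turn x y) with (t + IZR n).
    - apply per_Z. apply HP.
    - apply (Rmult_eq_reg_l (2 * PI)); lra. }
  generalize PI_RGT_0; intros Hpi.
  assert (Ho : outer_cut x y = 1) by (unfold outer_cut; apply sg_ge1; lra).
  unfold rsq in Hr. unfold turn.
  destruct (Rlt_dec x 0) as [Hx|Hx]; [|destruct (Rlt_dec 0 x) as [Hx'|Hx']].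
  - unfold turnW; rewrite Ho.
    replace (2 * PI * _) with (atan (- y / - x) + PI).
    + rewrite neg_cos, neg_sin.
      destruct (cos_sin_atan_quot (- x) (- y)) as [E1 E2]; try lra.
    + replace (- y / - x) with (y / x) by (field; lra). field; lra.
  - unfold turnE; rewrite Ho.
    replace (2 * PI * _) with (atan (y / x)) by (field; lra).
    now apply cos_sin_atan_quot.
  - assert (E : x = 0) by lra.
    assert (Ea : atan (x / y) = 0) by (rewrite E; unfold Rdiv; rewrite Rmult_0_l; apply atan_0).
    destruct (Rlt_dec 0 y) as [Hy|Hy].
    + unfold turnN; rewrite Ho, Ea.
      replace (2 * PI * _) with (PI / 2) by (field; lra).
      rewrite cos_PI2, sin_PI2. rewrite E in Hr. split; nra.
    + unfold turnS; rewrite Ho, Ea.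
      replace (2 * PI * _) with (PI / 2 + PI) by (field; lra).
      rewrite neg_cos, neg_sin, cos_PI2, sin_PI2. rewrite E in Hr. split; nra.
Qed.

Lemma jac_fill_start (D : R -> R -> Prop) T x y :
  open2 D -> D x y -> smooth2 D T ->
  (forall u v, D u v -> fill K k (u, v) = K (height k u v) (T u v)) ->
  (forall u v, D u v -> height k u v <= 0) -> jac_det (fill K k) x y = 0.
Proof.
  intros HD Dxy HT Hf Hh.
  apply (jac_det_rank1 (fill K k) P D T); trivial.
  - intros u v Duv. rewrite Hf by trivial. apply (con_start _ _ _ _ _ HK); auto.
  - exists (fst (velocity P (T x y))). exact (proj1 (sloop_derive P HP (T x y))).
  - exists (snd (velocity P (T x y))). exact (proj2 (sloop_derive P HP (T x y))).
Qed.

Lemma jac_fill_turn (D : R -> R -> Prop) t0 x y :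
  open2 D -> D x y ->
  (forall u v, D u v -> fill K k (u, v) = K (height k u v) t0) ->
  jac_det (fill K k) x y = 0.
Proof.
  intros HD Dxy Hf.
  destruct (con_smooth _ _ _ _ _ HK 1 (fun _ _ => True) (fun x _ => x) (fun _ _ => t0))
    as [[_ [f1 [f1' [Hf1 _]]]] [_ [f2 [f2' [Hf2 _]]]]].
  - apply Cn2_fst.
  - apply Cn2_const.
  - apply (jac_det_rank1 (fill K k) (fun s => K s t0) D (height k)); trivial.
    + apply height_Cn2.
    + eexists; now apply (Hf1 (height k x y) 0).
    + eexists; now apply (Hf2 (height k x y) 0).
Qed.

Lemma jac_fill_N x y : 1 / 5 < y -> jac_det (fill K k) x y = 0.
Proof.
  intros Hy. destruct (Rlt_dec (1 / 2) (rsq x y)) as [H|H].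
  - apply (jac_fill_start (fun u v => DN u v /\ 1 / 2 < rsq u v) turnN).
    + apply open2_and; [apply open_DN | apply open_out].
    + now split.
    + intros n; apply turnN_Cn2; unfold DN; intros; lra.
    + intros u v [Huv _]; now apply fill_DN.
    + intros u v [_ Huv]; rewrite height_out; lra.
  - apply (jac_fill_turn (fun u v => DN u v /\ rsq u v < 5 / 8) 0).
    + apply open2_and; [apply open_DN | apply open_in].
    + split; [trivial | lra].
    + intros u v [H1 H2]. rewrite fill_DN by trivial. f_equal.
      unfold turnN. rewrite outer_cut_in by lra. ring.
Qed.

Lemma jac_fill_S x y : y < - (1 / 5) -> jac_det (fill K k) x y = 0.
Proof.
  intros Hy. destruct (Rlt_dec (1 / 2) (rsq x y)) as [H|H].
  - apply (jac_fill_start (fun u v => DS u v /\ 1 / 2 < rsq u v) turnS).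
    + apply open2_and; [apply open_DS | apply open_out].
    + now split.
    + intros n; apply turnS_Cn2; unfold DS; intros; lra.
    + intros u v [Huv _]; now apply fill_DS.
    + intros u v [_ Huv]; rewrite height_out; lra.
  - apply (jac_fill_turn (fun u v => DS u v /\ rsq u v < 5 / 8) 1).
    + apply open2_and; [apply open_DS | apply open_in].
    + split; [trivial | lra].
    + intros u v [H1 H2]. rewrite fill_DS by trivial. f_equal.
      unfold turnS. rewrite outer_cut_in by lra. ring.
Qed.

Lemma jac_fill_E x y : 0 < x -> jac_det (fill K k) x y = 0.
Proof.
  intros Hx. destruct (Rlt_dec (1 / 2) (rsq x y)) as [H|H].
  - apply (jac_fill_start (fun u v => DE u v /\ 1 / 2 < rsq u v) turnE).
    + apply open2_and; [apply open_DE | apply open_out].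
    + now split.
    + intros n; apply turnE_Cn2; unfold DE; intros; lra.
    + intros u v [Huv _]; now apply fill_DE.
    + intros u v [_ Huv]; rewrite height_out; lra.
  - apply (jac_fill_turn (fun u v => DE u v /\ rsq u v < 5 / 8) 0).
    + apply open2_and; [apply open_DE | apply open_in].
    + split; [trivial | lra].
    + intros u v [H1 H2]. rewrite fill_DE by trivial. f_equal.
      unfold turnE. rewrite outer_cut_in by lra. ring.
Qed.

Lemma jac_fill_C x y : DC x y -> jac_det (fill K k) x y = 0.
Proof.
  intros H. apply (jac_det_rank1 (fill K k) (fun _ => c) DC (fun _ _ => 0)); trivial.
  - apply open_DC.
  - apply Cn2_const.
  - intros u v Huv. now apply fill_DC.
  - apply @ex_derive_const.
  - apply @ex_derive_const.
Qed.

Lemma jac_fill_right x y : - (1 / 5) < x -> jac_det (fill K k) x y = 0.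
Proof.
  intros Hx. destruct (Rlt_dec 0 x) as [H|H]; [now apply jac_fill_E|].
  destruct (Rlt_dec (1 / 5) y) as [Hy|Hy]; [now apply jac_fill_N|].
  destruct (Rlt_dec y (- (1 / 5))) as [Hy'|Hy']; [now apply jac_fill_S|].
  apply jac_fill_C. split; trivial. unfold rsq; nra.
Qed.

(** Left of the box the height is nonpositive, where K has not yet left P and depends on the angle
    alone. *)
Lemma jac_fill_left x y : x < - (2 / 5) -> jac_det (fill K k) x y = 0.
Proof.
  intros Hx. apply (jac_fill_start (fun u _ => u < - (2 / 5)) turnW); trivial.
  - apply (open2_lt (fun x _ => x) (fun _ _ => - (2 / 5))); auto with c2d.
  - intros n; apply turnW_Cn2; intros; lra.
  - intros u v Huv. apply fill_DW; unfold DW; lra.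
  - intros u v Huv. generalize (con_pos _ _ _ _ _ HK). intros Hk.
    unfold height, inner_cut. generalize (sg_range (4 * rsq u v - 1)); intros Hs.
    assert (5 * k * u + 2 * k <= 0) by nra.
    rewrite <- (Rmult_0_r (1 - sg (4 * rsq u v - 1))).
    apply Rmult_le_compat_l; lra.
Qed.

Lemma clock_derive y : is_derive clock y (- (5 / 2) * sg' (1 / 2 - 5 / 2 * y)).
Proof.
  apply (is_derive_comp sg (fun y => 1 / 2 - 5 / 2 * y)).
  - apply sg_derive.
  - auto_derive; trivial. field.
Qed.

Lemma jac_fill_box x y : x < - (1 / 5) -> rsq x y < 1 / 4 ->
  jac_det (fill K k) x y =
  5 * k * (- (5 / 2) * sg' (1 / 2 - 5 / 2 * y)) * jac K (5 * k * x + 2 * k) (clock y).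
Proof.
  intros Hx Hr.
  set (D := fun u v => DW u v /\ rsq u v < 1 / 4).
  assert (HD : open2 D) by (apply open2_and; [apply open_DW | apply open_in]).
  assert (Dxy : D x y) by (split; unfold DW; lra).
  assert (Hf : forall u v, D u v -> fill K k (u, v) = K (5 * k * u + 2 * k) (clock v)).
  { intros u v [H1 H2]. rewrite fill_DW, height_in by (trivial; lra). f_equal.
    unfold turnW. rewrite outer_cut_in by lra. ring. }
  assert (L1 : locally x (fun u => D u y)) by (apply locally_2d_slice1; auto).
  assert (L2 : locally y (fun v => D x v)) by (apply locally_2d_slice2; auto).
  destruct (con_smooth _ _ _ _ _ HK 1 (fun _ _ => True) (fun x _ => x) (fun _ y => y))
    as [[_ [f1 [f2 [Hf1 _]]]] [_ [g1 [g2 [Hg1 _]]]]]; [apply Cn2_fst | apply Cn2_snd |].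
  specialize (Hf1 (5 * k * x + 2 * k) (clock y) I).
  specialize (Hg1 (5 * k * x + 2 * k) (clock y) I).
  destruct Hf1 as [F1 F2], Hg1 as [G1 G2].
  assert (Hl : is_derive (fun u => 5 * k * u + 2 * k) x (5 * k)).
  { auto_derive; trivial. ring. }
  generalize (clock_derive y); intros Hcl.
  rewrite jacE. unfold jac_det.
  rewrite (Derive_eq _ _ _ F1), (Derive_eq _ _ _ F2), (Derive_eq _ _ _ G1), (Derive_eq _ _ _ G2).
  assert (Q1 : Derive (fun u => fst (fill K k (u, y))) x =
     5 * k * f1 (5 * k * x + 2 * k) (clock y)).
  { apply Derive_eq. apply (is_derive_ext_loc (fun u => fst (K (5 * k * u + 2 * k) (clock y)))).
    - generalize L1; apply filter_imp; intros u Hu; now rewrite Hf.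
    - apply (is_derive_comp (fun s => fst (K s (clock y))) (fun u => 5 * k * u + 2 * k)); trivial. }
  assert (Q2 : Derive (fun u => snd (fill K k (u, y))) x =
     5 * k * g1 (5 * k * x + 2 * k) (clock y)).
  { apply Derive_eq. apply (is_derive_ext_loc (fun u => snd (K (5 * k * u + 2 * k) (clock y)))).
    - generalize L1; apply filter_imp; intros u Hu; now rewrite Hf.
    - apply (is_derive_comp (fun s => snd (K s (clock y))) (fun u => 5 * k * u + 2 * k)); trivial. }
  assert (Q3 : Derive (fun v => fst (fill K k (x, v))) y =
     - (5 / 2) * sg' (1 / 2 - 5 / 2 * y) * f2 (5 * k * x + 2 * k) (clock y)).
  { apply Derive_eq. apply (is_derive_ext_loc (fun v => fst (K (5 * k * x + 2 * k) (clock v)))).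
    - generalize L2; apply filter_imp; intros u Hu; now rewrite Hf.
    - apply (is_derive_comp (fun t => fst (K (5 * k * x + 2 * k) t)) clock); trivial. }
  assert (Q4 : Derive (fun v => snd (fill K k (x, v))) y =
     - (5 / 2) * sg' (1 / 2 - 5 / 2 * y) * g2 (5 * k * x + 2 * k) (clock y)).
  { apply Derive_eq. apply (is_derive_ext_loc (fun v => snd (K (5 * k * x + 2 * k) (clock v)))).
    - generalize L2; apply filter_imp; intros u Hu; now rewrite Hf.
    - apply (is_derive_comp (fun t => snd (K (5 * k * x + 2 * k) t)) clock); trivial. }
  rewrite Q1, Q2, Q3, Q4. ring.
Qed.

Definition sheet (s : R) : R := RInt (fun t => Rabs (jac K s t)) 0 1.

Lemma is_RInt_zero (f : R -> R) a b :
  (forall x, Rmin a b < x < Rmax a b -> f x = 0) -> is_RInt f a b 0.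
Proof.
  intros H. apply (is_RInt_ext (fun _ => 0)).
  - intros; symmetry; auto.
  - evar_last; [apply @is_RInt_const|]. unfold scal; simpl; unfold mult; simpl; ring.
Qed.

Lemma fill_inner x : - (2 / 5) < x < - (1 / 5) ->
  RInt (fun y => Rabs (jac_det (fill K k) x y)) (- sqrt (1 - x ^ 2)) (sqrt (1 - x ^ 2)) =
  5 * k * sheet (5 * k * x + 2 * k).
Proof.
  intros Hx. set (b := sqrt (1 - x ^ 2)).
  assert (Hb : 1 / 5 < b).
  { unfold b. rewrite <- (sqrt_square (1 / 5)) by lra. apply sqrt_lt_1; nra. }
  apply is_RInt_unique.
  assert (I1 : is_RInt (fun y => Rabs (jac_det (fill K k) x y)) (- b) (- (1 / 5)) 0).
  { apply is_RInt_zero. intros y Hy. rewrite Rmin_left, Rmax_right in Hy by lra.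
    rewrite jac_fill_S by lra. apply Rabs_R0. }
  assert (I3 : is_RInt (fun y => Rabs (jac_det (fill K k) x y)) (1 / 5) b 0).
  { apply is_RInt_zero. intros y Hy. rewrite Rmin_left, Rmax_right in Hy by lra.
    rewrite jac_fill_N by lra. apply Rabs_R0. }
  assert (I2 : is_RInt (fun y => Rabs (jac_det (fill K k) x y)) (- (1 / 5)) (1 / 5)
                 (5 * k * sheet (5 * k * x + 2 * k))).
  { set (g := fun t => Rabs (jac K (5 * k * x + 2 * k) t)).
    assert (J : is_RInt (fun y => scal (- (5 / 2) * sg' (1 / 2 - 5 / 2 * y)) (g (clock y)))
       (- (1 / 5)) (1 / 5) (RInt g (clock (- (1 / 5))) (clock (1 / 5)))).
    { apply (@is_RInt_comp R_CompleteNormedModule g clock).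
      - intros y _. apply (cont2_slice (fun s t => Rabs (jac K s t))).
        apply jac_cont, (con_smooth _ _ _ _ _ HK).
      - intros y _. split; [apply clock_derive|].
        apply continuous_rmult; [apply continuous_const|].
        apply (continuous_comp (fun y => 1 / 2 - 5 / 2 * y) sg').
        + cont.
        + apply sg'_cont. }
    replace (clock (- (1 / 5))) with 1 in J by (unfold clock; rewrite sg_ge1; lra).
    replace (clock (1 / 5)) with 0 in J by (unfold clock; rewrite sg_le0; lra).
    (* [clock] decreases, so the substitution runs from 1 to 0. The factor -(5 k) restores the sign
       and supplies the absolute value of the horizontal derivative. *)
    apply (is_RInt_scal _ _ _ (- (5 * k))) in J.
    unfold sheet. fold g.
    replace (5 * k * RInt g 0 1) with (scal (- (5 * k)) (RInt g 1 0)).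
    2:{ rewrite <- (opp_RInt_swap g 0 1).
        - unfold scal, opp; simpl; unfold mult; simpl; ring.
        - exact (ex_RInt_jac K (con_smooth _ _ _ _ _ HK) _ _ _). }
    revert J; apply is_RInt_ext. intros y Hy. rewrite Rmin_left, Rmax_right in Hy by lra.
    rewrite jac_fill_box by (unfold rsq; nra).
    generalize (con_pos _ _ _ _ _ HK) (sg'_ge0 (1 / 2 - 5 / 2 * y)); intros Hk Hs.
    rewrite Rabs_mult, Rabs_left1 by nra.
    unfold scal; simpl; unfold mult; simpl. unfold g. ring. }
  replace (5 * k * sheet (5 * k * x + 2 * k)) with
    (plus (plus 0 (5 * k * sheet (5 * k * x + 2 * k))) 0).
  - apply @is_RInt_Chasles with (1 / 5); trivial.
    now apply @is_RInt_Chasles with (- (1 / 5)).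
  - unfold plus; simpl; ring.
Qed.

Lemma fill_area : disk_abs_area (fill K k) <= A.
Proof.
  unfold disk_abs_area.
  set (F := fun x => RInt _ _ _).
  generalize (con_pos _ _ _ _ _ HK); intros Hk.
  apply Rle_trans with (2 := con_area _ _ _ _ _ HK). right.
  assert (Z : forall x, x < - (2 / 5) \/ - (1 / 5) < x -> F x = 0).
  { intros x Hx. unfold F. apply is_RInt_unique, is_RInt_zero. intros y _.
    destruct Hx; [rewrite jac_fill_left by lra | rewrite jac_fill_right by lra];
      apply Rabs_R0. }
  assert (I1 : is_RInt F (-1) (- (2 / 5)) 0).
  { apply is_RInt_zero. intros y Hy. rewrite Rmin_left, Rmax_right in Hy by lra.
    apply Z; lra. }
  assert (I3 : is_RInt F (- (1 / 5)) 1 0).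
  { apply is_RInt_zero. intros y Hy. rewrite Rmin_left, Rmax_right in Hy by lra.
    apply Z; lra. }
  assert (I2 : is_RInt F (- (2 / 5)) (- (1 / 5)) (RInt sheet 0 k)).
  { assert (J : is_RInt (fun x => scal (5 * k) (sheet (5 * k * x + 2 * k)))
       (- (2 / 5)) (- (1 / 5)) (RInt sheet 0 k)).
    { apply @is_RInt_comp_lin.
      replace (5 * k * - (2 / 5) + 2 * k) with 0 by field.
      replace (5 * k * - (1 / 5) + 2 * k) with k by field.
      apply @RInt_correct. exact (ex_RInt_RInt_jac K (con_smooth _ _ _ _ _ HK) _ _). }
    revert J. apply is_RInt_ext. intros x Hx. rewrite Rmin_left, Rmax_right in Hx by lra.
    unfold F. rewrite fill_inner by lra. reflexivity. }
  apply is_RInt_unique.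
  replace (RInt _ 0 k) with (plus (plus 0 (RInt sheet 0 k)) 0)
    by (unfold plus; simpl; rewrite Rplus_0_l; apply Rplus_0_r).
  apply @is_RInt_Chasles with (- (1 / 5)); trivial.
  now apply @is_RInt_Chasles with (- (2 / 5)).
Qed.
End Fill.

Lemma Chain_Area P A : Chain P A -> Rbar_le (Area P) (Finite A).
Proof.
  intros HC. generalize (Chain_sloop P A HC); intros HP.
  destruct (Chain_Contraction P A HC) as [K [k [c HK]]].
  apply Rbar_le_trans with (Finite (disk_abs_area (fill K k))).
  - unfold Area. apply Glb_Rbar_correct. exists (fill K k); split; trivial.
    split; [|split].
    + now apply fill_smooth with P A c.
    + intros x y _. apply (con_avoid _ _ _ _ _ HK).
    + now apply fill_boundary with A c.
  - now apply fill_area with P c.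
Qed.

(** * Polygons *)

Fixpoint psum (f : nat -> R) (n : nat) : R :=
  match n with O => 0 | S m => psum f m + f m end.

Lemma psum_le f g n : (forall k, (k < n)%nat -> f k <= g k) -> psum f n <= psum g n.
Proof.
  induction n as [|n IH]; intros H; simpl; [lra|].
  apply Rplus_le_compat; [apply IH|apply H]; auto with arith.
Qed.

Lemma psum_plus f g n : psum (fun k => f k + g k) n = psum f n + psum g n.
Proof. induction n as [|n IH]; simpl; [ring|rewrite IH; ring]. Qed.

Lemma psum_scal c f n : psum (fun k => c * f k) n = c * psum f n.
Proof. induction n as [|n IH]; simpl; [ring|rewrite IH; ring]. Qed.

(* The step [sg] stops the motion to infinite order at every vertex, so this
   parametrization is smooth. *)
Definition polygon (N : nat) (p : Z -> R * R) (t : R) : R * R :=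
  let k := Int_part (INR N * t) in
  lerp (sg (INR N * t - IZR k)) (p k) (p (k + 1)%Z).

Lemma lerp_0 p q : lerp 0 p q = p.
Proof. unfold lerp; destruct p; simpl; f_equal; ring. Qed.

Lemma lerp_1 p q : lerp 1 p q = q.
Proof. unfold lerp; destruct q; simpl; f_equal; ring. Qed.

Lemma lerp_refl s p : lerp s p p = p.
Proof. unfold lerp; destruct p; simpl; f_equal; ring. Qed.

Lemma polygon_piece N p k t : IZR k <= INR N * t <= IZR k + 1 ->
  polygon N p t = lerp (sg (INR N * t - IZR k)) (p k) (p (k + 1)%Z).
Proof.
  intros [H1 H2]. unfold polygon.
  (* At the right endpoint [Int_part] is already k + 1, and both formulas give the vertex p (k +
     1). *)
  destruct (Req_dec (INR N * t) (IZR k + 1)) as [E|E].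
  - replace (Int_part (INR N * t)) with (k + 1)%Z.
    + rewrite plus_IZR, E.
      replace (IZR k + 1 - (IZR k + 1)) with 0 by ring.
      replace (IZR k + 1 - IZR k) with 1 by ring.
      now rewrite (sg_le0 0), (sg_ge1 1), lerp_0, lerp_1 by lra.
    + apply Int_part_spec. rewrite plus_IZR; lra.
  - now replace (Int_part (INR N * t)) with k by (apply Int_part_spec; lra).
Qed.

Lemma open_window c lo hi : open (fun t : R => lo < c * t /\ c * t < hi).
Proof.
  assert (C : forall t, continuous (fun t => c * t) t) by (intros; cont).
  apply open_and.
  - apply (open_comp (fun t => c * t) (fun u => lo < u)); [|apply open_gt].
    intros t _; apply C.
  - apply (open_comp (fun t => c * t) (fun u => u < hi)); [|apply open_lt].
    intros t _; apply C.
Qed.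

Lemma polygon_smooth N p (pr : R * R -> R) : (pr = fst \/ pr = snd) ->
  smooth1 everywhere (fun t => pr (polygon N p t)).
Proof.
  intros Hpr n. apply Cn1_local. intros t.
  set (k := Int_part (INR N * t)).
  destruct (base_Int_part (INR N * t)) as [B1 B2]; fold k in B1, B2.
  set (D := fun t => IZR k - 1 < INR N * t /\ INR N * t < IZR k + 1).
  (* On a window around a vertex the two adjacent pieces are covered by one formula, because on
     either side one of the two steps is constant. *)
  exists D, (fun t => pr (p (k - 1)%Z)
    + sg (INR N * t - IZR k + 1) * (pr (p k) - pr (p (k - 1)%Z))
    + sg (INR N * t - IZR k) * (pr (p (k + 1)%Z) - pr (p k))).
  split; [|split; [|split]].
  - split; lra.
  - apply open_window.
  - intros m.
    assert (HL : Cn1 m D (fun t => sg (INR N * t - IZR k + 1))).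
    { apply (Cn1_comp m everywhere); auto. apply sg_smooth.
      apply Cn1_plus; [|apply Cn1_const].
      apply Cn1_minus; [|apply Cn1_const].
      apply Cn1_mult; [apply Cn1_const | apply Cn1_id]. }
    apply Cn1_plus; [apply Cn1_plus|].
    + apply Cn1_const.
    + apply Cn1_mult; [apply HL | apply Cn1_const].
    + apply Cn1_mult; [|apply Cn1_const].
      apply (Cn1_comp m everywhere); auto. apply sg_smooth.
      apply Cn1_minus; [|apply Cn1_const].
      apply Cn1_mult; [apply Cn1_const | apply Cn1_id].
  - intros u [U1 U2].
    destruct (Rle_dec (IZR k) (INR N * u)) as [H|H].
    + rewrite (polygon_piece N p k u) by lra. rewrite (sg_ge1 (_ + 1)) by lra.
      destruct Hpr; subst pr; unfold lerp; simpl; ring.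
    + rewrite (polygon_piece N p (k - 1) u) by (rewrite minus_IZR; lra).
      rewrite (sg_le0 (INR N * u - IZR k)) by lra.
      replace (k - 1 + 1)%Z with k by ring.
      replace (INR N * u - IZR (k - 1)) with (INR N * u - IZR k + 1)
        by (rewrite minus_IZR; ring).
      destruct Hpr; subst pr; unfold lerp; simpl; ring.
Qed.

Definition periodic_seq {X : Type} (N : nat) (p : Z -> X) : Prop :=
  forall k, p (k + Z.of_nat N)%Z = p k.

Lemma polygon_sloop N p : periodic_seq N p -> sloop (polygon N p).
Proof.
  intros H. split; [|split].
  - apply polygon_smooth; auto.
  - apply polygon_smooth; auto.
  - intros t. unfold polygon. set (k := Int_part (INR N * t)).
    replace (Int_part (INR N * (t + 1))) with (k + Z.of_nat N)%Z.
    + rewrite plus_IZR, <- INR_IZR_INZ.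
      replace (INR N * (t + 1) - (IZR k + INR N)) with (INR N * t - IZR k) by ring.
      replace (k + Z.of_nat N + 1)%Z with (k + 1 + Z.of_nat N)%Z by ring.
      now rewrite !H.
    + apply Int_part_spec. rewrite plus_IZR, <- INR_IZR_INZ.
      destruct (base_Int_part (INR N * t)) as [B1 B2]; fold k in B1, B2. lra.
Qed.

Lemma polygon_const N c : polygon N (fun _ => c) = fun _ => c.
Proof. apply functional_extensionality; intros t; apply lerp_refl. Qed.

Definition vscal (a : R) (v : R * R) : R * R := (a * fst v, a * snd v).

Lemma polygon_velocity N p k t : IZR k < INR N * t < IZR k + 1 ->
  velocity (polygon N p) t =
  vscal (INR N * sg' (INR N * t - IZR k)) (vsub (p (k + 1)%Z) (p k)).
Proof.
  intros Ht.
  assert (L : locally t (fun u => IZR k < INR N * u /\ INR N * u < IZR k + 1)).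
  { now apply (open_window (INR N) (IZR k) (IZR k + 1)). }
  assert (S0 : forall a b, is_derive (fun u => (1 - sg (INR N * u - IZR k)) * a
              + sg (INR N * u - IZR k) * b) t (INR N * sg' (INR N * t - IZR k) * (b - a))).
  { intros a b.
    assert (S1 : is_derive (fun u => sg (INR N * u - IZR k)) t (INR N * sg' (INR N * t - IZR k))).
    { apply (is_derive_comp sg (fun u => INR N * u - IZR k)); [apply sg_derive|].
      auto_derive; trivial. ring. }
    apply (is_derive_ext (fun u => a + sg (INR N * u - IZR k) * (b - a))).
    { intros u. simpl. ring. }
    evar_last.
    - apply @is_derive_plus; [apply @is_derive_const|].
      apply (is_derive_mult (fun u => sg (INR N * u - IZR k)) (fun _ => b - a)).
      + exact S1.
      + apply @is_derive_const.
      + intros; apply Rmult_comm.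
    - unfold plus, mult, zero; simpl; unfold mult; simpl. ring. }
  unfold velocity, vscal, vsub. cbn [fst snd]. f_equal.
  - apply Derive_eq.
    apply (is_derive_ext_loc (fun u => (1 - sg (INR N * u - IZR k)) * fst (p k)
              + sg (INR N * u - IZR k) * fst (p (k + 1)%Z))); [|apply S0].
    generalize L; apply filter_imp; intros u Hu. cbv beta.
    rewrite (polygon_piece N p k u) by lra. reflexivity.
  - apply Derive_eq.
    apply (is_derive_ext_loc (fun u => (1 - sg (INR N * u - IZR k)) * snd (p k)
              + sg (INR N * u - IZR k) * snd (p (k + 1)%Z))); [|apply S0].
    generalize L; apply filter_imp; intros u Hu. cbv beta.
    rewrite (polygon_piece N p k u) by lra. reflexivity.
Qed.

(** On the k-th subinterval the substitution s = N t - k reduces the bound to [RInt_sg_affine]. The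
    pointwise hypothesis is asked only in the open subintervals, where the velocity of a polygon has
    a closed formula. *)
Lemma RInt_pieces N (g : R -> R) (A B : nat -> R) : (0 < N)%nat ->
  (forall a b, ex_RInt g a b) ->
  (forall k t, INR k < INR N * t < INR k + 1 ->
     g t <= INR N * sg' (INR N * t - INR k) *
            ((1 - sg (INR N * t - INR k)) * A k + sg (INR N * t - INR k) * B k)) ->
  RInt g 0 1 <= psum (fun k => (A k + B k) / 2) N.
Proof.
  intros HN Hg Hle. assert (N0 : 0 < INR N) by (apply lt_0_INR; lia).
  cut (forall m, RInt g 0 (INR m / INR N) <= psum (fun k => (A k + B k) / 2) m).
  { intros H. generalize (H N). now replace (INR N / INR N) with 1 by (field; lra). }
  induction m as [|m IH].
  - simpl. replace (0 / INR N) with 0 by (field; lra). rewrite RInt_point.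
    unfold zero; simpl; lra.
  - rewrite <- (RInt_Chasles g 0 (INR m / INR N)) by trivial.
    apply Rplus_le_compat; trivial.
    assert (Hm : INR m / INR N <= INR (S m) / INR N).
    { apply Rmult_le_compat_r; [left; now apply Rinv_0_lt_compat|].
      rewrite S_INR; lra. }
    assert (J : is_RInt (fun t => scal (INR N) (sg' (INR N * t + - INR m) *
       ((1 - sg (INR N * t + - INR m)) * A m + sg (INR N * t + - INR m) * B m)))
       (INR m / INR N) (INR (S m) / INR N) ((A m + B m) / 2)).
    { apply (is_RInt_comp_lin (fun s => sg' s * ((1 - sg s) * A m + sg s * B m))).
      replace (INR N * (INR m / INR N) + - INR m) with 0 by (field; lra).
      replace (INR N * (INR (S m) / INR N) + - INR m) with 1
        by (rewrite S_INR; field; lra).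
      apply RInt_sg_affine. }
    rewrite <- (is_RInt_unique _ _ _ _ J).
    apply RInt_le; trivial.
    + eexists; apply J.
    + intros t [T1 T2].
      replace (INR N * t + - INR m) with (INR N * t - INR m) by ring.
      unfold scal; simpl; unfold mult; simpl. rewrite <- Rmult_assoc.
      apply Hle. apply Rlt_div_l in T1; trivial. apply Rlt_div_r in T2; trivial.
      rewrite S_INR in T2. lra.
Qed.

(** An upper bound for the area swept by the linear homotopy from the segment p p' to the segment q
    q'. Its Jacobian is affine in time and affine along the segment, so the integral of the absolute
    value is at most the mean of its four corner values. *)
Definition quad (p p' q q' : R * R) : R :=
  (Rabs (cross (vsub p' p) (vsub q p)) + Rabs (cross (vsub p' p) (vsub q' p')) +
   Rabs (cross (vsub q' q) (vsub q p)) + Rabs (cross (vsub q' q) (vsub q' p'))) / 4.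

Lemma cross_lerp_bound tau c a b v : 0 <= tau <= 1 -> 0 <= c ->
  Rabs (cross (lerp tau a b) (vscal c v)) <=
  c * ((1 - tau) * Rabs (cross v a) + tau * Rabs (cross v b)).
Proof.
  intros Ht Hc.
  replace (cross (lerp tau a b) (vscal c v)) with
    (c * ((1 - tau) * - cross v a + tau * - cross v b))
    by (unfold cross, lerp, vscal; simpl; ring).
  rewrite Rabs_mult, (Rabs_pos_eq c) by trivial.
  apply Rmult_le_compat_l; trivial.
  eapply Rle_trans; [apply Rabs_triang|].
  rewrite !Rabs_mult, !Rabs_Ropp, (Rabs_pos_eq tau), (Rabs_pos_eq (1 - tau)) by lra. lra.
Qed.

Lemma vsub_lerp tau p p' q q' :
  vsub (lerp tau q q') (lerp tau p p') = lerp tau (vsub q p) (vsub q' p').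
Proof. unfold vsub, lerp; simpl; f_equal; ring. Qed.

Lemma swept_polygon N p q r :
  (0 < N)%nat -> periodic_seq N p -> periodic_seq N q -> periodic_seq N r ->
  RInt (fun t => Rabs (cross (vsub (polygon N q t) (polygon N p t)) (velocity (polygon N r) t))) 0 1
  <= psum (fun i => let k := Z.of_nat i in
     (Rabs (cross (vsub (r (k + 1)%Z) (r k)) (vsub (q k) (p k))) +
      Rabs (cross (vsub (r (k + 1)%Z) (r k)) (vsub (q (k + 1)%Z) (p (k + 1)%Z)))) / 2) N.
Proof.
  intros HN Hp Hq Hr. apply RInt_pieces; trivial.
  - apply swept_ex_RInt; now apply polygon_sloop.
  - intros i t. rewrite INR_IZR_INZ. intros Ht. set (k := Z.of_nat i) in *.
    rewrite (polygon_velocity N r k) by trivial.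
    rewrite (polygon_piece N p k), (polygon_piece N q k) by lra. rewrite vsub_lerp.
    apply cross_lerp_bound; [apply sg_range|].
    apply Rmult_le_pos; [apply pos_INR | apply sg'_ge0].
Qed.

Lemma Chain_polygon_step N p q A :
  (0 < N)%nat -> periodic_seq N p -> periodic_seq N q ->
  (forall k s tau, 0 <= s <= 1 -> 0 <= tau <= 1 ->
     ~ lattice (lerp s (lerp tau (p k) (p (k + 1)%Z)) (lerp tau (q k) (q (k + 1)%Z)))) ->
  Chain (polygon N q) A ->
  Chain (polygon N p) (psum (fun i => let k := Z.of_nat i in
     quad (p k) (p (k + 1)%Z) (q k) (q (k + 1)%Z)) N + A).
Proof.
  intros HN Hp Hq Hav HC. apply Chain_step with (polygon N q); trivial.
  - now apply polygon_sloop.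
  - intros s t Hs. unfold polygon. apply Hav; trivial. apply sg_range.
  - generalize (swept_polygon N p q p HN Hp Hq Hp) (swept_polygon N p q q HN Hp Hq Hq).
    intros H1 H2. eapply Rle_trans.
    + apply Rmult_le_compat_r; [lra|]. apply Rplus_le_compat; [apply H1 | apply H2].
    + rewrite <- psum_plus. unfold Rdiv at 1. rewrite Rmult_comm, <- psum_scal.
      apply psum_le. intros i _. unfold quad. simpl. lra.
Qed.

(** * Squares and their collapse *)

Definition vlen (v : R * R) : R := sqrt (fst v ^ 2 + snd v ^ 2).

Inductive dir := East | West | North | South.

Definition move (d : dir) (z : Z * Z) : Z * Z :=
  match d with
  | East => (fst z + 1, snd z)%Z
  | West => (fst z - 1, snd z)%Z
  | North => (fst z, snd z + 1)%Z
  | South => (fst z, snd z - 1)%Z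
  end.

(* Lists of directions are the nodes of the tree of unit squares that covers
   the punctured plane; the parent of a node is its tail. *)
Fixpoint cell (z0 : Z * Z) (l : list dir) : Z * Z :=
  match l with nil => z0 | d :: l' => move d (cell z0 l') end.

Definition in_square (z : Z * Z) (p : R * R) : Prop :=
  IZR (fst z) <= fst p <= IZR (fst z) + 1 /\
  IZR (snd z) <= snd p <= IZR (snd z) + 1 /\ ~ lattice p.

Lemma unit_integer (m a : Z) x : x = IZR a -> IZR m <= x <= IZR m + 1 ->
  x = IZR m \/ x = IZR m + 1.
Proof.
  intros -> [H1 H2]. rewrite <- plus_IZR in *. apply le_IZR in H1, H2.
  assert (a = m \/ a = m + 1)%Z as [E|E] by lia; rewrite E; auto.
Qed.

Lemma lerp_extreme s a b m : 0 < s < 1 -> m <= a <= m + 1 -> m <= b <= m + 1 ->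
  (1 - s) * a + s * b = m \/ (1 - s) * a + s * b = m + 1 ->
  a = (1 - s) * a + s * b.
Proof. intros Hs Ha Hb [H|H]; nra. Qed.

(** The corners are extreme points of the square: if an interior point of a segment is a corner, the
    whole segment is that corner. Removing the corners therefore keeps the square convex, and linear
    homotopies inside it avoid the lattice. *)
Lemma in_square_lerp z p q s : in_square z p -> in_square z q -> 0 <= s <= 1 ->
  in_square z (lerp s p q).
Proof.
  intros [H1 [H2 H3]] [H4 [H5 H6]] Hs. unfold in_square, lerp; cbn [fst snd].
  assert (X : IZR (fst z) <= (1 - s) * fst p + s * fst q <= IZR (fst z) + 1) by nra.
  assert (Y : IZR (snd z) <= (1 - s) * snd p + s * snd q <= IZR (snd z) + 1) by nra.
  split; [exact X|]. split; [exact Y|].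
  destruct (Req_dec s 0) as [E|N0].
  { subst s. generalize (lerp_0 p q). unfold lerp. now intros ->. }
  destruct (Req_dec s 1) as [E|N1].
  { subst s. generalize (lerp_1 p q). unfold lerp. now intros ->. }
  intros [a [b E]]. apply H3. exists a, b. injection E; intros E2 E1.
  assert (Hs' : 0 < s < 1) by lra.
  rewrite (surjective_pairing p). f_equal.
  - rewrite <- E1. apply (lerp_extreme s _ _ (IZR (fst z))); trivial.
    now apply unit_integer with a.
  - rewrite <- E2. apply (lerp_extreme s _ _ (IZR (snd z))); trivial.
    now apply unit_integer with b.
Qed.

(* Bilinear retraction of the unit square onto its bottom edge that shrinks
   the other three edges by the factor 1/3. *)
Definition rho (xi eta : R) : R := xi + eta * (1 - 2 * xi) / 3.

(** Here z is the child, reached from its parent by a move in direction d, so the retained edge lies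
    on the opposite side: the left edge for [East]. *)
Definition collapse (d : dir) (z : Z * Z) (p : R * R) : R * R :=
  let m := IZR (fst z) in let n := IZR (snd z) in
  let x := fst p in let y := snd p in
  match d with
  | East => (m, n + rho (y - n) (x - m))
  | West => (m + 1, n + rho (y - n) (m + 1 - x))
  | North => (m + rho (x - m) (y - n), n)
  | South => (m + rho (x - m) (n + 1 - y), n + 1)
  end.

Lemma rho_range xi eta : 0 <= xi <= 1 -> 0 <= eta <= 1 -> 0 <= rho xi eta <= 1.
Proof. intros H1 H2; unfold rho; split; nra. Qed.

(** With [rho_1]: only the ends of the root edge are sent to its ends, hence a square without its
    corners is retracted without meeting the lattice. *)
Lemma rho_0 xi eta : 0 <= xi <= 1 -> 0 <= eta <= 1 -> rho xi eta = 0 -> xi = 0 /\ eta = 0.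
Proof. intros H1 H2; unfold rho; intros H; split; nra. Qed.

Lemma rho_1 xi eta : 0 <= xi <= 1 -> 0 <= eta <= 1 -> rho xi eta = 1 -> xi = 1 /\ eta = 0.
Proof. intros H1 H2; unfold rho; intros H; split; nra. Qed.

Lemma not_lattice_rho (m n : Z) xi eta :
  0 <= xi <= 1 -> 0 <= eta <= 1 -> ~ (eta = 0 /\ (xi = 0 \/ xi = 1)) ->
  forall a, IZR n + rho xi eta <> IZR a.
Proof.
  intros Hx He Hn a E. generalize (rho_range xi eta Hx He); intros Hr.
  destruct (unit_integer n a _ E) as [H|H]; [lra| |]; apply Hn.
  - destruct (rho_0 xi eta); try lra; auto.
  - destruct (rho_1 xi eta); try lra; auto.
Qed.

Lemma collapse_parent d z p : in_square (move d z) p ->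
  in_square z (collapse d (move d z) p).
Proof.
  destruct z as [m n]. intros [H1 [H2 H3]].
  assert (L : forall a b : Z, fst p = IZR a -> snd p = IZR b -> False).
  { intros a b E1 E2. apply H3. exists a, b. rewrite (surjective_pairing p). congruence. }
  destruct d; cbn [move fst snd] in *; unfold in_square, collapse; cbn [fst snd];
    rewrite ?plus_IZR, ?minus_IZR in *.
  - assert (Hr := rho_range (snd p - IZR n) (fst p - (IZR m + 1)) ltac:(lra) ltac:(lra)).
    split; [lra|]. split; [lra|]. intros [a [b E]]. injection E; intros E2 E1.
    revert E2. apply not_lattice_rho; try exact m; try lra.
    intros [Q1 Q2]. destruct Q2; [apply (L (m + 1) n)%Z | apply (L (m + 1) (n + 1))%Z];
      rewrite ?plus_IZR; lra.
  - assert (Hr := rho_range (snd p - IZR n) (IZR m - 1 + 1 - fst p) ltac:(lra) ltac:(lra)).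
    split; [lra|]. split; [lra|]. intros [a [b E]]. injection E; intros E2 E1.
    revert E2. apply not_lattice_rho; try exact m; try lra.
    intros [Q1 Q2]. destruct Q2; [apply (L m n)%Z | apply (L m (n + 1))%Z];
      rewrite ?plus_IZR; lra.
  - assert (Hr := rho_range (fst p - IZR m) (snd p - (IZR n + 1)) ltac:(lra) ltac:(lra)).
    split; [lra|]. split; [lra|]. intros [a [b E]]. injection E; intros E2 E1.
    revert E1. apply not_lattice_rho; try exact m; try lra.
    intros [Q1 Q2]. destruct Q2; [apply (L m (n + 1))%Z | apply (L (m + 1) (n + 1))%Z];
      rewrite ?plus_IZR; lra.
  - assert (Hr := rho_range (fst p - IZR m) (IZR n - 1 + 1 - snd p) ltac:(lra) ltac:(lra)).
    split; [lra|]. split; [lra|]. intros [a [b E]]. injection E; intros E2 E1.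
    revert E1. apply not_lattice_rho; try exact m; try lra.
    intros [Q1 Q2]. destruct Q2; [apply (L m n)%Z | apply (L (m + 1) n)%Z];
      rewrite ?plus_IZR; lra.
Qed.

Lemma collapse_fix d z p : in_square (move d z) p -> in_square z p ->
  collapse d (move d z) p = p.
Proof.
  destruct z as [m n]. intros [H1 [H2 _]] [H4 [H5 _]]. rewrite (surjective_pairing p) at 2.
  destruct d; cbn [move fst snd] in *; unfold collapse; cbn [fst snd];
    rewrite ?plus_IZR, ?minus_IZR in *; f_equal; try lra; unfold rho.
  - replace (fst p - (IZR m + 1)) with 0 by lra; lra.
  - replace (IZR m - 1 + 1 - fst p) with 0 by lra; lra.
  - replace (snd p - (IZR n + 1)) with 0 by lra; lra.
  - replace (IZR n - 1 + 1 - snd p) with 0 by lra; lra.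
Qed.

(* The cost of collapsing one segment, in coordinates where the root edge is
   [eta = 0]. *)
Definition rho_quad (xi eta xi' eta' : R) : R :=
  let v1 := xi' - xi in let v2 := eta' - eta in
  let r := rho xi eta in let r' := rho xi' eta' in
  (Rabs (v1 * eta + v2 * (r - xi)) + Rabs (v1 * eta' + v2 * (r' - xi')) +
   Rabs ((r' - r) * eta) + Rabs ((r' - r) * eta')) / 4.

Lemma Rabs_prod_le a b c : Rabs b <= c -> Rabs (a * b) <= Rabs a * c.
Proof. intros H. rewrite Rabs_mult. apply Rmult_le_compat_l; trivial. apply Rabs_pos. Qed.

(** The four determinants and the length of the image are each at most |v1| + |v2| / 3. The mean of
    the former and the latter thus contribute this quantity once each. *)
Lemma rho_cost xi eta xi' eta' :
  0 <= xi <= 1 -> 0 <= eta <= 1 -> 0 <= xi' <= 1 -> 0 <= eta' <= 1 ->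
  rho_quad xi eta xi' eta' + Rabs (rho xi' eta' - rho xi eta) <=
  2 * (Rabs (xi' - xi) + Rabs (eta' - eta) / 3).
Proof.
  intros H1 H2 H3 H4. unfold rho_quad.
  set (v1 := xi' - xi). set (v2 := eta' - eta).
  assert (T : forall a b, 0 <= a <= 1 -> 0 <= b <= 1 ->
     Rabs (v1 * b + v2 * (rho a b - a)) <= Rabs v1 + Rabs v2 / 3).
  { intros a b Ha Hb. eapply Rle_trans; [apply Rabs_triang|].
    apply Rplus_le_compat.
    - rewrite <- (Rmult_1_r (Rabs v1)). apply Rabs_prod_le. apply Rabs_le; lra.
    - apply Rabs_prod_le. unfold rho. apply Rabs_le; nra. }
  assert (Hr : Rabs (rho xi' eta' - rho xi eta) <= Rabs v1 + Rabs v2 / 3).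
  { replace (rho xi' eta' - rho xi eta) with
      (v1 * (1 - (eta + eta') / 3) + v2 * ((1 - (xi + xi')) / 3))
      by (unfold rho, v1, v2; field).
    eapply Rle_trans; [apply Rabs_triang|]. apply Rplus_le_compat.
    - rewrite <- (Rmult_1_r (Rabs v1)). apply Rabs_prod_le. apply Rabs_le; lra.
    - apply Rabs_prod_le. apply Rabs_le; lra. }
  set (r := rho xi' eta' - rho xi eta) in *.
  assert (S : forall b, 0 <= b <= 1 -> Rabs (r * b) <= Rabs r).
  { intros b Hb. rewrite <- (Rmult_1_r (Rabs r)). apply Rabs_prod_le. apply Rabs_le; lra. }
  generalize (T xi eta H1 H2) (T xi' eta' H3 H4) (S eta H2) (S eta' H4). lra.
Qed.

(** Relative to the length of the segment, area and image length are at most 1/3 and 1/3 on the two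
    side edges, equal to 2/3 and 1/3 on the edge opposite to the root edge, and equal to 0 and 1 on
    the root edge. *)
Lemma rho_cost_edge xi eta xi' eta' :
  0 <= xi <= 1 -> 0 <= eta <= 1 -> 0 <= xi' <= 1 -> 0 <= eta' <= 1 ->
  (xi = xi' /\ (xi = 0 \/ xi = 1)) \/ (eta = eta' /\ (eta = 0 \/ eta = 1)) ->
  rho_quad xi eta xi' eta' + Rabs (rho xi' eta' - rho xi eta) <=
  Rabs (xi' - xi) + Rabs (eta' - eta).
Proof.
  intros H1 H2 H3 H4 H. unfold rho_quad, rho.
  destruct H as [[E [F|F]]|[E [F|F]]]; subst.
  - replace (_ * eta + _) with ((eta' - eta) * (eta / 3)) by field.
    replace (_ * eta' + _) with ((eta' - eta) * (eta' / 3)) by field.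
    replace (_ - (0 + _)) with ((eta' - eta) / 3) by field.
    replace ((eta' - eta) / 3 * eta) with ((eta' - eta) * (eta / 3)) by field.
    replace ((eta' - eta) / 3 * eta') with ((eta' - eta) * (eta' / 3)) by field.
    unfold Rdiv. rewrite !Rabs_mult.
    rewrite (Rabs_pos_eq (/ 3)), (Rabs_pos_eq eta), (Rabs_pos_eq eta') by lra.
    generalize (Rabs_pos (eta' - eta)) (Rabs_pos (0 - 0)). nra.
  - replace (_ * eta + _) with ((eta' - eta) * - (eta / 3)) by field.
    replace (_ * eta' + _) with ((eta' - eta) * - (eta' / 3)) by field.
    replace (_ - (1 + _)) with (- ((eta' - eta) / 3)) by field.
    replace (- ((eta' - eta) / 3) * eta) with ((eta' - eta) * - (eta / 3)) by field.
    replace (- ((eta' - eta) / 3) * eta') with ((eta' - eta) * - (eta' / 3)) by field.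
    unfold Rdiv. rewrite !Rabs_mult, !Rabs_Ropp, !Rabs_mult.
    rewrite (Rabs_pos_eq (/ 3)), (Rabs_pos_eq eta), (Rabs_pos_eq eta') by lra.
    generalize (Rabs_pos (eta' - eta)) (Rabs_pos (1 - 1)). nra.
  - rewrite !Rmult_0_l. unfold Rdiv. rewrite !Rmult_0_l, !Rplus_0_r, !Rmult_0_r.
    rewrite !Rminus_diag, !Rmult_0_r, !Rplus_0_r, Rabs_R0. lra.
  - rewrite !Rminus_diag, !Rmult_0_l, !Rplus_0_r, !Rmult_1_r.
    replace (xi' + 1 * (1 - 2 * xi') / 3 - _) with ((xi' - xi) / 3) by field.
    unfold Rdiv. rewrite !Rabs_mult, (Rabs_pos_eq (/ 3)), Rabs_R0 by lra.
    generalize (Rabs_pos (xi' - xi)). lra.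
Qed.

(** * Pruning the tree of squares *)

Definition on_edge (p q : R * R) : Prop :=
  exists a : Z, (fst p = IZR a /\ fst q = IZR a) \/ (snd p = IZR a /\ snd q = IZR a).

(* Collapsing an arbitrary segment costs, together with the length of its image
   on the root edge, at most 2 sqrt(10) / 3 < 12 / 5 times its length; for a
   segment on an edge the factor is 1. *)
Definition weighted (p q : R * R) (w : R) : Prop :=
  (on_edge p q /\ vlen (vsub q p) <= w) \/ 12 / 5 * vlen (vsub q p) <= w.

Lemma vlen_ge0 v : 0 <= vlen v.
Proof. apply sqrt_pos. Qed.

Lemma vlen_axis v : fst v = 0 \/ snd v = 0 -> vlen v = Rabs (fst v) + Rabs (snd v).
Proof.
  unfold vlen. intros [E|E]; rewrite E.
  - replace (0 ^ 2 + snd v ^ 2) with (Rsqr (snd v)) by (unfold Rsqr; ring).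
    rewrite sqrt_Rsqr_abs, Rabs_R0; ring.
  - replace (fst v ^ 2 + 0 ^ 2) with (Rsqr (fst v)) by (unfold Rsqr; ring).
    rewrite sqrt_Rsqr_abs, Rabs_R0; ring.
Qed.

Lemma le_vlen a v : 0 <= a -> a ^ 2 <= fst v ^ 2 + snd v ^ 2 -> a <= vlen v.
Proof.
  intros Ha H. unfold vlen. rewrite <- (sqrt_pow2 a Ha). now apply sqrt_le_1_alt.
Qed.

Lemma pow2_Rabs x : Rabs x ^ 2 = x ^ 2.
Proof. rewrite RPow_abs. apply Rabs_pos_eq, pow2_ge_0. Qed.

(** Cauchy-Schwarz against (1, 1/3) gives the factor sqrt(10) / 3; the constant 5/6 below is
    admissible since 25/36 times 10/9 is less than 1. *)
Lemma vlen_skew v : 2 * (Rabs (fst v) + Rabs (snd v) / 3) <= 12 / 5 * vlen v /\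
                    2 * (Rabs (snd v) + Rabs (fst v) / 3) <= 12 / 5 * vlen v.
Proof.
  generalize (Rabs_pos (fst v)) (Rabs_pos (snd v)).
  generalize (pow2_Rabs (fst v)) (pow2_Rabs (snd v)). intros E1 E2 P1 P2.
  split.
  - cut (5 / 6 * (Rabs (fst v) + Rabs (snd v) / 3) <= vlen v); [lra|].
    apply le_vlen; [lra|]. rewrite <- E1, <- E2. nra.
  - cut (5 / 6 * (Rabs (snd v) + Rabs (fst v) / 3) <= vlen v); [lra|].
    apply le_vlen; [lra|]. rewrite <- E1, <- E2. nra.
Qed.

Lemma vlen_sum v : Rabs (fst v) + Rabs (snd v) <= 2 * vlen v.
Proof. destruct (vlen_skew v). generalize (vlen_ge0 v). lra. Qed.

Lemma Rabs_pm x y : x = y \/ x = - y -> Rabs x = Rabs y.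
Proof. intros [->| ->]; [reflexivity | apply Rabs_Ropp]. Qed.

(** Coordinates of the child square along its root edge and away from it. They are isometric but may
    reverse the orientation, so determinants are compared only up to sign. *)
Definition coords (d : dir) (z : Z * Z) (p : R * R) : R * R :=
  let m := IZR (fst z) in let n := IZR (snd z) in
  let x := fst p in let y := snd p in
  match d with
  | East => (y - n, x - m)
  | West => (y - n, m + 1 - x)
  | North => (x - m, y - n)
  | South => (x - m, n + 1 - y)
  end.

Lemma coords_range d z p : in_square z p ->
  0 <= fst (coords d z p) <= 1 /\ 0 <= snd (coords d z p) <= 1.
Proof. intros [H1 [H2 _]]; destruct d; unfold coords; cbn [fst snd]; lra. Qed.

Lemma coords_edge d z p q : in_square z p -> in_square z q -> on_edge p q ->
  let c := coords d z p in let c' := coords d z q in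
  (fst c = fst c' /\ (fst c = 0 \/ fst c = 1)) \/
  (snd c = snd c' /\ (snd c = 0 \/ snd c = 1)).
Proof.
  intros [H1 [H2 _]] _ [a [[E1 E2]|[E1 E2]]].
  - destruct (unit_integer (fst z) a (fst p) E1 H1); destruct d; simpl; rewrite E2, <- E1; lra.
  - destruct (unit_integer (snd z) a (snd p) E1 H2); destruct d; simpl; rewrite E2, <- E1; lra.
Qed.

Lemma quad_collapse d z p q :
  let c := coords d z p in let c' := coords d z q in
  quad p q (collapse d z p) (collapse d z q) = rho_quad (fst c) (snd c) (fst c') (snd c').
Proof.
  intros c c'. unfold quad, rho_quad. unfold Rdiv at 1 2. f_equal.
  f_equal; [f_equal; [f_equal|]|]; apply Rabs_pm; unfold c, c', coords, collapse, cross, vsub;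
    destruct d; cbn [fst snd]; (left; ring) || (right; ring).
Qed.

Lemma vlen_collapse d z p q :
  let c := coords d z p in let c' := coords d z q in
  vlen (vsub (collapse d z q) (collapse d z p)) =
  Rabs (rho (fst c') (snd c') - rho (fst c) (snd c)).
Proof.
  intros c c'. rewrite vlen_axis.
  - unfold c, c', coords, collapse, vsub; destruct d; cbn [fst snd];
      rewrite Rminus_diag, Rabs_R0, ?Rplus_0_l, ?Rplus_0_r; apply Rabs_pm; left; ring.
  - unfold collapse, vsub; destruct d; cbn [fst snd]; lra.
Qed.

Lemma vlen_coords d z p q :
  let v := vsub (coords d z q) (coords d z p) in
  let u := vsub q p in
  (Rabs (fst v) = Rabs (fst u) /\ Rabs (snd v) = Rabs (snd u)) \/
  (Rabs (fst v) = Rabs (snd u) /\ Rabs (snd v) = Rabs (fst u)).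
Proof.
  intros v u. unfold u, v, vsub, coords; destruct d; cbn [fst snd];
    ((left; split; apply Rabs_pm; (left; ring) || (right; ring)) ||
     (right; split; apply Rabs_pm; (left; ring) || (right; ring))).
Qed.

(** The potential inequality: the weight of a segment pays for the area of its collapse and still
    covers the length of the image, which is a sufficient weight for a segment on an edge. *)
Lemma collapse_cost d z p q w : in_square z p -> in_square z q -> weighted p q w ->
  quad p q (collapse d z p) (collapse d z q) +
  vlen (vsub (collapse d z q) (collapse d z p)) <= w.
Proof.
  intros Hp Hq Hw. rewrite quad_collapse, vlen_collapse.
  destruct (coords_range d z p Hp) as [C1 C2]. destruct (coords_range d z q Hq) as [C3 C4].
  generalize (vlen_coords d z p q). cbv zeta.
  unfold vsub at 1 3 5 7. cbn [fst snd]. intros HV.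
  destruct Hw as [[He Hw]|Hw].
  - eapply Rle_trans; [apply rho_cost_edge; trivial; now apply coords_edge|].
    eapply Rle_trans; [|apply Hw]. rewrite vlen_axis.
    + destruct HV as [[E1 E2]|[E1 E2]]; rewrite E1, E2; lra.
    + destruct He as [a [[E1 E2]|[E1 E2]]]; unfold vsub; simpl; lra.
  - eapply Rle_trans; [apply rho_cost; trivial|].
    eapply Rle_trans; [|apply Hw]. destruct (vlen_skew (vsub q p)).
    destruct HV as [[E1 E2]|[E1 E2]]; rewrite E1, E2; lra.
Qed.

Lemma collapse_on_edge d z p q : on_edge (collapse d z p) (collapse d z q).
Proof.
  destruct d; unfold on_edge, collapse; cbn [fst snd].
  - exists (fst z); auto.
  - exists (fst z + 1)%Z; rewrite plus_IZR; auto.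
  - exists (snd z); auto.
  - exists (snd z + 1)%Z; rewrite plus_IZR; auto.
Qed.

Definition linked (a b : list dir) : Prop :=
  a = b \/ (exists d, a = d :: b) \/ (exists d, b = d :: a).

Lemma quad_refl p q : quad p q p q = 0.
Proof.
  unfold quad, cross, vsub; cbn [fst snd].
  rewrite !Rminus_diag, !Rmult_0_r, Rminus_diag, Rabs_R0. field.
Qed.

(** Two of the four terms vanish at the apex. The others are at most |v1| + |v2| <= 2 |v| each, so
    their sum divided by 4 is at most the length. *)
Lemma quad_cone z p q c w : in_square z p -> in_square z q -> in_square z c ->
  weighted p q w -> quad p q c c <= w.
Proof.
  intros [P1 [P2 _]] [Q1 [Q2 _]] [D1 [D2 _]] Hw.
  assert (Hv : vlen (vsub q p) <= w).
  { generalize (vlen_ge0 (vsub q p)). destruct Hw as [[_ Hw]|Hw]; lra. }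
  eapply Rle_trans; [|apply Hv]. generalize (vlen_sum (vsub q p)).
  unfold quad. set (v := vsub q p).
  assert (T : forall a, -1 <= fst a <= 1 -> -1 <= snd a <= 1 ->
     Rabs (cross v a) <= Rabs (fst v) + Rabs (snd v)).
  { intros a A1 A2. unfold cross, Rminus.
    eapply Rle_trans; [apply Rabs_triang|]. rewrite Rabs_Ropp.
    apply Rplus_le_compat.
    - rewrite <- (Rmult_1_r (Rabs (fst v))). apply Rabs_prod_le, Rabs_le; lra.
    - rewrite <- (Rmult_1_r (Rabs (snd v))). apply Rabs_prod_le, Rabs_le; lra. }
  assert (Z0 : forall a, cross (vsub c c) a = 0).
  { intros a; unfold cross, vsub; cbn [fst snd]. ring. }
  rewrite !Z0, Rabs_R0.
  assert (T1 : Rabs (cross v (vsub c p)) <= Rabs (fst v) + Rabs (snd v))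
    by (apply T; unfold vsub; cbn [fst snd]; lra).
  assert (T2 : Rabs (cross v (vsub c q)) <= Rabs (fst v) + Rabs (snd v))
    by (apply T; unfold vsub; cbn [fst snd]; lra).
  lra.
Qed.

(** A label belongs to the edge from p k to p (k + 1), not to a vertex. Each vertex therefore lies
    in the squares of two consecutive, linked labels. *)
Record walk (z0 : Z * Z) (D N : nat) (p : Z -> R * R) (l : Z -> list dir) (w : Z -> R) : Prop := {
  walk_perp : periodic_seq N p;
  walk_perl : periodic_seq N l;
  walk_left : forall k, in_square (cell z0 (l k)) (p k);
  walk_right : forall k, in_square (cell z0 (l k)) (p (k + 1)%Z);
  walk_linked : forall k, linked (l k) (l (k + 1)%Z);
  walk_depth : forall k, (length (l k) <= D)%nat;
  walk_weight : forall k, weighted (p k) (p (k + 1)%Z) (w k) }.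

Section Prune.
Variables (z0 : Z * Z) (D : nat).

Definition prune_point (l : list dir) (p : R * R) : R * R :=
  match l with
  | nil => p
  | d :: _ => if Nat.eq_dec (length l) (S D) then collapse d (cell z0 l) p else p
  end.

Definition prune (l : list dir) : list dir :=
  if Nat.eq_dec (length l) (S D) then tl l else l.

Definition prune_weight (l : list dir) (p q : R * R) (w : R) : R :=
  if Nat.eq_dec (length l) (S D)
  then vlen (vsub (prune_point l q) (prune_point l p)) else w.

Lemma prune_point_in l p : in_square (cell z0 l) p ->
  in_square (cell z0 (prune l)) (prune_point l p).
Proof.
  intros H. unfold prune, prune_point. destruct l as [|d l].
  - simpl; now destruct (Nat.eq_dec 0 (S D)).
  - destruct (Nat.eq_dec _ _); trivial. now apply collapse_parent.
Qed.

(** The root edge belongs to the child as well as to the parent. Each collapse can therefore be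
    performed linearly inside the child square. *)
Lemma prune_point_same_square l p : in_square (cell z0 l) p ->
  in_square (cell z0 l) (prune_point l p).
Proof.
  intros H. unfold prune_point. destruct l as [|d l]; trivial.
  destruct (Nat.eq_dec _ _); trivial.
  destruct H as [H1 [H2 H3]].
  assert (Hl : ~ lattice (collapse d (cell z0 (d :: l)) p)).
  { now apply (collapse_parent d (cell z0 l) p). }
  revert H1 H2 Hl. generalize (cell z0 (d :: l)) as z. intros z H1 H2 Hl.
  assert (R1 := fun a b => rho_range a b).
  destruct d; unfold in_square, collapse in *; cbn [fst snd] in *.
  - generalize (R1 (snd p - IZR (snd z)) (fst p - IZR (fst z))). intuition lra.
  - generalize (R1 (snd p - IZR (snd z)) (IZR (fst z) + 1 - fst p)). intuition lra.
  - generalize (R1 (fst p - IZR (fst z)) (snd p - IZR (snd z))). intuition lra.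
  - generalize (R1 (fst p - IZR (fst z)) (IZR (snd z) + 1 - snd p)). intuition lra.
Qed.

Lemma prune_child d l p : (length (d :: l) <= S D)%nat ->
  in_square (cell z0 (d :: l)) p -> in_square (cell z0 l) p ->
  prune_point (d :: l) p = p /\ prune_point l p = p.
Proof.
  intros Hl H1 H2. split.
  - unfold prune_point. destruct (Nat.eq_dec _ _); trivial. now apply collapse_fix.
  - unfold prune_point. destruct l as [|e l]; trivial.
    destruct (Nat.eq_dec _ _); trivial. simpl in *; lia.
Qed.

(** A point in the squares of a child and its parent lies on their common edge, which the collapse
    fixes; the parent itself is too short a word to be collapsed in the same round. So the image of
    a vertex does not depend on which of its two edges provides the label. *)
Lemma prune_point_compat a b p : linked a b ->
  (length a <= S D)%nat -> (length b <= S D)%nat ->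
  in_square (cell z0 a) p -> in_square (cell z0 b) p -> prune_point a p = prune_point b p.
Proof.
  intros [->|[[d ->]|[d ->]]] Ha Hb H1 H2; trivial.
  - destruct (prune_child d b p) as [-> ->]; trivial.
  - destruct (prune_child d a p) as [-> ->]; trivial.
Qed.

Lemma prune_linked a b : linked a b ->
  (length a <= S D)%nat -> (length b <= S D)%nat -> linked (prune a) (prune b).
Proof.
  assert (C : forall d l, (length (d :: l) <= S D)%nat ->
    prune l = l /\ (prune (d :: l) = l \/ prune (d :: l) = d :: l)).
  { intros d l Hl. unfold prune. split.
    - destruct (Nat.eq_dec (length l) (S D)); [simpl in Hl; lia | trivial].
    - destruct (Nat.eq_dec _ (S D)); [now left | now right]. }
  intros [->|[[d ->]|[d ->]]] Ha Hb.
  - now left.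
  - destruct (C d b Ha) as [-> [-> | ->]]; [now left | right; left; now exists d].
  - destruct (C d a Hb) as [-> [-> | ->]]; [now left | right; right; now exists d].
Qed.

Lemma prune_length l : (length l <= S D)%nat -> (length (prune l) <= D)%nat.
Proof.
  unfold prune. destruct (Nat.eq_dec (length l) (S D)); [|lia].
  destruct l; simpl in *; lia.
Qed.

Lemma prune_weighted l p q w : weighted p q w ->
  weighted (prune_point l p) (prune_point l q) (prune_weight l p q w).
Proof.
  intros Hw. unfold prune_weight. destruct (Nat.eq_dec (length l) (S D)) as [E|E].
  - left; split; [|lra]. destruct l as [|d l]; [discriminate|].
    unfold prune_point. destruct (Nat.eq_dec _ _); [apply collapse_on_edge | contradiction].
  - destruct l as [|d l]; trivial. unfold prune_point.
    destruct (Nat.eq_dec _ _); [contradiction | trivial].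
Qed.

Lemma prune_cost l p q w :
  in_square (cell z0 l) p -> in_square (cell z0 l) q -> weighted p q w ->
  quad p q (prune_point l p) (prune_point l q) + prune_weight l p q w <= w.
Proof.
  intros Hp Hq Hw. unfold prune_weight, prune_point. destruct l as [|d l].
  - rewrite quad_refl. simpl. lra.
  - destruct (Nat.eq_dec _ _).
    + now apply collapse_cost.
    + rewrite quad_refl. lra.
Qed.

Lemma walk_prune N p l w : walk z0 (S D) N p l w ->
  walk z0 D N (fun k => prune_point (l k) (p k)) (fun k => prune (l k))
    (fun k => prune_weight (l k) (p k) (p (k + 1)%Z) (w k)) /\
  forall k, prune_point (l (k + 1)%Z) (p (k + 1)%Z) = prune_point (l k) (p (k + 1)%Z).
Proof.
  intros [Hp Hl H1 H2 H3 H4 H5].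
  assert (E : forall k, prune_point (l (k + 1)%Z) (p (k + 1)%Z) =
                        prune_point (l k) (p (k + 1)%Z)).
  { intros k. symmetry. apply prune_point_compat; auto. }
  split; trivial. split.
  - intros k. now rewrite Hp, Hl.
  - intros k. now rewrite Hl.
  - intros k. now apply prune_point_in.
  - intros k. rewrite E. now apply prune_point_in.
  - intros k. now apply prune_linked.
  - intros k. now apply prune_length.
  - intros k. rewrite E. now apply prune_weighted.
Qed.
End Prune.

Lemma walk_Chain z0 D N p l w : (0 < N)%nat -> walk z0 D N p l w ->
  Chain (polygon N p) (psum (fun i => w (Z.of_nat i)) N).
Proof.
  intros HN. revert p l w. induction D as [|D IH]; intros p l w W.
  - assert (L : forall k, l k = nil).
    { intros k. generalize (walk_depth _ _ _ _ _ _ W k). destruct (l k); simpl; trivial; lia. }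
    assert (S0 : forall k, in_square z0 (p k)).
    { intros k. generalize (walk_left _ _ _ _ _ _ W k). now rewrite L. }
    (* Any apex in the root square would serve; a vertex is known to avoid the corners. *)
    set (c := p 0%Z).
    apply Chain_le with (psum (fun i => let k := Z.of_nat i in
      quad (p k) (p (k + 1)%Z) c c) N + 0).
    + apply (Chain_polygon_step N p (fun _ => c)); trivial.
      * apply (walk_perp _ _ _ _ _ _ W).
      * intros k; reflexivity.
      * intros k s tau Hs Ht.
        apply (in_square_lerp z0); trivial; apply in_square_lerp; trivial; apply S0.
      * rewrite polygon_const. apply Chain_const; [apply (S0 0%Z) | lra].
    + rewrite Rplus_0_r. apply psum_le. intros i _. cbv zeta.
      apply (quad_cone z0); try apply S0. apply (walk_weight _ _ _ _ _ _ W).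
  - destruct (walk_prune z0 D N p l w W) as [W' E].
    set (q := fun k => prune_point z0 D (l k) (p k)) in *.
    apply IH in W'. destruct W as [Hp Hl H1 H2 H3 H4 H5].
    eapply Chain_le.
    + apply (Chain_polygon_step N p q); trivial.
      * intros k. unfold q. now rewrite Hp, Hl.
      * intros k s tau Hs Ht. apply (in_square_lerp (cell z0 (l k))); trivial;
          apply in_square_lerp; trivial.
        -- now apply prune_point_same_square.
        -- unfold q. rewrite E. now apply prune_point_same_square.
      * exact W'.
    + rewrite <- psum_plus. apply psum_le. intros i _. cbv zeta. unfold q.
      rewrite E. now apply prune_cost.
Qed.

(** * Lifting to the tree of squares *)

Definition opposite (d : dir) : dir :=
  match d with East => West | West => East | North => South | South => North end.

Lemma move_inj d e z : move d z = move e z -> d = e.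
Proof.
  intros H. assert (A := f_equal fst H). assert (B := f_equal snd H).
  destruct d, e; simpl in A, B; trivial; lia.
Qed.

Lemma move_move d e z : move d (move e z) = z -> d = opposite e.
Proof.
  intros H. assert (A := f_equal fst H). assert (B := f_equal snd H).
  destruct d, e; simpl in A, B; trivial; lia.
Qed.

Lemma move_opposite e z : move (opposite e) (move e z) = z.
Proof. destruct z, e; simpl; f_equal; lia. Qed.

Lemma move_neq d z : move d z <> z.
Proof.
  intros H. assert (A := f_equal fst H). assert (B := f_equal snd H).
  destruct d; simpl in A, B; lia.
Qed.

Definition adjacent (z z' : Z * Z) : Prop := z = z' \/ exists d, z' = move d z.

Definition eq_cell (z z' : Z * Z) : {z = z'} + {z <> z'}.
Proof. decide equality; apply Z.eq_dec. Defined.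

(** [South] doubles as the default value; the direction is meaningful only for adjacent distinct
    squares. *)
Definition dir_to (z z' : Z * Z) : dir :=
  if eq_cell (move East z) z' then East else
  if eq_cell (move West z) z' then West else
  if eq_cell (move North z) z' then North else South.

Lemma dir_to_move d z : dir_to z (move d z) = d.
Proof.
  unfold dir_to. destruct (eq_cell (move East z) (move d z)) as [E|E];
    [now apply move_inj in E|].
  destruct (eq_cell (move West z) (move d z)) as [E'|E']; [now apply move_inj in E'|].
  destruct (eq_cell (move North z) (move d z)) as [E2|E2]; [now apply move_inj in E2|].
  destruct d; trivial; contradiction.
Qed.

Section Lift.
Variable z0 : Z * Z.

(** One move of the lifted path. A move back to the parent square cancels the head letter, as in a
    free reduction, which keeps the words reduced. *)
Definition step (l : list dir) (z : Z * Z) : list dir :=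
  if eq_cell (cell z0 l) z then l else
  match l with
  | nil => dir_to (cell z0 l) z :: l
  | d :: l' => if eq_cell (cell z0 l') z then l' else dir_to (cell z0 l) z :: l
  end.

Fixpoint reduced (l : list dir) : Prop :=
  match l with
  | nil => True
  | d :: l' => match l' with nil => True | e :: _ => d <> opposite e end /\ reduced l'
  end.

Lemma step_self l : step l (cell z0 l) = l.
Proof. unfold step. destruct (eq_cell (cell z0 l) (cell z0 l)); trivial; contradiction. Qed.

(** The last clause, that a move and its reverse cancel, rests on reducedness: after the head letter
    e is dropped, the way back must push e again, and it could cancel a further letter only if that
    letter were opposite to e. *)
Lemma step_spec l z : reduced l -> adjacent (cell z0 l) z ->
  cell z0 (step l z) = z /\ linked l (step l z) /\ reduced (step l z) /\
  step (step l z) (cell z0 l) = l.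
Proof.
  intros Hr Ha. unfold step at 1 2 3 5.
  destruct (eq_cell (cell z0 l) z) as [E|E].
  { repeat split; trivial. now left. now rewrite step_self. }
  destruct Ha as [Ha|[d Ha]]; [contradiction|].
  assert (C : (match l with nil => True | e :: _ => d <> opposite e end) ->
    cell z0 (dir_to (cell z0 l) z :: l) = z /\ linked l (dir_to (cell z0 l) z :: l) /\
    reduced (dir_to (cell z0 l) z :: l) /\ step (dir_to (cell z0 l) z :: l) (cell z0 l) = l).
  { intros Hd. rewrite Ha, dir_to_move. repeat split; trivial.
    - right; right; now exists d.
    - unfold step. destruct (eq_cell (cell z0 (d :: l)) (cell z0 l)) as [F|F].
      + simpl in F. now apply move_neq in F.
      + destruct (eq_cell (cell z0 l) (cell z0 l)); trivial; contradiction. }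
  destruct l as [|e l']; [now apply C|].
  destruct (eq_cell (cell z0 l') z) as [F|F].
  - split; [exact F|]. split; [right; left; now exists e|]. split; [apply Hr|].
    destruct Hr as [Hr1 Hr2].
    assert (G : cell z0 (e :: l') = move e (cell z0 l')) by reflexivity.
    rewrite G. unfold step.
    destruct (eq_cell (cell z0 l') (move e (cell z0 l'))) as [I|I].
    { symmetry in I. now apply move_neq in I. }
    destruct l' as [|g l'']; [now rewrite dir_to_move|].
    destruct (eq_cell (cell z0 l'') (move e (cell z0 (g :: l'')))) as [J|J].
    + simpl in J. symmetry in J. apply move_move in J. contradiction.
    + now rewrite dir_to_move.
  - apply C. intros ->. apply F. rewrite Ha. simpl. now rewrite move_opposite.
Qed.

Definition clustered (x y z : Z * Z) : Prop :=
  adjacent x y /\ adjacent x z /\ adjacent y z /\ (x = y \/ y = z \/ x = z).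

(** Two of the three squares coincide, so the detour contains a stationary move or is a move
    followed by its reverse. *)
Lemma step_step l z1 z2 : reduced l -> clustered (cell z0 l) z1 z2 ->
  step (step l z1) z2 = step l z2.
Proof.
  intros Hr [H1 [H2 [H3 [E|[E|E]]]]].
  - subst z1. now rewrite step_self.
  - subst z2. destruct (step_spec l z1 Hr H1) as [E _].
    rewrite <- E at 2. apply step_self.
  - subst z2. rewrite step_self. now apply step_spec.
Qed.

(** The grid is lifted along its left side and then along each row. That vertical moves elsewhere
    give the same nodes is the content of [lift_vertical]. *)
Fixpoint lift_col (F : nat -> nat -> Z * Z) (j : nat) : list dir :=
  match j with O => nil | S j => step (lift_col F j) (F (S j) O) end.

Fixpoint lift (F : nat -> nat -> Z * Z) (j i : nat) : list dir :=
  match i with O => lift_col F j | S i => step (lift F j i) (F j (S i)) end.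

Variables (F : nat -> nat -> Z * Z) (n : nat).
Hypothesis F_row0 : forall i, F 0%nat i = z0.
Hypothesis F_per : forall j, (j <= n)%nat -> F j n = F j 0%nat.
Hypothesis F_cell : forall j i, (j < n)%nat ->
  clustered (F j i) (F j (S i)) (F (S j) (S i)) /\
  clustered (F j i) (F (S j) i) (F (S j) (S i)).

Lemma lift_col_spec j : (j <= n)%nat ->
  cell z0 (lift_col F j) = F j 0%nat /\ reduced (lift_col F j).
Proof.
  induction j as [|j IH]; intros Hj.
  - simpl; split; trivial. now rewrite F_row0.
  - destruct IH as [E R0]; [lia|]. simpl.
    destruct (F_cell j 0) as [_ [H _]]; [lia|]. rewrite <- E in H.
    destruct (step_spec _ _ R0 H) as [? [? [? _]]]; auto.
Qed.

Lemma F_right j i : (0 < n)%nat -> (j <= n)%nat -> adjacent (F j i) (F j (S i)).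
Proof.
  intros Hn Hj. destruct (Nat.eq_dec j n) as [->|Hjn].
  (* The last row is the far side of the triangles based on the row before it. *)
  - destruct n as [|m]; [lia|]. destruct (F_cell m i) as [_ [_ [_ [H _]]]]; [lia | exact H].
  - destruct (F_cell j i) as [[H _] _]; [lia | exact H].
Qed.

Lemma lift_spec j i : (0 < n)%nat -> (j <= n)%nat ->
  cell z0 (lift F j i) = F j i /\ reduced (lift F j i) /\
  linked (lift F j i) (lift F j (S i)).
Proof.
  intros Hn Hj.
  assert (C : cell z0 (lift F j i) = F j i /\ reduced (lift F j i)).
  { induction i as [|i [E R0]]; [now apply lift_col_spec|].
    simpl. assert (H := F_right j i Hn Hj). rewrite <- E in H.
    destruct (step_spec _ _ R0 H) as [? [? [? _]]]; auto. }
  destruct C as [E R0]. repeat split; trivial.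
  assert (H := F_right j i Hn Hj). rewrite <- E in H. simpl. now apply step_spec.
Qed.

Lemma lift_vertical j i : (j < n)%nat -> lift F (S j) i = step (lift F j i) (F (S j) i).
Proof.
  intros Hj. induction i as [|i IH]; trivial.
  destruct (lift_spec j i) as [E [R0 _]]; [lia | lia |].
  destruct (F_cell j i Hj) as [H1 H2]. rewrite <- E in H1, H2.
  change (lift F (S j) (S i)) with (step (lift F (S j) i) (F (S j) (S i))).
  change (lift F j (S i)) with (step (lift F j i) (F j (S i))).
  rewrite IH, !step_step; trivial.
Qed.

(** Over the constant row the lift never moves. The vertical moves at i = 0 and at i = n go to the
    same squares, so closedness passes from row to row. *)
Lemma lift_closed j : (j <= n)%nat -> lift F j n = lift F j 0.
Proof.
  induction j as [|j IH]; intros Hj.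
  - assert (E : forall i, lift F 0 i = nil).
    { induction i as [|i IHi]; trivial.
      change (lift F 0 (S i)) with (step (lift F 0 i) (F 0%nat (S i))).
      rewrite IHi, F_row0. apply (step_self nil). }
    now rewrite !E.
  - rewrite !lift_vertical, IH, F_per by lia. reflexivity.
Qed.
End Lift.

(** * Small scale *)

Definition near (e : R) (p q : R * R) : Prop :=
  Rabs (fst p - fst q) < e /\ Rabs (snd p - snd q) < e.

Definition far (e : R) (p : R * R) : Prop :=
  forall a b : Z, ~ near e p (IZR a, IZR b).

Lemma far_mono e e' p : e' <= e -> far e p -> far e' p.
Proof. intros He H a b [H1 H2]. apply (H a b). split; lra. Qed.

Lemma near_far e p q : far (e + e) p -> near e p q -> far e q.
Proof.
  intros Hp [H1 H2] a b [H3 H4]. apply (Hp a b). cbn [fst snd] in *.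
  apply Rabs_def2 in H1, H2, H3, H4. split; apply Rabs_def1; cbn [fst snd]; lra.
Qed.

Lemma far_not_lattice e p : 0 < e -> far e p -> ~ lattice p.
Proof.
  intros He H [a [b E]]. apply (H a b). rewrite E.
  split; cbn [fst snd]; rewrite Rminus_diag, Rabs_R0; lra.
Qed.

Lemma noninteger_far x : (forall a : Z, x <> IZR a) ->
  exists r, 0 < r /\ forall a : Z, r <= Rabs (x - IZR a).
Proof.
  intros H. destruct (base_Int_part x) as [B1 B2]. set (m := Int_part x) in *.
  assert (x <> IZR m) by apply H.
  exists (Rmin (x - IZR m) (IZR m + 1 - x)). split.
  - apply Rmin_glb_lt; lra.
  - intros a. destruct (Z_le_dec a m) as [L|L].
    + apply IZR_le in L. rewrite Rabs_pos_eq by lra.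
      eapply Rle_trans; [apply Rmin_l|]. lra.
    + assert (L' : (m + 1 <= a)%Z) by lia. apply IZR_le in L'. rewrite plus_IZR in L'.
      rewrite Rabs_left1 by lra. eapply Rle_trans; [apply Rmin_r|]. lra.
Qed.

Lemma not_lattice_far p : ~ lattice p -> exists r, 0 < r /\ far r p.
Proof.
  intros H. destruct (classic (exists a : Z, fst p = IZR a)) as [[a Ha]|Hx].
  - destruct (noninteger_far (snd p)) as [r [Hr R0]].
    { intros b Hb. apply H. exists a, b. rewrite (surjective_pairing p). congruence. }
    exists r; split; trivial. intros a' b' [_ H2]. cbn [snd] in H2.
    specialize (R0 b'). lra.
  - destruct (noninteger_far (fst p)) as [r [Hr R0]].
    { intros b Hb. apply Hx. now exists b. }
    exists r; split; trivial. intros a' b' [H1 _]. cbn [fst] in H1.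
    specialize (R0 a'). lra.
Qed.

(** One local radius serves both as the size of a neighbourhood and as the distance from the lattice
    kept there. A positive lower bound for the radii, provided by compactness, is then the required
    distance. *)
Lemma compact_far (g : R -> R -> R * R) a b c d :
  (forall x y, a <= x <= b -> c <= y <= d ->
     continuity_2d_pt (fun u v => fst (g u v)) x y /\
     continuity_2d_pt (fun u v => snd (g u v)) x y /\ ~ lattice (g x y)) ->
  exists r, 0 < r /\ forall x y, a <= x <= b -> c <= y <= d -> far r (g x y).
Proof.
  intros Hg.
  assert (L : forall x y, exists r : posreal, a <= x <= b -> c <= y <= d ->
     forall u v, Rabs (u - x) < r -> Rabs (v - y) < r -> far r (g u v)).
  { intros x y. destruct (classic (a <= x <= b /\ c <= y <= d)) as [[Hx Hy]|Hn].
    - destruct (Hg x y Hx Hy) as [H1 [H2 H3]].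
      destruct (not_lattice_far _ H3) as [r [Hr R0]].
      assert (Hr2 : 0 < r / 2) by lra.
      destruct (H1 (mkposreal _ Hr2)) as [d1 D1]. destruct (H2 (mkposreal _ Hr2)) as [d2 D2].
      assert (Hm : 0 < Rmin (r / 2) (Rmin d1 d2)).
      { apply Rmin_glb_lt; trivial. apply Rmin_glb_lt; apply cond_pos. }
      exists (mkposreal _ Hm). cbn [Defs.lattice pos]. intros _ _ u v Hu Hv.
      assert (M1 := Rmin_l (r / 2) (Rmin d1 d2)). assert (M2 := Rmin_r (r / 2) (Rmin d1 d2)).
      assert (M3 := Rmin_l d1 d2). assert (M4 := Rmin_r d1 d2).
      simpl in Hu, Hv |- *.
      apply far_mono with (1 := M1). apply (near_far (r / 2) (g x y)).
      + now replace (r / 2 + r / 2) with r by field.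
      + split; rewrite Rabs_minus_sym; [apply D1 | apply D2]; lra.
    - exists (mkposreal 1 Rlt_0_1). tauto. }
  set (delta := fun x y => proj1_sig (constructive_indefinite_description _ (L x y))).
  destruct (compactness_value_2d a b c d delta) as [r Hr].
  exists r; split; [apply cond_pos|]. intros x y Hx Hy.
  apply NNPP; intros Hn. apply (Hr x y Hx Hy). intros [u [v [Hu [Hv [H1 [H2 H3]]]]]].
  apply Hn. apply far_mono with (1 := H3).
  unfold delta in *. destruct (constructive_indefinite_description _ (L u v)) as [e He].
  simpl in *. now apply He.
Qed.

Lemma continuous_components (H : R * R -> R * R) s t : continuous H (s, t) ->
  continuity_2d_pt (fun u v => fst (H (u, v))) s t /\
  continuity_2d_pt (fun u v => snd (H (u, v))) s t.
Proof.
  intros C.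
  assert (Ffst : forall p : R * R, filterlim fst (locally p) (locally (fst p))).
  { intros [x y]. apply continuous_fst. }
  assert (Fsnd : forall p : R * R, filterlim snd (locally p) (locally (snd p))).
  { intros [x y]. apply continuous_snd. }
  split; apply continuity_2d_pt_filterlim.
  - apply (filterlim_ext (fun z => fst (H z))); [now intros [u v]|].
    apply (filterlim_comp _ _ _ H fst _ (locally (H (s, t)))); [exact C|].
    apply Ffst.
  - apply (filterlim_ext (fun z => snd (H z))); [now intros [u v]|].
    apply (filterlim_comp _ _ _ H snd _ (locally (H (s, t)))); [exact C|].
    apply Fsnd.
Qed.

Lemma homotopy_scale (H : R * R -> R * R) e0 :
  0 < e0 ->
  (forall p, continuous H p) ->
  (forall s t, 0 <= s <= 1 -> H (s, t + 1) = H (s, t)) ->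
  (forall s t, 0 <= s <= 1 -> ~ lattice (H (s, t))) ->
  exists e n, 0 < e <= e0 /\ (0 < n)%nat /\
    (forall s t, 0 <= s <= 1 -> far (e + e) (H (s, t))) /\
    (forall s s' t t', 0 <= s <= 1 -> 0 <= s' <= 1 ->
       Rabs (s - s') <= / INR n -> Rabs (t - t') <= / INR n ->
       near e (H (s, t)) (H (s', t'))).
Proof.
  intros He0 HC Hper Hav.
  assert (HC1 := fun s t => proj1 (continuous_components H s t (HC (s, t)))).
  assert (HC2 := fun s t => proj2 (continuous_components H s t (HC (s, t)))).
  assert (Hshift : forall t, exists k : Z, 0 <= t + IZR k <= 1 /\
    forall s v, 0 <= s <= 1 -> H (s, v + IZR k) = H (s, v)).
  { intros t. exists (- Int_part t)%Z. destruct (base_Int_part t) as [B1 B2]. split.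
    - rewrite opp_IZR; lra.
    - intros s v Hs. apply (per_Z (fun v => H (s, v))). intros; now apply Hper. }
  destruct (compact_far (fun s t => H (s, t)) 0 1 0 1) as [r [Hr R0]].
  { intros; repeat split; auto. }
  set (e := Rmin e0 (r / 2)).
  assert (He : 0 < e) by (apply Rmin_glb_lt; lra).
  assert (E1 : e <= e0) by apply Rmin_l. assert (E2 : e <= r / 2) by apply Rmin_r.
  (* The window exceeds a period by one unit on either side: t can be shifted into [0, 1], but t' is
     only known to be within 1 / n <= 1 of it. *)
  destruct (uniform_continuity_2d (fun u v => fst (H (u, v))) 0 1 (-1) 2
    (fun x y _ _ => HC1 x y) (mkposreal _ He)) as [d1 D1].
  destruct (uniform_continuity_2d (fun u v => snd (H (u, v))) 0 1 (-1) 2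
    (fun x y _ _ => HC2 x y) (mkposreal _ He)) as [d2 D2].
  assert (Hd : 0 < Rmin d1 d2) by (apply Rmin_glb_lt; apply cond_pos).
  destruct (archimed_cor1 _ Hd) as [n [N1 N2]].
  assert (M1 := Rmin_l d1 d2). assert (M2 := Rmin_r d1 d2).
  exists e, n. split; [lra|]. split; [exact N2|]. split.
  - intros s t Hs. destruct (Hshift t) as [k [K1 K2]]. rewrite <- K2 by trivial.
    apply (far_mono r); [lra|]. now apply R0.
  - intros s s' t t' Hs Hs' Ds Dt. destruct (Hshift t) as [k [K1 K2]].
    rewrite <- (K2 s t), <- (K2 s' t') by trivial.
    assert (Hn : / INR n <= 1).
    { rewrite <- Rinv_1. apply Rinv_le_contravar; [lra|]. apply (le_INR 1). lia. }
    assert (T : -1 <= t' + IZR k <= 2).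
    { assert (T := Rabs_le_between' t t' (/ INR n)). apply T in Dt. lra. }
    assert (Dt' : Rabs ((t + IZR k) - (t' + IZR k)) <= / INR n).
    { now replace ((t + IZR k) - (t' + IZR k)) with (t - t') by ring. }
    split; [apply D1 | apply D2]; lra.
Qed.

Definition fl (p : R * R) : Z * Z := (Int_part (fst p), Int_part (snd p)).

Lemma Int_part_close x y : Rabs (x - y) < 1 ->
  (Int_part x = Int_part y \/ Int_part x = Int_part y + 1 \/ Int_part x = Int_part y - 1)%Z.
Proof.
  intros H. apply Rabs_def2 in H.
  destruct (base_Int_part x), (base_Int_part y).
  assert (A : (Int_part x < Int_part y + 2)%Z).
  { apply lt_IZR. rewrite plus_IZR. lra. }
  assert (B : (Int_part y < Int_part x + 2)%Z).
  { apply lt_IZR. rewrite plus_IZR. lra. }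
  lia.
Qed.

Lemma integer_between x y z e : Int_part x <> Int_part y ->
  Rabs (z - x) < e -> Rabs (z - y) < e -> exists a : Z, Rabs (z - IZR a) < e.
Proof.
  assert (W : forall x y, (Int_part x < Int_part y)%Z ->
    Rabs (z - x) < e -> Rabs (z - y) < e -> exists a : Z, Rabs (z - IZR a) < e).
  { clear. intros x y H Hx Hy. exists (Int_part y).
    assert (L : (Int_part x + 1 <= Int_part y)%Z) by lia.
    apply IZR_le in L. rewrite plus_IZR in L.
    destruct (base_Int_part x), (base_Int_part y).
    apply Rabs_def2 in Hx, Hy. apply Rabs_def1; lra. }
  intros H Hx Hy. destruct (Z_lt_le_dec (Int_part x) (Int_part y)).
  - now apply (W x y).
  - apply (W y x); trivial; lia.
Qed.

(* Near a point that is far from the lattice, at most one of the two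
   coordinates can cross an integer. *)
Lemma near_clustered e p q r : e <= 1 -> far e p -> 
  near e p p -> near e p q -> near e p r -> near e q r ->
  clustered (fl p) (fl q) (fl r).
Proof.
  intros He Hf [Pp1 Pp2] [Pq1 Pq2] [Pr1 Pr2] [Qr1 Qr2].
  assert (Hone : (Int_part (fst p) = Int_part (fst q) /\ Int_part (fst p) = Int_part (fst r)) \/
                 (Int_part (snd p) = Int_part (snd q) /\ Int_part (snd p) = Int_part (snd r))).
  { apply NNPP; intros Hn.
    assert (X : exists a : Z, Rabs (fst p - IZR a) < e).
    { destruct (Z.eq_dec (Int_part (fst p)) (Int_part (fst q))) as [E|E].
      - destruct (Z.eq_dec (Int_part (fst p)) (Int_part (fst r))) as [E'|E']; [tauto|].
        now apply (integer_between (fst p) (fst r)).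
      - now apply (integer_between (fst p) (fst q)). }
    assert (Y : exists a : Z, Rabs (snd p - IZR a) < e).
    { destruct (Z.eq_dec (Int_part (snd p)) (Int_part (snd q))) as [E|E].
      - destruct (Z.eq_dec (Int_part (snd p)) (Int_part (snd r))) as [E'|E']; [tauto|].
        now apply (integer_between (snd p) (snd r)).
      - now apply (integer_between (snd p) (snd q)). }
    destruct X as [a X], Y as [b Y]. apply (Hf a b). now split. }
  assert (A : (forall a b c d : Z, (a = c /\ (b = d \/ b = d + 1 \/ b = d - 1)) \/
     (b = d /\ (a = c \/ a = c + 1 \/ a = c - 1)) -> adjacent (a, b) (c, d))%Z).
  { intros a b c d H. unfold adjacent.
    destruct H as [[-> [-> |[-> | ->]]]|[-> [-> |[-> | ->]]]].
    - now left.
    - right; exists South; simpl; f_equal; ring.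
    - right; exists North; simpl; f_equal; ring.
    - now left.
    - right; exists West; simpl; f_equal; ring.
    - right; exists East; simpl; f_equal; ring. }
  assert (X1 := Int_part_close (fst p) (fst q)). assert (X2 := Int_part_close (fst p) (fst r)).
  assert (X3 := Int_part_close (fst q) (fst r)).
  assert (Y1 := Int_part_close (snd p) (snd q)). assert (Y2 := Int_part_close (snd p) (snd r)).
  assert (Y3 := Int_part_close (snd q) (snd r)).
  specialize (X1 ltac:(lra)); specialize (X2 ltac:(lra)); specialize (X3 ltac:(lra)).
  specialize (Y1 ltac:(lra)); specialize (Y2 ltac:(lra)); specialize (Y3 ltac:(lra)).
  unfold clustered, fl.
  split; [apply A; lia|]. split; [apply A; lia|]. split; [apply A; lia|].
  destruct Hone as [[E1 E2]|[E1 E2]].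
  - assert (Int_part (snd p) = Int_part (snd q) \/ Int_part (snd q) = Int_part (snd r)
      \/ Int_part (snd p) = Int_part (snd r)) as [E|[E|E]] by lia.
    + left; congruence.
    + right; left; congruence.
    + right; right; congruence.
  - assert (Int_part (fst p) = Int_part (fst q) \/ Int_part (fst q) = Int_part (fst r)
      \/ Int_part (fst p) = Int_part (fst r)) as [E|[E|E]] by lia.
    + left; congruence.
    + right; left; congruence.
    + right; right; congruence.
Qed.

Lemma near_refl e p : 0 < e -> near e p p.
Proof. intros He; split; rewrite Rminus_diag, Rabs_R0; lra. Qed.

Lemma convex_lt a b e s : a < e -> b < e -> 0 <= s <= 1 -> (1 - s) * a + s * b < e.
Proof.
  intros Ha Hb Hs. apply Rle_lt_trans with (Rmax a b).
  - assert (M1 := Rmax_l a b). assert (M2 := Rmax_r a b). nra.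
  - now apply Rmax_lub_lt.
Qed.

Lemma near_lerp e c p q s : near e c p -> near e c q -> 0 <= s <= 1 ->
  near e c (lerp s p q).
Proof.
  intros [H1 H2] [H3 H4] Hs. unfold lerp; split; cbn [fst snd].
  - replace (fst c - _) with ((1 - s) * (fst c - fst p) + s * (fst c - fst q)) by ring.
    eapply Rle_lt_trans; [apply Rabs_triang|]. rewrite !Rabs_mult.
    rewrite (Rabs_pos_eq s), (Rabs_pos_eq (1 - s)) by lra. now apply convex_lt.
  - replace (snd c - _) with ((1 - s) * (snd c - snd p) + s * (snd c - snd q)) by ring.
    eapply Rle_lt_trans; [apply Rabs_triang|]. rewrite !Rabs_mult.
    rewrite (Rabs_pos_eq s), (Rabs_pos_eq (1 - s)) by lra. now apply convex_lt.
Qed.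

Lemma in_square_fl p : ~ lattice p -> in_square (fl p) p.
Proof.
  intros H. unfold in_square, fl; cbn [fst snd].
  destruct (base_Int_part (fst p)), (base_Int_part (snd p)). repeat split; lra || trivial.
Qed.

(** * Inscribed polygons *)

Lemma hit_between x y m : (x <= m <= y \/ y <= m <= x) -> x <> y ->
  exists s, 0 <= s <= 1 /\ (1 - s) * x + s * y = m.
Proof.
  intros H Hn. exists ((m - x) / (y - x)). split; [|field; lra].
  destruct H as [H|H].
  - split; [apply Rle_div_r; lra | apply Rle_div_l; lra].
  - replace ((m - x) / (y - x)) with ((x - m) / (x - y)) by (field; lra).
    split; [apply Rle_div_r; lra | apply Rle_div_l; lra].
Qed.

Definition crossing_of (p q m : R * R) : Prop :=
  exists s, 0 <= s <= 1 /\ m = lerp s p q /\ in_square (fl p) m /\ in_square (fl q) m.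

(** If both points have the same square, p itself serves. Otherwise the squares share an edge: the
    chord meets the line of that edge by linear interpolation, and its other coordinate stays in the
    common range by convexity. The chord avoids the lattice because it remains within e of p. *)
Lemma crossing_exists e p q : 0 < e <= 1 -> far (e + e) p -> near e p q ->
  exists m, crossing_of p q m.
Proof.
  intros He Hf Hn.
  assert (Hfe : far e p) by (apply (far_mono (e + e)); trivial; lra).
  assert (Hq : far e q) by now apply (near_far e p).
  assert (Hp := near_refl e p (proj1 He)).
  assert (Hp' := near_refl e q (proj1 He)).
  assert (NL : forall s, 0 <= s <= 1 -> ~ lattice (lerp s p q)).
  { intros s Hs [a [b E]]. apply (Hfe a b). rewrite <- E. now apply near_lerp. }
  destruct (near_clustered e p q q) as [[E|[d E]] _]; trivial; [lra| |].
  { exists p, 0. rewrite lerp_0, <- E. assert (in_square (fl p) p).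
    { apply in_square_fl, (far_not_lattice e); trivial; lra. }
    repeat split; trivial; lra || apply H. }
  destruct (base_Int_part (fst p)) as [A1 A2], (base_Int_part (snd p)) as [A3 A4].
  destruct (base_Int_part (fst q)) as [B1 B2], (base_Int_part (snd q)) as [B3 B4].
  unfold crossing_of, in_square, fl in *; cbn [fst snd] in *.
  set (a := Int_part (fst p)) in *. set (b := Int_part (snd p)) in *.
  assert (Conv : forall s x y u v, 0 <= s <= 1 -> u <= x <= v -> u <= y <= v ->
    u <= (1 - s) * x + s * y <= v) by (intros; nra).
  destruct d; cbn [move fst snd] in E; injection E; intros E2 E1;
    rewrite E1, E2 in *; rewrite ?plus_IZR, ?minus_IZR in *.
  - destruct (hit_between (fst p) (fst q) (IZR a + 1)) as [s [Hs Es]]; try lra.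
    exists (lerp s p q), s. specialize (NL s Hs).
    assert (X : fst (lerp s p q) = _) by exact Es.
    assert (Y : IZR b <= snd (lerp s p q) <= IZR b + 1) by (apply Conv; lra).
    rewrite X.
    repeat split; trivial; lra.
  - destruct (hit_between (fst p) (fst q) (IZR a)) as [s [Hs Es]]; try lra.
    exists (lerp s p q), s. specialize (NL s Hs).
    assert (X : fst (lerp s p q) = _) by exact Es.
    assert (Y : IZR b <= snd (lerp s p q) <= IZR b + 1) by (apply Conv; lra).
    rewrite X.
    repeat split; trivial; lra.
  - destruct (hit_between (snd p) (snd q) (IZR b + 1)) as [s [Hs Es]]; try lra.
    exists (lerp s p q), s. specialize (NL s Hs).
    assert (X : snd (lerp s p q) = _) by exact Es.
    assert (Y : IZR a <= fst (lerp s p q) <= IZR a + 1) by (apply Conv; lra).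
    rewrite X.
    repeat split; trivial; lra.
  - destruct (hit_between (snd p) (snd q) (IZR b)) as [s [Hs Es]]; try lra.
    exists (lerp s p q), s. specialize (NL s Hs).
    assert (X : snd (lerp s p q) = _) by exact Es.
    assert (Y : IZR a <= fst (lerp s p q) <= IZR a + 1) by (apply Conv; lra).
    rewrite X.
    repeat split; trivial; lra.
Qed.

Definition crossing (p q : R * R) : R * R := epsilon (inhabits p) (crossing_of p q).

Lemma vlen_vscal c v : 0 <= c -> vlen (vscal c v) = c * vlen v.
Proof.
  intros Hc. unfold vlen, vscal; cbn [fst snd].
  replace ((c * fst v) ^ 2 + (c * snd v) ^ 2) with (c ^ 2 * (fst v ^ 2 + snd v ^ 2)) by ring.
  rewrite sqrt_mult_alt by apply pow2_ge_0. now rewrite sqrt_pow2.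
Qed.

Lemma vlen_split s p q : 0 <= s <= 1 ->
  vlen (vsub (lerp s p q) p) + vlen (vsub q (lerp s p q)) = vlen (vsub q p).
Proof.
  intros Hs.
  replace (vsub (lerp s p q) p) with (vscal s (vsub q p))
    by (unfold vscal, vsub, lerp; cbn [fst snd]; f_equal; ring).
  replace (vsub q (lerp s p q)) with (vscal (1 - s) (vsub q p))
    by (unfold vscal, vsub, lerp; cbn [fst snd]; f_equal; ring).
  rewrite !vlen_vscal by lra. ring.
Qed.

Lemma vlen_sq v : vlen v ^ 2 = fst v ^ 2 + snd v ^ 2.
Proof. unfold vlen. apply pow2_sqrt. generalize (pow2_ge_0 (fst v)) (pow2_ge_0 (snd v)); lra. Qed.

Lemma dot_le u v : fst u * fst v + snd u * snd v <= vlen u * vlen v.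
Proof.
  generalize (vlen_ge0 u) (vlen_ge0 v); intros Hu Hv.
  destruct (Rle_dec (fst u * fst v + snd u * snd v) 0) as [H|H].
  - apply Rle_trans with 0; trivial. now apply Rmult_le_pos.
  - apply Rsqr_incr_0_var; [|now apply Rmult_le_pos].
    unfold Rsqr.
    replace (vlen u * vlen v * (vlen u * vlen v)) with (vlen u ^ 2 * vlen v ^ 2) by ring.
    rewrite !vlen_sq.
    generalize (pow2_ge_0 (fst u * snd v - snd u * fst v)). nra.
Qed.

Lemma speed_cont P : sloop P -> forall t, continuous (fun t => vlen (velocity P t)) t.
Proof.
  intros HP t. destruct (velocity_cont P HP t) as [C1 C2].
  unfold vlen.
  apply (continuous_comp (fun t => fst (velocity P t) ^ 2 + snd (velocity P t) ^ 2) sqrt).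
  - simpl. cont.
  - apply continuity_pt_filterlim, continuity_pt_sqrt.
    generalize (pow2_ge_0 (fst (velocity P t))) (pow2_ge_0 (snd (velocity P t))); lra.
Qed.

(** The velocity is projected onto the chord v: its inner product with v integrates to |v|^2 and is
    at most |v| times the speed. *)
Lemma chord_le P a b : sloop P -> a <= b ->
  vlen (vsub (P b) (P a)) <= RInt (fun t => vlen (velocity P t)) a b.
Proof.
  intros HP Hab. set (v := vsub (P b) (P a)).
  assert (Hi : ex_RInt (fun t => vlen (velocity P t)) a b).
  { apply cont_ex_RInt. now apply speed_cont. }
  assert (H0 : 0 <= RInt (fun t => vlen (velocity P t)) a b).
  { apply RInt_ge_0; trivial. intros; apply vlen_ge0. }
  destruct (Req_dec (vlen v) 0) as [E|E]; [rewrite E; trivial|].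
  assert (Hv : 0 < vlen v) by (generalize (vlen_ge0 v); lra).
  assert (D : is_RInt (fun t => fst v * fst (velocity P t) + snd v * snd (velocity P t)) a b
                (fst v * fst v + snd v * snd v)).
  { set (F := fun t => fst v * fst (P t) + snd v * snd (P t)).
    replace (fst v * fst v + snd v * snd v) with (minus (F b) (F a))
      by (unfold F, v, vsub, minus, plus, opp; simpl; ring).
    apply (is_RInt_derive F).
    - intros t _. destruct (sloop_derive P HP t). unfold F.
      apply @is_derive_plus; now apply @is_derive_scal.
    - intros t _. destruct (velocity_cont P HP t). cont. }
  apply (Rmult_le_reg_l (vlen v)); trivial.
  replace (vlen v * vlen v) with (fst v * fst v + snd v * snd v)
    by (generalize (vlen_sq v); lra).
  rewrite <- (is_RInt_unique _ _ _ _ D).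
  replace (vlen v * RInt (fun t => vlen (velocity P t)) a b) with
    (RInt (fun t => vlen v * vlen (velocity P t)) a b).
  - apply RInt_le; trivial.
    + eexists; apply D.
    + now apply @ex_RInt_scal.
    + intros; apply dot_le.
  - apply is_RInt_unique. apply @is_RInt_scal. now apply @RInt_correct.
Qed.

Lemma inscribed_length P n : sloop P -> (0 < n)%nat ->
  psum (fun i => vlen (vsub (P (INR (S i) / INR n)) (P (INR i / INR n)))) n <=
  RInt (fun t => vlen (velocity P t)) 0 1.
Proof.
  intros HP Hn. assert (Hn0 : 0 < INR n) by (apply lt_0_INR; lia).
  cut (forall m, psum (fun i => vlen (vsub (P (INR (S i) / INR n)) (P (INR i / INR n)))) m <=
    RInt (fun t => vlen (velocity P t)) 0 (INR m / INR n)).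
  { intros H. generalize (H n). now replace (INR n / INR n) with 1 by (field; lra). }
  induction m as [|m IH].
  - simpl. replace (0 / INR n) with 0 by (field; lra). rewrite RInt_point.
    unfold zero; simpl; lra.
  - rewrite <- (RInt_Chasles _ 0 (INR m / INR n))
      by (apply cont_ex_RInt; now apply speed_cont).
    apply Rplus_le_compat; trivial. apply chord_le; trivial.
    apply Rmult_le_compat_r; [left; now apply Rinv_0_lt_compat|]. rewrite S_INR; lra.
Qed.

Lemma psum_double f n : psum f (2 * n) = psum (fun i => f (2 * i)%nat + f (2 * i + 1)%nat) n.
Proof.
  induction n as [|n IH]; trivial.
  replace (2 * S n)%nat with (S (S (2 * n))) by lia. cbn [psum]. rewrite IH.
  replace (S (2 * n)) with (2 * n + 1)%nat by lia. ring.
Qed.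

Lemma cross_le_vlen c u v : Rabs (fst u) <= c -> Rabs (snd u) <= c ->
  Rabs (cross u v) <= 2 * c * vlen v.
Proof.
  intros H1 H2. unfold cross, Rminus.
  eapply Rle_trans; [apply Rabs_triang|]. rewrite Rabs_Ropp, !Rabs_mult.
  assert (Hc : 0 <= c) by (generalize (Rabs_pos (fst u)); lra).
  apply Rle_trans with (c * (Rabs (fst v) + Rabs (snd v))).
  - generalize (Rabs_pos (fst v)) (Rabs_pos (snd v)). nra.
  - generalize (vlen_sum v). nra.
Qed.

Section Inscribed.
Variables (a : Z -> R * R) (L : Z -> list dir) (z0 : Z * Z) (n : nat) (e : R).
Hypothesis n_pos : (0 < n)%nat.
Hypothesis e_range : 0 < e <= 1.
Hypothesis a_per : periodic_seq n a.
Hypothesis L_per : periodic_seq n L.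
Hypothesis a_far : forall i, far (e + e) (a i).
Hypothesis a_near : forall i, near e (a i) (a (i + 1)%Z).
Hypothesis L_cell : forall i, cell z0 (L i) = fl (a i).
Hypothesis L_linked : forall i, linked (L i) (L (i + 1)%Z).

Definition vertex (k : Z) : R * R :=
  if Z.even k then a (k / 2) else crossing (a (k / 2)) (a (k / 2 + 1)).
(** The two edges at the sample a i, with numbers 2 i - 1 and 2 i, both lie in its square; hence the
    shift by one. *)
Definition label (k : Z) : list dir := L ((k + 1) / 2).
Definition edge_length (k : Z) : R := vlen (vsub (vertex (k + 1)) (vertex k)).

Lemma vertex_even i : vertex (2 * i) = a i.
Proof.
  unfold vertex. replace (Z.even (2 * i)) with true by now rewrite Z.even_mul. f_equal.
  rewrite Z.mul_comm. apply Z.div_mul; lia.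
Qed.

Lemma half_odd i : ((2 * i + 1) / 2)%Z = i.
Proof. symmetry; apply (Z.div_unique _ _ _ 1); lia. Qed.

Lemma vertex_odd i : vertex (2 * i + 1) = crossing (a i) (a (i + 1)%Z).
Proof. unfold vertex. rewrite Z.even_add, Z.even_mul, half_odd. reflexivity. Qed.

Lemma label_even i : label (2 * i) = L i.
Proof. unfold label. now rewrite half_odd. Qed.

Lemma label_odd i : label (2 * i + 1) = L (i + 1)%Z.
Proof.
  unfold label. f_equal. replace (2 * i + 1 + 1)%Z with ((i + 1) * 2)%Z by ring.
  apply Z.div_mul; lia.
Qed.

Lemma odd_succ i : (2 * i + 1 + 1 = 2 * (i + 1))%Z.
Proof. ring. Qed.

Lemma crossing_spec i : crossing_of (a i) (a (i + 1)%Z) (crossing (a i) (a (i + 1)%Z)).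
Proof.
  apply (epsilon_spec (inhabits (a i)) (crossing_of (a i) (a (i + 1)%Z))).
  now apply (crossing_exists e).
Qed.

Lemma a_in i : in_square (cell z0 (L i)) (a i).
Proof. rewrite L_cell. apply in_square_fl, (far_not_lattice (e + e)); auto; lra. Qed.

Lemma vertex_walk D : (forall i, (length (L i) <= D)%nat) ->
  walk z0 D (2 * n) vertex label (fun k => 12 / 5 * edge_length k).
Proof.
  intros HD. split.
  - intros k. destruct (Z.Even_or_Odd k) as [[i ->]|[i ->]].
    + replace (2 * i + Z.of_nat (2 * n))%Z with (2 * (i + Z.of_nat n))%Z by lia.
      now rewrite !vertex_even.
    + replace (2 * i + 1 + Z.of_nat (2 * n))%Z with (2 * (i + Z.of_nat n) + 1)%Z by lia.
      rewrite !vertex_odd. replace (i + Z.of_nat n + 1)%Z with (i + 1 + Z.of_nat n)%Z by ring.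
      now rewrite !a_per.
  - intros k. destruct (Z.Even_or_Odd k) as [[i ->]|[i ->]].
    + replace (2 * i + Z.of_nat (2 * n))%Z with (2 * (i + Z.of_nat n))%Z by lia.
      now rewrite !label_even.
    + replace (2 * i + 1 + Z.of_nat (2 * n))%Z with (2 * (i + Z.of_nat n) + 1)%Z by lia.
      rewrite !label_odd. replace (i + Z.of_nat n + 1)%Z with (i + 1 + Z.of_nat n)%Z by ring.
      now rewrite !L_per.
  - intros k. destruct (Z.Even_or_Odd k) as [[i ->]|[i ->]].
    + rewrite vertex_even, label_even. apply a_in.
    + rewrite vertex_odd, label_odd, L_cell. now destruct (crossing_spec i) as [s [_ [_ [_ H]]]].
  - intros k. destruct (Z.Even_or_Odd k) as [[i ->]|[i ->]].
    + rewrite vertex_odd, label_even, L_cell. now destruct (crossing_spec i) as [s [_ [_ [H _]]]].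
    + rewrite odd_succ, vertex_even, label_odd. apply a_in.
  - intros k. destruct (Z.Even_or_Odd k) as [[i ->]|[i ->]].
    + rewrite label_even, label_odd. apply L_linked.
    + rewrite odd_succ, label_even, label_odd. now left.
  - intros k. apply HD.
  - intros k. right. unfold edge_length. lra.
Qed.

(** The crossing lies on the chord, so inserting it adds no length. *)
Lemma edge_length_pair i : edge_length (2 * i) + edge_length (2 * i + 1) =
  vlen (vsub (a (i + 1)%Z) (a i)).
Proof.
  unfold edge_length. rewrite odd_succ, !vertex_even, vertex_odd.
  destruct (crossing_spec i) as [s [Hs [-> _]]]. now apply vlen_split.
Qed.

Lemma perimeter : psum (fun i => edge_length (Z.of_nat i)) (2 * n) =
  psum (fun i => vlen (vsub (a (Z.of_nat i + 1)%Z) (a (Z.of_nat i)))) n.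
Proof.
  rewrite psum_double. apply Rle_antisym; apply psum_le; intros i _; right;
    rewrite <- edge_length_pair; f_equal; f_equal; lia.
Qed.

Lemma near_vertex k : near e (a (k / 2)) (vertex k) /\ near e (a (k / 2)) (vertex (k + 1)).
Proof.
  assert (C : forall i, near e (a i) (crossing (a i) (a (i + 1)%Z))).
  { intros i. destruct (crossing_spec i) as [s [Hs [-> _]]].
    apply near_lerp; auto. apply near_refl; lra. }
  destruct (Z.Even_or_Odd k) as [[i ->]|[i ->]].
  - rewrite vertex_odd, vertex_even. replace (2 * i / 2)%Z with i.
    + split; auto. apply near_refl; lra.
    + symmetry. rewrite Z.mul_comm. apply Z.div_mul; lia.
  - rewrite odd_succ, vertex_even, vertex_odd, half_odd. auto.
Qed.
End Inscribed.

Lemma near_vsub e p q r : near e p q -> near e p r ->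
  Rabs (fst (vsub r q)) <= 2 * e /\ Rabs (snd (vsub r q)) <= 2 * e.
Proof.
  intros [H1 H2] [H3 H4]. apply Rabs_def2 in H1, H2, H3, H4.
  unfold vsub; cbn [fst snd]. split; apply Rabs_le; lra.
Qed.

(** Loop and polygon differ by at most 2 e in each coordinate, so the determinant with a velocity v
    is at most 4 e |v|. Both curves have at most the length of P, and so have the two swept
    integrals at most 4 e times that length. *)
Lemma Chain_inscribed P N p e A :
  sloop P -> (0 < N)%nat -> periodic_seq N p ->
  (forall t, exists q, far e q /\ near e q (P t) /\ near e q (polygon N p t)) ->
  psum (fun i => vlen (vsub (p (Z.of_nat i + 1)%Z) (p (Z.of_nat i)))) N <=
    RInt (fun t => vlen (velocity P t)) 0 1 ->
  Chain (polygon N p) A ->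
  Chain P (4 * e * RInt (fun t => vlen (velocity P t)) 0 1 + A).
Proof.
  intros HP HN Hp Hq Hl HC. set (len := RInt _ 0 1) in *.
  assert (He : 0 < e).
  { destruct (Hq 0) as [q [_ [[H _] _]]]. generalize (Rabs_pos (fst q - fst (P 0))); lra. }
  assert (HG := polygon_sloop N p Hp).
  assert (Hc : forall t v, Rabs (cross (vsub (polygon N p t) (P t)) v) <= 4 * e * vlen v).
  { intros t v. destruct (Hq t) as [q [_ [H1 H2]]].
    destruct (near_vsub e q _ _ H1 H2) as [B1 B2].
    generalize (cross_le_vlen (2 * e) _ v B1 B2). lra. }
  apply Chain_step with (polygon N p); trivial.
  - intros s t Hs [a [b E]]. destruct (Hq t) as [q [Hf [H1 H2]]].
    apply (Hf a b). rewrite <- E. now apply near_lerp.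
  - assert (I1 : RInt (fun t => Rabs (cross (vsub (polygon N p t) (P t)) (velocity P t))) 0 1
                 <= 4 * e * len).
    { replace (4 * e * len) with (RInt (fun t => 4 * e * vlen (velocity P t)) 0 1).
      - apply RInt_le; [lra | now apply swept_ex_RInt | |auto].
        apply @ex_RInt_scal. apply cont_ex_RInt. now apply speed_cont.
      - apply is_RInt_unique. apply @is_RInt_scal, @RInt_correct.
        apply cont_ex_RInt. now apply speed_cont. }
    assert (I2 : RInt (fun t => Rabs (cross (vsub (polygon N p t) (P t))
                   (velocity (polygon N p) t))) 0 1 <= 4 * e * len).
    { set (W := fun i => 4 * e * vlen (vsub (p (Z.of_nat i + 1)%Z) (p (Z.of_nat i)))).
      apply Rle_trans with (psum (fun i => (W i + W i) / 2) N).
      - apply RInt_pieces; trivial.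
        + now apply swept_ex_RInt.
        + intros i t Ht. eapply Rle_trans; [apply Hc|].
          assert (Hi : INR i = IZR (Z.of_nat i)) by apply INR_IZR_INZ.
          rewrite Hi in Ht |- *.
          rewrite (polygon_velocity N p (Z.of_nat i)) by trivial.
          rewrite vlen_vscal.
          * unfold W. right; ring.
          * apply Rmult_le_pos; [apply pos_INR | apply sg'_ge0].
      - apply Rle_trans with (psum W N).
        + apply psum_le; intros; lra.
        + unfold W. rewrite psum_scal. apply Rmult_le_compat_l; lra. }
    lra.
Qed.

(** * From a contractible loop to a chain *)

Lemma bounded_lengths (f : nat -> list dir) n :
  exists D, forall i, (i <= n)%nat -> (length (f i) <= D)%nat.
Proof.
  induction n as [|n [D IH]].
  - exists (length (f O)). intros i Hi. now replace i with O by lia.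
  - exists (Nat.max D (length (f (S n)))). intros i Hi.
    destruct (Nat.eq_dec i (S n)) as [->|Hn]; [lia|].
    specialize (IH i ltac:(lia)). lia.
Qed.

Lemma contractible_Chain alpha : sloop alpha -> contractible_loop alpha ->
  Chain alpha ((1 + sqrt 2) * RInt (fun t => vlen (velocity alpha t)) 0 1).
Proof.
  intros Hs [H [c [HC [H0 [H1 [Hper Hav]]]]]].
  (* With e <= 1/400 the passage to the polygon costs at most 1/100 of the length, and 12/5 + 1/100
     = 241/100 <= 1 + sqrt 2. *)
  destruct (homotopy_scale H (1 / 400)) as [e [n [He [Hn [Hfar Hnear]]]]]; trivial; [lra|].
  assert (Hn0 : 0 < INR n) by (apply lt_0_INR; lia).
  (* The time of the homotopy is reversed: row 0 lies over the constant loop, whose square is the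
     root, and row n over the given loop. *)
  set (F := fun j i => fl (H (1 - INR j / INR n, INR i / INR n))).
  set (z0 := fl c).
  assert (Hj : forall j, (j <= n)%nat -> 0 <= 1 - INR j / INR n <= 1).
  { intros j Hj. apply le_INR in Hj.
    assert (0 <= INR j / INR n) by (apply Rdiv_le_0_compat; [apply pos_INR | trivial]).
    assert (INR j / INR n <= 1) by (apply Rle_div_l; lra). lra. }
  assert (Step : forall j, INR (S j) / INR n - INR j / INR n = / INR n).
  { intros j. rewrite S_INR. field; lra. }
  assert (Inv : 0 < / INR n) by now apply Rinv_0_lt_compat.
  assert (Hnear' : forall j j' i i', (j <= n)%nat -> (j' <= n)%nat ->
    (j = j' \/ j' = S j \/ j = S j') -> (i = i' \/ i' = S i \/ i = S i') ->
    near e (H (1 - INR j / INR n, INR i / INR n)) (H (1 - INR j' / INR n, INR i' / INR n))).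
  { intros j j' i i' Lj Lj' Cj Ci.
    assert (S1 := Step j). assert (S2 := Step j'). assert (S3 := Step i). assert (S4 := Step i').
    apply Hnear; auto; apply Rabs_le.
    - destruct Cj as [->|[->| ->]]; lra.
    - destruct Ci as [->|[->| ->]]; lra. }
  assert (F_row0 : forall i, F 0%nat i = z0).
  { intros i. unfold F, z0. simpl INR at 1.
    replace (1 - 0 / INR n) with 1 by (field; lra). now rewrite H1. }
  assert (F_per : forall j, (j <= n)%nat -> F j n = F j 0%nat).
  { intros j Lj. unfold F. f_equal. simpl INR at 4.
    replace (INR n / INR n) with (0 / INR n + 1) by (field; lra). auto. }
  assert (F_cell : forall j i, (j < n)%nat ->
    clustered (F j i) (F j (S i)) (F (S j) (S i)) /\
    clustered (F j i) (F (S j) i) (F (S j) (S i))).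
  { intros j i Lj. split; apply (near_clustered e); try (apply Hnear'; auto; lia); try lra;
      apply (far_mono (e + e)); try lra; apply Hfar, Hj; lia. }
  set (l := lift z0 F n).
  assert (l_closed : l n = l 0%nat) by (apply lift_closed; trivial).
  assert (l_cell : forall i, cell z0 (l i) = F n i) by (intros i; now apply (lift_spec z0 F n)).
  assert (l_linked : forall i, linked (l i) (l (S i))) by (intros i; now apply (lift_spec z0 F n)).
  destruct (bounded_lengths l n) as [D HD].
  set (a := fun i : Z => alpha (IZR i / INR n)).
  (* The labels of one period are repeated; the closedness of the lift makes the last and the first
     of them linked. *)
  set (L := fun i : Z => l (Z.to_nat (i mod Z.of_nat n))).
  assert (Hper' := proj2 (proj2 Hs)).
  assert (a_per : periodic_seq n a).
  { intros i. unfold a. rewrite plus_IZR, <- INR_IZR_INZ, <- (Hper' (IZR i / INR n)).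
    f_equal. field; lra. }
  assert (L_per : periodic_seq n L).
  { intros i. unfold L. do 2 f_equal.
    replace (i + Z.of_nat n)%Z with (i + 1 * Z.of_nat n)%Z by ring. apply Z_mod_plus_full. }
  assert (a_far : forall i, far (e + e) (a i)).
  { intros i. unfold a. rewrite <- H0. apply Hfar; lra. }
  assert (alpha_near : forall t t', Rabs (t - t') <= / INR n -> near e (alpha t) (alpha t')).
  { intros t t' Ht. rewrite <- !H0. apply Hnear; trivial; try lra.
    rewrite Rminus_diag, Rabs_R0; lra. }
  assert (a_near : forall i, near e (a i) (a (i + 1)%Z)).
  { intros i. apply alpha_near. rewrite plus_IZR.
    replace (IZR i / INR n - (IZR i + 1) / INR n) with (- / INR n) by (field; lra).
    rewrite Rabs_Ropp, Rabs_pos_eq; lra. }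
  assert (Hmod : forall i, (0 <= i mod Z.of_nat n < Z.of_nat n)%Z).
  { intros i. apply Z.mod_pos_bound; lia. }
  assert (L_cell : forall i, cell z0 (L i) = fl (a i)).
  { intros i. unfold L, a. rewrite l_cell. unfold F.
    replace (1 - INR n / INR n) with 0 by (field; lra). rewrite H0. f_equal.
    rewrite INR_IZR_INZ, Z2Nat.id by apply Hmod.
    rewrite <- (per_Z alpha Hper' (i / Z.of_nat n)). f_equal.
    rewrite (Z.div_mod i (Z.of_nat n)) at 3 by lia.
    rewrite plus_IZR, mult_IZR, <- (INR_IZR_INZ n). field; lra. }
  assert (L_linked : forall i, linked (L i) (L (i + 1)%Z)).
  { intros i. unfold L. set (r := Z.to_nat (i mod Z.of_nat n)).
    assert (Hr : (r < n)%nat) by (generalize (Hmod i); unfold r; lia).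
    replace (l (Z.to_nat ((i + 1) mod Z.of_nat n))) with (l (S r)); trivial.
    assert (Ei : (i + 1 = Z.of_nat (S r) + i / Z.of_nat n * Z.of_nat n)%Z).
    { unfold r. rewrite Nat2Z.inj_succ, Z2Nat.id by apply Hmod.
      generalize (Z.div_mod i (Z.of_nat n)). lia. }
    rewrite Ei, Z_mod_plus_full. destruct (Nat.eq_dec (S r) n) as [E|E].
    - rewrite E, Z_mod_same_full. exact l_closed.
    - rewrite Z.mod_small, Nat2Z.id by lia. reflexivity. }
  assert (W : walk z0 D (2 * n) (vertex a) (label L) (fun k => 12 / 5 * edge_length a k)).
  { apply vertex_walk with e; trivial; [lra|]. intros i. apply HD.
    generalize (Hmod i); lia. }
  assert (He1 : 0 < e <= 1) by lra.
  assert (Per := perimeter a n e Hn He1 a_far a_near).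
  assert (Hlen : psum (fun i => edge_length a (Z.of_nat i)) (2 * n) <=
    RInt (fun t => vlen (velocity alpha t)) 0 1).
  { rewrite Per. eapply Rle_trans; [|apply (inscribed_length alpha n Hs Hn)].
    apply psum_le; intros i _; right. unfold a.
    rewrite plus_IZR, S_INR, <- INR_IZR_INZ. reflexivity. }
  assert (C := walk_Chain z0 D (2 * n) _ _ _ ltac:(lia) W).
  cbv beta in C.
  rewrite (psum_scal (12 / 5) (fun i => edge_length a (Z.of_nat i))) in C.
  set (len := RInt _ 0 1) in *.
  assert (Len0 : 0 <= len).
  { apply RInt_ge_0; [lra | apply cont_ex_RInt; now apply speed_cont|].
    intros; apply vlen_ge0. }
  eapply Chain_le.
  - apply (Chain_inscribed alpha (2 * n) (vertex a) e); try eassumption; [lia | apply W |].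
    (* The polygon has two edges per sample interval, so at time t it is on edge k of the interval
       that starts at the sample k / 2, and this interval also contains t. *)
    intros t. set (k := Int_part (INR (2 * n) * t)). exists (a (k / 2)%Z).
    destruct (near_vertex a n e Hn He1 a_far a_near k) as [V1 V2].
    split; [apply (far_mono (e + e)); trivial; lra|]. split.
    + apply alpha_near.
      destruct (base_Int_part (INR (2 * n) * t)) as [B1 B2]. fold k in B1, B2.
      rewrite mult_INR in B1, B2. simpl (INR 2) in B1, B2.
      assert (K1 : (2 * (k / 2) <= k)%Z) by (apply Z.mul_div_le; lia).
      assert (K2 : (k + 1 <= 2 * (k / 2) + 2)%Z).
      { generalize (Z.mul_succ_div_gt k 2). lia. }
      apply IZR_le in K1, K2. rewrite !plus_IZR, !mult_IZR in K2. rewrite mult_IZR in K1.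
      set (h := IZR (k / 2)) in *.
      replace (h / INR n - t) with ((h - INR n * t) / INR n) by (field; lra).
      unfold Rdiv. rewrite Rabs_mult, (Rabs_pos_eq (/ INR n)) by lra.
      rewrite <- (Rmult_1_l (/ INR n)) at 2. apply Rmult_le_compat_r; [lra|].
      apply Rabs_le. lra.
    + unfold polygon. fold k. apply near_lerp; trivial. apply sg_range.
  - assert (S2 : 141 / 100 <= sqrt 2).
    { rewrite <- (sqrt_pow2 (141 / 100)) by lra. apply sqrt_le_1_alt; lra. }
    assert (4 * e * len <= 1 / 100 * len) by (apply Rmult_le_compat_r; lra).
    assert (241 / 100 * len <= (1 + sqrt 2) * len) by (apply Rmult_le_compat_r; lra).
    fold len. lra.
Qed.

Theorem theorem1p1 (alpha : R -> R * R) :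
  periodic_loop alpha ->
  smooth_loop alpha ->
  avoids_lattice alpha ->
  contractible_loop alpha ->
  Rbar_le (Area alpha) (Finite ((1 + sqrt 2) * Length alpha)).
Proof.
  intros Hper Hsm _ Hcon.
  apply (Chain_Area alpha ((1 + sqrt 2) * Length alpha)).
  apply (contractible_Chain alpha); trivial.
  split; [|split; [|exact Hper]]; apply ex_derive_n_smooth1; intros n t; apply Hsm.
Qed.
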